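(* Let $\Lambda$ be a finite dimensional associative algebra over a field $k$ with a distinguished idempotent $e$ such that $\Lambda e\Lambda$ is a strongly stratifying ideal, and let $f=1-e$. The algebra $\Lambda$ verifies Han's conjecture if and only if the algebra $e\Lambda e\times f\Lambda f$ verifies Han's conjecture.
   Context: Throughout, ''algebra'' means a finite dimensional associative unital algebra over a fixed field $k$. For an algebra $\Lambda$, $HH_*(\Lambda)=\mathrm{Tor}_*^{\Lambda\otimes_k\Lambda^{\mathrm{op}}}(\Lambda,\Lambda)$ is its Hochschild homology; it is called finite if there is $N$ with $HH_m(\Lambda)=0$ for all $m>N$. An algebra $\Lambda$ verifies Han's conjecture (equivalently, Han's conjecture holds, or is true, for $\Lambda$) if the following implication holds: if $HH_*(\Lambda)$ is finite, then $\Lambda$ has finite global dimension. Let $e\in\Lambda$ be an idempotent and $f=1-e$. The ideal $\Lambda e\Lambda$ is strongly stratifying if: (1) $\mathrm{Tor}_n^{e\Lambda e}(\Lambda e,e\Lambda)=0$ for $n>0$; (2) $f\Lambda e\otimes_{e\Lambda e}e\Lambda f=0$; (3) $\mathrm{Tor}_n^{f\Lambda f}(\Lambda f,f\Lambda)=0$ for $n>0$. The algebras $e\Lambda e$ and $f\Lambda f$ have units $e$ and $f$ respectively. *)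

(* Defs.v *)
From HB Require Import structures.
From mathcomp Require Import all_boot all_order all_algebra.
From mathcomp Require Import boolp.

Set Implicit Arguments.
Unset Strict Implicit.
Unset Printing Implicit Defensive.

Import GRing.Theory.
Local Open Scope ring_scope.
Local Open Scope quotient_scope.

(* Finite dimensional unital associative algebras over k.  MathComp's algType
   and falgType require 1 != 0, which is not assumed here: the corner e A e of
   an algebra A is the zero algebra when e = 0.                               *)
Record fdAlg (k : fieldType) := FDAlg {
  alg_vect : vectType k;
  alg_one : alg_vect;
  alg_mul : alg_vect -> alg_vect -> alg_vect;
  alg_mulA : associative alg_mul;
  alg_mul1l : left_id alg_one alg_mul;
  alg_mul1r : right_id alg_one alg_mul;
  alg_mulDl : left_distributive alg_mul +%R;
  alg_mulDr : right_distributive alg_mul +%R;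
  alg_scaleAl : forall c x y, c *: alg_mul x y = alg_mul (c *: x) y;
  alg_scaleAr : forall c x y, c *: alg_mul x y = alg_mul x (c *: y)
}.

Definition alg_sort (k : fieldType) (A : fdAlg k) : Type := alg_vect A.
Coercion alg_sort : fdAlg >-> Sortclass.
HB.instance Definition _ (k : fieldType) (A : fdAlg k) :=
  Vector.on (alg_sort A).
HB.instance Definition _ (k : fieldType) (A : fdAlg k) :=
  GRing.Zmodule_isPzRing.Build (alg_sort A)
    (@alg_mulA k A) (@alg_mul1l k A) (@alg_mul1r k A)
    (@alg_mulDl k A) (@alg_mulDr k A).

Lemma fdscaleAl (k : fieldType) (A : fdAlg k) (c : k) (x y : A) :
  c *: (x * y) = (c *: x) * y.
Proof. exact: alg_scaleAl. Qed.

Lemma fdscaleAr (k : fieldType) (A : fdAlg k) (c : k) (x y : A) :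
  c *: (x * y) = x * (c *: y).
Proof. exact: alg_scaleAr. Qed.

Section ProductAlgebra.
Variables (k : fieldType) (A B : fdAlg k).

Fact prod_alg_scaleAl (c : k) (x y : A * B) : c *: (x * y) = (c *: x) * y.
Proof. by congr pair; apply: fdscaleAl. Qed.

Fact prod_alg_scaleAr (c : k) (x y : A * B) : c *: (x * y) = x * (c *: y).
Proof. by congr pair; apply: fdscaleAr. Qed.

Definition prod_alg : fdAlg k :=
  @FDAlg k (A * B)%type 1 *%R (@mulrA (A * B)%type) (@mul1r (A * B)%type)
    (@mulr1 (A * B)%type) (@mulrDl (A * B)%type) (@mulrDr (A * B)%type)
    prod_alg_scaleAl prod_alg_scaleAr.
End ProductAlgebra.

Section Idempotents.
Variables (k : fieldType) (A : fdAlg k).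

Record idem := Idem {
  idem_val :> A;
  idemP : idem_val * idem_val = idem_val
}.

Definition idem1 : idem := Idem (mulr1 (1 : A)).

Fact idemC_subproof (e : idem) :
  (1 - (e : A)) * (1 - (e : A)) = 1 - (e : A).
Proof. by rewrite mulrBr mulr1 mulrBl mul1r idemP subrr subr0. Qed.
Definition idemC (e : idem) : idem := Idem (idemC_subproof e).
End Idempotents.
Arguments idem1 {k} A.

Section Peirce.
Variables (k : fieldType) (A : fdAlg k).

(* peirce g e is g A e = {g x e | x in A}; in particular peirce 1 e is A e and
   peirce e 1 is e A.                                                         *)
Definition peirce_fun (g e : A) (x : A) : A := g * x * e.
Fact peirce_fun_linear g e : linear (peirce_fun g e).
Proof.
move=> c x y; rewrite /peirce_fun mulrDr mulrDl; congr (_ + _).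
by rewrite -fdscaleAr -fdscaleAl.
Qed.
HB.instance Definition _ g e := GRing.isLinear.Build k A A _ (peirce_fun g e)
  (peirce_fun_linear g e).
Definition peirce_space (g e : A) : {vspace A} := limg (linfun (peirce_fun g e)).
Definition peirce (g e : A) : Type := subvs_of (peirce_space g e).
HB.instance Definition _ g e := Vector.on (peirce g e).

Lemma peirce_spaceP g e (x : A) :
  reflect (exists y, x = g * y * e) (x \in peirce_space g e).
Proof.
apply: (iffP memv_imgP) => [[y _ ->]|[y ->]].
  by exists y; rewrite lfunE.
by exists y; rewrite ?memvf // lfunE.
Qed.

Lemma peirce_idl (g : idem A) (e : A) (x : peirce g e) : (g : A) * vsval x = vsval x.
Proof. by case/peirce_spaceP: (subvsP x) => y ->; rewrite !mulrA idemP. Qed.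

Lemma peirce_idr (g : A) (e : idem A) (x : peirce g e) : vsval x * (e : A) = vsval x.
Proof. by case/peirce_spaceP: (subvsP x) => y ->; rewrite -!mulrA idemP. Qed.

Fact peirce_mul_subproof (g h e : A) (x : peirce g h) (y : peirce h e) :
  vsval x * vsval y \in peirce_space g e.
Proof.
case/peirce_spaceP: (subvsP x) => a ->; case/peirce_spaceP: (subvsP y) => b ->.
by apply/peirce_spaceP; exists (a * h * (h * b)); rewrite !mulrA.
Qed.
Definition peirce_mul (g h e : A) (x : peirce g h) (y : peirce h e) : peirce g e :=
  Subvs (peirce_mul_subproof x y).

Fact peirce_one_subproof (e : idem A) : (e : A) \in peirce_space e e.
Proof. by apply/peirce_spaceP; exists 1; rewrite mulr1 idemP. Qed.
Definition peirce_one (e : idem A) : peirce e e := Subvs (peirce_one_subproof e).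

Fact peirce_mulA (g h i e : A)
    (x : peirce g h) (y : peirce h i) (z : peirce i e) :
  peirce_mul x (peirce_mul y z) = peirce_mul (peirce_mul x y) z.
Proof. by apply: val_inj; rewrite /= mulrA. Qed.

Fact peirce_mul1l (g : idem A) (e : A) (x : peirce g e) :
  peirce_mul (peirce_one g) x = x.
Proof. by apply: val_inj; rewrite /= peirce_idl. Qed.

Fact peirce_mul1r (g : A) (e : idem A) (x : peirce g e) :
  peirce_mul x (peirce_one e) = x.
Proof. by apply: val_inj; rewrite /= peirce_idr. Qed.

Fact peirce_mulDl (g h e : A) (x y : peirce g h) (z : peirce h e) :
  peirce_mul (x + y) z = peirce_mul x z + peirce_mul y z.
Proof. by apply: val_inj; rewrite /= mulrDl. Qed.

Fact peirce_mulDr (g h e : A) (x : peirce g h) (y z : peirce h e) :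
  peirce_mul x (y + z) = peirce_mul x y + peirce_mul x z.
Proof. by apply: val_inj; rewrite /= mulrDr. Qed.

Fact peirce_scaleAl (g h e : A) c (x : peirce g h) (y : peirce h e) :
  c *: peirce_mul x y = peirce_mul (c *: x) y.
Proof. by apply: val_inj; rewrite /= fdscaleAl. Qed.

Fact peirce_scaleAr (g h e : A) c (x : peirce g h) (y : peirce h e) :
  c *: peirce_mul x y = peirce_mul x (c *: y).
Proof. by apply: val_inj; rewrite /= fdscaleAr. Qed.

Definition corner (e : idem A) : fdAlg k :=
  @FDAlg k (peirce e e) (peirce_one e) (@peirce_mul e e e)
    (@peirce_mulA e e e e) (@peirce_mul1l e e) (@peirce_mul1r e e)
    (@peirce_mulDl e e e) (@peirce_mulDr e e e)
    (@peirce_scaleAl e e e) (@peirce_scaleAr e e e).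

(* g A e as a left module over g A g *)
Definition lpeirce (g e : idem A) : Type := peirce g e.
HB.instance Definition _ (g e : idem A) := GRing.Zmodule.on (lpeirce g e).

Definition lpeirce_scale (g e : idem A) (a : corner g) (x : lpeirce g e) :
  lpeirce g e := peirce_mul a x.
Fact lpeirce_scaleA (g e : idem A) (a b : corner g) (x : lpeirce g e) :
  lpeirce_scale a (lpeirce_scale b x) = lpeirce_scale (a * b) x.
Proof. exact: peirce_mulA. Qed.
Fact lpeirce_scale1 (g e : idem A) : left_id 1 (@lpeirce_scale g e).
Proof. exact: peirce_mul1l. Qed.
Fact lpeirce_scaleDr (g e : idem A) : right_distributive (@lpeirce_scale g e) +%R.
Proof. exact: peirce_mulDr. Qed.
Fact lpeirce_scaleDl (g e : idem A) (x : lpeirce g e) :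
  {morph (@lpeirce_scale g e)^~ x : a b / a + b}.
Proof. by move=> a b; apply: peirce_mulDl. Qed.
HB.instance Definition _ (g e : idem A) :=
  GRing.Zmodule_isLmodule.Build (corner g) (lpeirce g e) (@lpeirce_scaleA g e)
    (@lpeirce_scale1 g e) (@lpeirce_scaleDr g e) (@lpeirce_scaleDl g e).

(* g A e as a right module over e A e *)
Definition rpeirce (g e : idem A) : Type := peirce g e.
HB.instance Definition _ (g e : idem A) := GRing.Zmodule.on (rpeirce g e).

Definition rpeirce_scale (g e : idem A) (a : (corner e)^c) (x : rpeirce g e) :
  rpeirce g e := peirce_mul x (a : corner e).
Fact rpeirce_scaleA (g e : idem A) (a b : (corner e)^c) (x : rpeirce g e) :
  rpeirce_scale a (rpeirce_scale b x) = rpeirce_scale (a * b) x.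
Proof. by symmetry; apply: peirce_mulA. Qed.
Fact rpeirce_scale1 (g e : idem A) : left_id 1 (@rpeirce_scale g e).
Proof. exact: peirce_mul1r. Qed.
Fact rpeirce_scaleDr (g e : idem A) : right_distributive (@rpeirce_scale g e) +%R.
Proof. by move=> a x y; apply: peirce_mulDl. Qed.
Fact rpeirce_scaleDl (g e : idem A) (x : rpeirce g e) :
  {morph (@rpeirce_scale g e)^~ x : a b / a + b}.
Proof. by move=> a b; apply: peirce_mulDr. Qed.
HB.instance Definition _ (g e : idem A) :=
  GRing.Zmodule_isLmodule.Build (corner e)^c (rpeirce g e) (@rpeirce_scaleA g e)
    (@rpeirce_scale1 g e) (@rpeirce_scaleDr g e) (@rpeirce_scaleDl g e).
End Peirce.

(* The tensor product of M and N over R, where R acts on M by ra (on the right) and on N by la (on the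
   left).  Elements of the tensor product are classes of finite formal sums of
   pairs (m, n); no formal opposites are needed, as - (m, n) is (- m, n).     *)
Section Tensor.
Variables (R : Type) (M N : zmodType) (ra : R -> M -> M) (la : R -> N -> N).

Inductive tens_rel : seq (M * N) -> seq (M * N) -> Prop :=
| tens_refl s : tens_rel s s
| tens_sym s t : tens_rel s t -> tens_rel t s
| tens_trans s t u : tens_rel s t -> tens_rel t u -> tens_rel s u
| tens_cat s s' t t' :
    tens_rel s s' -> tens_rel t t' -> tens_rel (s ++ t) (s' ++ t')
| tens_catC s t : tens_rel (s ++ t) (t ++ s)
| tens_0l n : tens_rel [:: (0, n)] [::]
| tens_0r m : tens_rel [:: (m, 0)] [::]
| tens_Dl m m' n : tens_rel [:: (m + m', n)] [:: (m, n); (m', n)]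
| tens_Dr m n n' : tens_rel [:: (m, n + n')] [:: (m, n); (m, n')]
| tens_bal r m n : tens_rel [:: (ra r m, n)] [:: (m, la r n)].

Definition tens_relb : rel (seq (M * N)) := fun s t => `[< tens_rel s t >].

Fact tens_relb_equiv : equiv_class_of tens_relb.
Proof.
split=> [s|s t|t s u].
- exact/asboolP/tens_refl.
- by apply/asboolP/asboolP; apply: tens_sym.
- by move=> /asboolP st /asboolP tu; apply/asboolP; apply: tens_trans st tu.
Qed.
Canonical tens_equiv := EquivRelPack tens_relb_equiv.

Definition tens : Type := {eq_quot tens_equiv}.
HB.instance Definition _ := Choice.on tens.
HB.instance Definition _ : EqQuotient _ tens_equiv tens := EqQuotient.on tens.

Definition tens_cls (s : seq (M * N)) : tens := \pi_tens s.

Lemma tens_clsP s t : tens_cls s = tens_cls t <-> tens_rel s t.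
Proof. by split=> [/eqquotP/asboolP|H]; last exact/eqquotP/asboolP. Qed.

Lemma tens_clsK (x : tens) : tens_cls (repr x) = x.
Proof. exact: reprK. Qed.

Lemma tens_repr s : tens_rel (repr (tens_cls s)) s.
Proof. by apply/tens_clsP; rewrite tens_clsK. Qed.

Lemma tens_ind (P : tens -> Prop) : (forall s, P (tens_cls s)) -> forall x, P x.
Proof. by move=> Ps x; rewrite -[x]tens_clsK. Qed.

Definition tens0 : tens := tens_cls [::].
Definition tens_add (x y : tens) : tens := tens_cls (repr x ++ repr y).
Definition tens_opp (x : tens) : tens :=
  tens_cls [seq (- p.1, p.2) | p <- repr x].

Lemma tens_addE s t : tens_add (tens_cls s) (tens_cls t) = tens_cls (s ++ t).
Proof. by apply/tens_clsP; apply: tens_cat; apply: tens_repr. Qed.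

Fact tens_addA : associative tens_add.
Proof.
elim/tens_ind=> s; elim/tens_ind=> t; elim/tens_ind=> u.
by rewrite !tens_addE catA.
Qed.

Fact tens_addC : commutative tens_add.
Proof.
elim/tens_ind=> s; elim/tens_ind=> t.
by rewrite !tens_addE; apply/tens_clsP/tens_catC.
Qed.

Fact tens_add0 : left_id tens0 tens_add.
Proof. by elim/tens_ind=> s; rewrite tens_addE. Qed.

Lemma tens_rel_perm s t : perm_eq s t -> tens_rel s t.
Proof.
elim: s t => [|x s IHs] t.
  by rewrite perm_sym => /perm_nilP ->; apply: tens_refl.
move=> st; have tx : x \in t by rewrite -(perm_mem st) mem_head.
case/splitPr: tx st => t1 t2 st.
have {}st : perm_eq s (t2 ++ t1).
  by rewrite -(perm_cons x) (permPl st) perm_catC.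
apply: tens_trans (tens_catC (x :: t2) t1).
exact: (tens_cat (tens_refl [:: x]) (IHs _ st)).
Qed.

Fact tens_addN : left_inverse tens0 tens_opp tens_add.
Proof.
move=> x; rewrite -{2}(tens_clsK x) tens_addE; apply/tens_clsP.
elim: (repr x) => [|[m n] s IHs]; first exact: tens_refl.
apply: (@tens_trans _ (((- m, n) :: [:: (m, n)]) ++
    ([seq (- p.1, p.2) | p <- s] ++ s))).
  apply: tens_rel_perm; rewrite /= perm_cons.
  by rewrite -[(m, n) :: s]cat1s -[_ :: (_ ++ s)]cat1s perm_catCA.
rewrite -[[::]]cats0; apply: tens_cat IHs.
apply: tens_trans (tens_sym (tens_Dl _ _ _)) _.
by rewrite addNr; apply: tens_0l.
Qed.

HB.instance Definition _ := GRing.isZmodule.Build tens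
  tens_addA tens_addC tens_add0 tens_addN.

(* The additive map out of the tensor product induced by phi; meaningful for
   biadditive phi with phi (ra r m) n = phi m (la r n) (see tens_liftE).      *)
Definition tens_lift (G : zmodType) (phi : M -> N -> G) (x : tens) : G :=
  \sum_(p <- repr x) phi p.1 p.2.

Lemma tens_liftE (G : zmodType) (phi : M -> N -> G) s :
    (forall m m' n, phi (m + m') n = phi m n + phi m' n) ->
    (forall m n n', phi m (n + n') = phi m n + phi m n') ->
    (forall r m n, phi (ra r m) n = phi m (la r n)) ->
  tens_lift phi (tens_cls s) = \sum_(p <- s) phi p.1 p.2.
Proof.
move=> phiDl phiDr phiZ; rewrite /tens_lift.
move: (repr _) (tens_repr s) => t; elim=> {s t} //=.
- by move=> ? ? ? _ -> _ ->.
- by move=> *; rewrite !big_cat; congr (_ + _).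
- by move=> *; rewrite !big_cat /= addrC.
- move=> n; rewrite big_seq1 big_nil /=.
  by apply: (addrI (phi 0 n)); rewrite -phiDl !addr0.
- move=> m; rewrite big_seq1 big_nil /=.
  by apply: (addrI (phi m 0)); rewrite -phiDr !addr0.
- by move=> *; rewrite !big_cons !big_nil /= phiDl !addr0.
- by move=> *; rewrite !big_cons !big_nil /= phiDr !addr0.
- by move=> *; rewrite !big_cons !big_nil /= phiZ.
Qed.
End Tensor.

(* A right R-module is an lmodType R^c: for r : R and m : M, the scalar
   product (r : R^c) *: m is m.r                                              *)
Definition tensmod (R : pzRingType) (M : lmodType R^c) (N : lmodType R) :=
  tens (fun (r : R^c) (m : M) => r *: m) (fun (r : R) (n : N) => r *: n).
HB.instance Definition _ (R : pzRingType) (M : lmodType R^c) (N : lmodType R) :=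
  GRing.Zmodule.on (tensmod M N).

Definition tensmod_map (R : pzRingType) (M M' : lmodType R^c)
    (f : {linear M -> M'}) (N : lmodType R) : tensmod M N -> tensmod M' N :=
  fun x => tens_cls _ _ [seq (f p.1, p.2) | p <- repr x].

Lemma tensmod_mapE (R : pzRingType) (M M' : lmodType R^c)
    (f : {linear M -> M'}) (N : lmodType R) (s : seq (M * N)) :
  tensmod_map f (tens_cls _ _ s : tensmod M N) =
    tens_cls _ _ [seq (f p.1, p.2) | p <- s].
Proof.
apply/tens_clsP; move: (repr _) (tens_repr (fun (r : R^c) (m : M) => r *: m)
  (fun (r : R) (n : N) => r *: n) s) => t; elim=> {s t} /=.
- by move=> t; apply: tens_refl.
- by move=> t u _; apply: tens_sym.
- by move=> t u v _ IH1 _; apply: tens_trans IH1.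
- by move=> t t' u u' _ IH1 _ IH2; rewrite !map_cat; apply: tens_cat.
- by move=> t u; rewrite !map_cat; apply: tens_catC.
- by move=> n; rewrite linear0; apply: tens_0l.
- by move=> m; apply: tens_0r.
- by move=> m m' n; rewrite linearD; apply: tens_Dl.
- by move=> m n n'; apply: tens_Dr.
- by move=> r m n; rewrite linearZ; apply: tens_bal.
Qed.

Definition projective (R : pzRingType) (P : lmodType R) : Prop :=
  forall (X Y : lmodType R) (g : {linear X -> Y}) (f : {linear P -> Y}),
    (forall y, exists x, g x = y) ->
  exists h : {linear P -> X}, forall p, g (h p) = f p.

(* ... -> P 2 -> P 1 -> P 0 -> M -> 0, with res_d n : P n.+1 -> P n           *)
Record proj_resolution (R : pzRingType) (M : lmodType R) := ProjResolution {
  res_obj :> nat -> lmodType R;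
  res_d : forall n, {linear res_obj n.+1 -> res_obj n};
  res_aug : {linear res_obj 0%N -> M};
  res_proj : forall n, projective (res_obj n);
  res_aug_surj : forall x : M, exists y, res_aug y = x;
  res_exact0 : forall x : res_obj 0%N,
    res_aug x = 0 <-> exists y, res_d 0%N y = x;
  res_exactS : forall n (x : res_obj n.+1),
    res_d n x = 0 <-> exists y, res_d n.+1 y = x
}.

Section Tor.
Variables (R : pzRingType) (M : lmodType R^c) (N : lmodType R).

Definition tor_cycle (P : proj_resolution M) (n : nat) : tensmod (P n) N -> Prop :=
  match n with
  | 0%N => fun _ => True
  | m.+1 => fun x => tensmod_map (res_d P m) x = 0
  end.

Definition tor_boundary (P : proj_resolution M) (n : nat)
    (x : tensmod (P n) N) : Prop :=
  exists y : tensmod (P n.+1) N, tensmod_map (res_d P n) y = x.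

(* Tor_n^R(M, N) = 0: the n-th homology of P (x)_R N vanishes, P being any
   projective resolution of the right module M.                               *)
Definition Tor_eq0 (n : nat) : Prop :=
  forall (P : proj_resolution M) (x : tensmod (P n) N),
    tor_cycle x -> tor_boundary x.
End Tor.

(* The global dimension is that of left modules, all of them (not only the
   finitely generated ones); over a finite dimensional algebra the left and
   right global dimensions coincide.                                          *)
Definition finite_gldim (R : pzRingType) : Prop :=
  exists d : nat, forall M : lmodType R, exists P : proj_resolution M,
    forall n, (d < n)%N -> forall x : P n, x = 0.

Section Enveloping.
Variables (k : fieldType) (A : fdAlg k).

Definition env_ra (c : k) (a : A) : A := c *: a.
Definition env_la (c : k) (b : A^c) : A^c := c *: (b : A).
(* A (x)_k A^op                                                               *)
Definition env : Type := tens env_ra env_la.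
HB.instance Definition _ := GRing.Zmodule.on env.
Local Notation env_rel := (tens_rel env_ra env_la).

Definition env_cls (s : seq (A * A^c)) : env := tens_cls env_ra env_la s.

Lemma env_ind (P : env -> Prop) : (forall s, P (env_cls s)) -> forall x, P x.
Proof. exact: tens_ind. Qed.

Lemma env_addE s t : env_cls s + env_cls t = env_cls (s ++ t).
Proof. exact: tens_addE. Qed.

(* (a (x) b) (a' (x) b') = a a' (x) b' b: the second factor is in A^c         *)
Definition env_mul_seq (s t : seq (A * A^c)) : seq (A * A^c) :=
  [seq (p.1 * q.1, p.2 * q.2) | p <- s, q <- t].
Definition env_one : env := env_cls [:: (1, 1)].
Definition env_mul (x y : env) : env := env_cls (env_mul_seq (repr x) (repr y)).

Lemma env_mul_relr s t t' : env_rel t t' ->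
  env_rel (env_mul_seq s t) (env_mul_seq s t').
Proof.
move=> tt'; elim: s => [|[a b] s IHs]; first exact: tens_refl.
apply: tens_cat IHs; elim: tt' => /=.
- by move=> u; apply: tens_refl.
- by move=> u v _; apply: tens_sym.
- by move=> u v w _ IH1 _; apply: tens_trans IH1.
- by move=> u u' v v' _ IH1 _ IH2; rewrite !map_cat; apply: tens_cat.
- by move=> u v; rewrite !map_cat; apply: tens_catC.
- by move=> n; rewrite mulr0; apply: tens_0l.
- by move=> m; rewrite mulr0; apply: tens_0r.
- by move=> m m' n; rewrite mulrDr; apply: tens_Dl.
- by move=> m n n'; rewrite mulrDr; apply: tens_Dr.
- move=> c m n; rewrite /env_ra -fdscaleAr.
  rewrite (_ : b * env_la c n = env_la c (b * n)); last first.
    by rewrite /env_la; symmetry; apply: (@fdscaleAl _ A).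
  exact: tens_bal.
Qed.

Lemma env_mul_rell s s' t : env_rel s s' ->
  env_rel (env_mul_seq s t) (env_mul_seq s' t).
Proof.
move=> ss'; elim: t => [|[a b] t IHt].
  by rewrite /env_mul_seq !allpairs0r; apply: tens_refl.
have cons_r u : env_rel (env_mul_seq u ((a, b) :: t))
    ([seq (p.1 * a, p.2 * b) | p <- u] ++ env_mul_seq u t).
  apply: tens_rel_perm.
  by rewrite (perm_allpairs_consr _ u (fun=> (a, b)) (fun=> t)).
apply: tens_trans (cons_r s) _; apply: tens_trans _ (tens_sym (cons_r s')).
apply: tens_cat IHt; elim: ss' => /=.
- by move=> u; apply: tens_refl.
- by move=> u v _; apply: tens_sym.
- by move=> u v w _ IH1 _; apply: tens_trans IH1.
- by move=> u u' v v' _ IH1 _ IH2; rewrite !map_cat; apply: tens_cat.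
- by move=> u v; rewrite !map_cat; apply: tens_catC.
- by move=> n; rewrite mul0r; apply: tens_0l.
- by move=> m; rewrite mul0r; apply: tens_0r.
- by move=> m m' n; rewrite mulrDl; apply: tens_Dl.
- by move=> m n n'; rewrite mulrDl; apply: tens_Dr.
- move=> c m n; rewrite /env_ra -fdscaleAl.
  rewrite (_ : env_la c n * b = env_la c (n * b)); last first.
    by rewrite /env_la; symmetry; apply: (@fdscaleAr _ A).
  exact: tens_bal.
Qed.

Lemma env_mulE s t : env_mul (env_cls s) (env_cls t) = env_cls (env_mul_seq s t).
Proof.
apply/tens_clsP.
apply: tens_trans (env_mul_rell _ (tens_repr _ _ s)) _.
exact: env_mul_relr (tens_repr _ _ t).
Qed.

Lemma env_mul_seqA s t u :
  env_mul_seq s (env_mul_seq t u) = env_mul_seq (env_mul_seq s t) u.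
Proof.
elim: s => //= -[a b] s IHs.
rewrite /env_mul_seq /= allpairs_cat -!/(env_mul_seq _ _) IHs; congr (_ ++ _).
rewrite /env_mul_seq map_allpairs allpairs_mapl /=.
by apply: eq_allpairs => -[a1 b1] [a2 b2] /=; rewrite !mulrA.
Qed.

Fact env_mulA : associative env_mul.
Proof.
elim/env_ind=> s; elim/env_ind=> t; elim/env_ind=> u.
by rewrite !env_mulE env_mul_seqA.
Qed.

Fact env_mul1l : left_id env_one env_mul.
Proof.
elim/env_ind=> s; rewrite env_mulE /env_mul_seq /= cats0.
by congr env_cls; rewrite -[RHS]map_id; apply: eq_map => -[a b]; rewrite /= !mul1r.
Qed.

Fact env_mul1r : right_id env_one env_mul.
Proof.
elim/env_ind=> s; rewrite env_mulE /env_mul_seq allpairs1r.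
by congr env_cls; rewrite -[RHS]map_id; apply: eq_map => -[a b]; rewrite /= !mulr1.
Qed.

Fact env_mulDl : left_distributive env_mul +%R.
Proof.
elim/env_ind=> s; elim/env_ind=> t; elim/env_ind=> u.
by rewrite env_addE !env_mulE env_addE /env_mul_seq allpairs_cat.
Qed.

Fact env_mulDr : right_distributive env_mul +%R.
Proof.
elim/env_ind=> s; elim/env_ind=> t; elim/env_ind=> u.
rewrite env_addE !env_mulE env_addE; apply/tens_clsP/tens_rel_perm.
by rewrite (perm_allpairs_catr _ s (fun=> t) (fun=> u)).
Qed.

HB.instance Definition _ := GRing.Zmodule_isPzRing.Build env
  env_mulA env_mul1l env_mul1r env_mulDl env_mulDr.

Lemma env_one_def : (1 : env) = env_cls [:: (1, 1)].
Proof. by []. Qed.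

Lemma env_mul_def s t : env_cls s * env_cls t = env_cls (env_mul_seq s t).
Proof. exact: env_mulE. Qed.

(* A as a left module over A (x)_k A^op: (a (x) b).x = a x b                  *)
Definition lenvmod : Type := A.
HB.instance Definition _ := GRing.Zmodule.on lenvmod.
Definition lenvmod_scale (u : env) (x : lenvmod) : lenvmod :=
  tens_lift (fun (a : A) (b : A^c) => a * (x : A) * (b : A)) u.

Lemma lenvmod_scaleE s (x : lenvmod) :
  lenvmod_scale (env_cls s) x = \sum_(p <- s) p.1 * (x : A) * (p.2 : A).
Proof.
apply: tens_liftE => [a a' b|a b b'|c a b]; first by rewrite !mulrDl.
- by rewrite mulrDr.
- by rewrite /env_ra /env_la -!fdscaleAl -fdscaleAr.
Qed.

Fact lenvmod_scaleDr : right_distributive lenvmod_scale +%R.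
Proof.
elim/env_ind=> s x y; rewrite !lenvmod_scaleE -big_split /=.
by apply: eq_bigr => p _; rewrite mulrDr mulrDl.
Qed.

Fact lenvmod_scaleDl x : {morph lenvmod_scale^~ x : u v / u + v}.
Proof.
elim/env_ind=> s; elim/env_ind=> t.
by rewrite env_addE !lenvmod_scaleE big_cat.
Qed.

Fact lenvmod_scaleA u v x :
  lenvmod_scale u (lenvmod_scale v x) = lenvmod_scale (u * v) x.
Proof.
elim/env_ind: u => s; elim/env_ind: v => t.
rewrite env_mul_def !lenvmod_scaleE big_allpairs_dep; apply: eq_bigr => p _.
rewrite mulr_sumr mulr_suml; apply: eq_bigr => q _ /=.
rewrite [p.2 * q.2](_ : _ = (q.2 : A) * (p.2 : A)); last by [].
by rewrite !mulrA.
Qed.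

Fact lenvmod_scale1 : left_id 1 lenvmod_scale.
Proof. by move=> x; rewrite lenvmod_scaleE big_seq1 mul1r mulr1. Qed.

HB.instance Definition _ := GRing.Zmodule_isLmodule.Build env lenvmod
  lenvmod_scaleA lenvmod_scale1 lenvmod_scaleDr lenvmod_scaleDl.

(* A as a right module over A (x)_k A^op: x.(a (x) b) = b x a                 *)
Definition renvmod : Type := A.
HB.instance Definition _ := GRing.Zmodule.on renvmod.
Definition renvmod_scale (u : env^c) (x : renvmod) : renvmod :=
  tens_lift (fun (a : A) (b : A^c) => (b : A) * (x : A) * a) (u : env).

Lemma renvmod_scaleE s (x : renvmod) :
  renvmod_scale (env_cls s) x = \sum_(p <- s) (p.2 : A) * (x : A) * p.1.
Proof.
apply: tens_liftE => [a a' b|a b b'|c a b]; first by rewrite mulrDr.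
- by rewrite -!mulrDl.
- by rewrite /env_ra /env_la -!fdscaleAl -fdscaleAr.
Qed.

Fact renvmod_scaleDr : right_distributive renvmod_scale +%R.
Proof.
elim/env_ind=> s x y; rewrite !renvmod_scaleE -big_split /=.
by apply: eq_bigr => p _; rewrite mulrDr mulrDl.
Qed.

Fact renvmod_scaleDl x : {morph renvmod_scale^~ x : u v / u + v}.
Proof.
elim/env_ind=> s; elim/env_ind=> t.
rewrite [_ + _](env_addE s t) !renvmod_scaleE big_cat //.
Qed.

Fact renvmod_scaleA u v x :
  renvmod_scale u (renvmod_scale v x) = renvmod_scale (u * v) x.
Proof.
elim/env_ind: u => s; elim/env_ind: v => t.
rewrite [_ * _](env_mul_def t s) !renvmod_scaleE big_allpairs_dep exchange_big /=.
apply: eq_bigr => p _.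
rewrite mulr_sumr mulr_suml; apply: eq_bigr => q _ /=.
rewrite [q.2 * p.2](_ : _ = (p.2 : A) * (q.2 : A)); last by [].
by rewrite !mulrA.
Qed.

Fact renvmod_scale1 : left_id 1 renvmod_scale.
Proof. by move=> x; rewrite renvmod_scaleE big_seq1 mul1r mulr1. Qed.

HB.instance Definition _ := GRing.Zmodule_isLmodule.Build env^c renvmod
  renvmod_scaleA renvmod_scale1 renvmod_scaleDr renvmod_scaleDl.
End Enveloping.

(* HH_n(A) = Tor_n(A, A) over A (x)_k A^op                                     *)
Definition HH_eq0 (k : fieldType) (A : fdAlg k) (n : nat) : Prop :=
  @Tor_eq0 (env A) (renvmod A) (lenvmod A) n.

Definition HH_finite (k : fieldType) (A : fdAlg k) : Prop :=
  exists N : nat, forall m : nat, (N < m)%N -> HH_eq0 A m.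

Definition Han (k : fieldType) (A : fdAlg k) : Prop :=
  HH_finite A -> finite_gldim A.

Definition strongly_stratifying (k : fieldType) (A : fdAlg k) (e : idem A) : Prop :=
  let f := idemC e in
  [/\ forall n, (0 < n)%N ->
        @Tor_eq0 (corner e) (rpeirce (idem1 A) e) (lpeirce e (idem1 A)) n,
      forall x : @tensmod (corner e) (rpeirce f e) (lpeirce e f), x = 0 &
      forall n, (0 < n)%N ->
        @Tor_eq0 (corner f) (rpeirce (idem1 A) f) (lpeirce f (idem1 A)) n].

(* Main.v *)
(* Write L for the algebra, B = eLe, C = fLf and D for the k-dual.  Everything
   is expressed through the vanishing of Hochschild cohomology H^n(A, -), n > 0:
   HH_n(A) is dual to H^n(A, DA), finite global dimension is the uniform
   vanishing of H^n(A, Hom_k(X, Y)) for n large, and Tor^B_n(Le, eL) = 0 says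
   that the B-bimodules of bilinear forms on Le x eL are acyclic.
     As fLe (x)_B eLf = 0, the quotient L/LeL is C, and every B-balanced form on
   Le x eL factors through the multiplication onto LeL.  This gives exact
   sequences 0 -> Hom(C, Y) -> Hom(L, Y) -> Hom_B(Le (x) eL, Y) -> 0.
   Acyclicity for B makes the last term computable over B or over L (two spectral
   sequences of one double complex), which yields H^n(B, DB) for Y = k; the
   first term yields H^n(C, DC) because H^n(L, Y) = H^n(C, Y) for C-bimodules Y.
   So HH is finite for L if and only if it is for B and C.  The same sequence,
   with an L-module K in place of L, compares global dimensions; surjectivity on
   the right is obtained by taking K to be a syzygy.
     All this applies to B x C, stratified by (1, 0), with the same corners.  *)

(* No complex, spectral sequence or derived functor is built. [shift] lowers the degree by one, so
   vanishing in any degree unfolds to a statement about derivations being inner, and long exact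
   sequences and the double complex become inductions on the degree. With cohomology all
   coefficients stay inside spaces of functions: tensor products occur only where Tor is translated,
   quotients become kernels, and k-linear extension by Zorn's lemma replaces bases, the modules
   being possibly infinite dimensional. Bimodules may be non-unital because left modules get the
   zero right action and the inclusions of the corners do not preserve 1. The obstacle is that
   global dimension involves all L-modules K, while stratification speaks of L itself: in general Le
   (x)_B eK -> K is not injective and Tor^B(Le, eK) does not vanish. Both hold for free K, and
   extending forms from a syzygy to its free cover needs only an H^1 over B to vanish; a bound on
   Ext over B provides this after boundedly many syzygies. Conversely, coinduction makes every
   B-module a retract of the corner of an L-module. *)
Require Import Defs.
From HB Require Import structures.
From mathcomp Require Import all_boot all_order all_algebra.
From mathcomp Require Import boolp classical_sets functions.

Set Implicit Arguments.
Unset Strict Implicit.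
Unset Printing Implicit Defensive.

Import GRing.Theory.
Local Open Scope ring_scope.

(** * Linear selections *)

Section LinearSelection.
Variable k : fieldType.

Definition subspace (V : lmodType k) (P : V -> Prop) :=
  P 0 /\ forall c x y, P x -> P y -> P (c *: x + y).

Definition linear_on (V W : lmodType k) (P : V -> Prop) (f : V -> W) :=
  forall c x y, P x -> P y -> f (c *: x + y) = c *: f x + f y.

Definition linear_rel (V W : lmodType k) (R : V -> W -> Prop) :=
  R 0 0 /\ forall c x y x' y', R x y -> R x' y' -> R (c *: x + x') (c *: y + y').

Definition lin (V W : lmodType k) (f : V -> W) :=
  forall c x y, f (c *: x + y) = c *: f x + f y.

Lemma lin_onT (V W : lmodType k) (f : V -> W) : lin f -> linear_on (fun=> True) f.
Proof. by move=> fl c x y _ _; apply: fl. Qed.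

Lemma lin_fct0 (V W : lmodType k) : lin (0 : V -> W).
Proof. by move=> c x y; rewrite -[RHS]/(c *: 0 + 0) scaler0 addr0. Qed.

Lemma lin_fctL (V W : lmodType k) c (f g : V -> W) :
  lin f -> lin g -> lin (c *: f + g).
Proof.
move=> fl gl d x y.
change (c *: f (d *: x + y) + g (d *: x + y) = d *: (c *: f x + g x) + (c *: f y + g y)).
by rewrite fl gl !scalerDr !scalerA [c * d]mulrC addrACA.
Qed.

Section On.
Variables (V W : lmodType k) (P : V -> Prop) (f : V -> W).
Hypotheses (sP : subspace P) (fP : linear_on P f).

Lemma subspaceD x y : P x -> P y -> P (x + y).
Proof. by move=> Px Py; rewrite -[x]scale1r; apply: sP.2. Qed.

Lemma subspaceZ c x : P x -> P (c *: x).
Proof. by move=> Px; rewrite -[_ *: _]addr0; apply: sP.2 => //; apply: sP.1. Qed.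

Lemma subspaceN x : P x -> P (- x).
Proof. by rewrite -scaleN1r; apply: subspaceZ. Qed.

Lemma subspaceB x y : P x -> P y -> P (x - y).
Proof. by move=> Px Py; apply: subspaceD => //; apply: subspaceN. Qed.

Lemma lin_on0 : f 0 = 0.
Proof.
by apply: (addrI (f 0)); have := fP 1 sP.1 sP.1; rewrite !scale1r !addr0 => <-.
Qed.

Lemma lin_onD x y : P x -> P y -> f (x + y) = f x + f y.
Proof. by move=> Px Py; rewrite -[x in LHS]scale1r fP // scale1r. Qed.

Lemma lin_onZ c x : P x -> f (c *: x) = c *: f x.
Proof. by move=> Px; rewrite -[c *: x]addr0 fP ?lin_on0 ?addr0 //; apply: sP.1. Qed.

Lemma lin_onN x : P x -> f (- x) = - f x.
Proof. by move=> Px; rewrite -scaleN1r lin_onZ // scaleN1r. Qed.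

Lemma lin_onB x y : P x -> P y -> f (x - y) = f x - f y.
Proof. by move=> Px Py; rewrite lin_onD ?lin_onN //; apply: subspaceN. Qed.
End On.

Lemma subspaceT (V : lmodType k) : subspace (fun _ : V => True).
Proof. by []. Qed.

Section Lin.
Variables (V W : lmodType k) (f : V -> W).
Hypothesis fl : lin f.
Let fT := lin_onT fl.
Lemma lin0 : f 0 = 0. Proof. exact: (lin_on0 (@subspaceT V) fT). Qed.
Lemma linD x y : f (x + y) = f x + f y. Proof. exact: (lin_onD fT). Qed.
Lemma linZ c x : f (c *: x) = c *: f x. Proof. exact: (lin_onZ (@subspaceT V) fT). Qed.
Lemma linB x y : f (x - y) = f x - f y. Proof. exact: (lin_onB (@subspaceT V) fT). Qed.
End Lin.

Lemma lin_comp (U V W : lmodType k) (f : V -> W) (g : U -> V) :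
  lin f -> lin g -> lin (fun u => f (g u)).
Proof. by move=> fl gl c x y; rewrite gl fl. Qed.

(* A maximal graph of a linear partial function inside R, containing g, is
   defined everywhere, since it can be extended along any line.               *)
Lemma linear_selection (U V : lmodType k) (D : U -> Prop) (R g : U -> V -> Prop) :
    subspace D -> linear_rel R -> linear_rel g ->
    (forall u, D u -> exists v, R u v) ->
    (forall u v, g u v -> D u /\ R u v) -> (forall v, g 0 v -> v = 0) ->
  exists s : U -> V, [/\ linear_on D s, forall u, D u -> R u (s u) &
    forall u v, g u v -> s u = v].
Proof.
move=> [D0 DL] [R0 RL] [g0 gL] Rtot gDR gfun.
pose T := (U * V)%type.
pose ok (S : set T) := [/\ linear_rel (fun u v => S (u, v)),
  forall u v, S (u, v) -> D u /\ R u v & forall v, S (0, v) -> v = 0].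
pose G : set T := fun p : T => g p.1 p.2.
have okG : ok G by split.
(* Zorn's lemma is applied to graphs united with [G], so that the empty chain is harmless. *)
have [F FP Ftot|S [okS maxS]] := @Zorn_bigcup T (fun S => ok (S `|` G)%classic).
  split.
  - split; first by right.
    move=> c x y x' y' [[S1 FS1 Sxy]|Gxy] [[S2 FS2 Sxy']|Gxy'].
    + have [le|le] := Ftot _ _ FS1 FS2.
        have [[_ SL] _ _] := FP _ FS2.
        have [h|h] := SL c x y x' y' (or_introl (le _ Sxy)) (or_introl Sxy'); last by right.
        by left; exists S2.
      have [[_ SL] _ _] := FP _ FS1.
      have [h|h] := SL c x y x' y' (or_introl Sxy) (or_introl (le _ Sxy')); last by right.
      by left; exists S1.
    + have [[_ SL] _ _] := FP _ FS1.
      have [h|h] := SL c x y x' y' (or_introl Sxy) (or_intror Gxy'); last by right.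
      by left; exists S1.
    + have [[_ SL] _ _] := FP _ FS2.
      have [h|h] := SL c x y x' y' (or_intror Gxy) (or_introl Sxy'); last by right.
      by left; exists S2.
    + by right; apply: gL.
  - move=> u v [[S FS Suv]|/gDR //].
    by have [_ h _] := FP _ FS; apply: h; left.
  - move=> v [[S FS Suv]|/gfun //].
    by have [_ _ h] := FP _ FS; apply: h; left.
have [[S0 SL] SDR Sfun] := okS.
set S' := (S `|` G)%classic in S0 SL SDR Sfun.
have tot u : D u -> exists v, S' (u, v).
  move=> Du; apply: contrapT => nS; have [v Ruv] := Rtot u Du.
  (* The line through [(u, v)] is adjoined. The graph stays single-valued: a relation with a nonzero
     multiple of [u] would already put [u] in the domain. *)
  pose S2 : set T := fun p : T => exists c x y, S' (x, y) /\ p = (x + c *: u, y + c *: v).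
  have SS2 : (S' `<=` S2)%classic.
    by move=> [x y] h; exists 0, x, y; rewrite !scale0r !addr0.
  apply: (maxS S2); first split.
  - by move=> p Sp; apply: SS2; left.
  - move=> eqS; apply: nS; exists v; left; apply: eqS.
    by exists 1, 0, 0; rewrite !scale1r !add0r.
  have -> : (S2 `|` G = S2)%classic.
    apply/seteqP; split=> p; last by left.
    by case=> // h; apply: SS2; right.
  have minus x y x' y' : S' (x, y) -> S' (x', y') -> S' (x - x', y - y').
    move=> h h'; have := SL (-1) x' y' x y h' h.
    by rewrite !scaleN1r ![- _ + _]addrC.
  have scal a x y : S' (x, y) -> S' (a *: x, a *: y).
    by move=> h; have := SL a x y 0 0 h S0; rewrite !addr0.
  split.
  - split; first exact: SS2.
    move=> a x y x' y' [c [x1 [y1 [h1 [-> ->]]]]] [c' [x2 [y2 [h2 [-> ->]]]]].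
    exists (a * c + c'), (a *: x1 + x2), (a *: y1 + y2); split; first exact: SL.
    congr pair; rewrite scalerDr scalerDl scalerA -!addrA; congr (_ + _);
    by rewrite addrCA.
  - move=> x y [c [x1 [y1 [h1 [-> ->]]]]]; have [Dx1 Rxy1] := SDR _ _ h1.
    by rewrite ![_ + c *: _]addrC; split; [apply: DL|apply: RL].
  - move=> y [c [x1 [y1 [h1 [e ->]]]]].
    have [c0|c0] := eqVneq c 0.
      move: e; rewrite c0 !scale0r !addr0 => e; apply: Sfun; rewrite [0]e; exact: h1.
    case: nS; exists (- c^-1 *: y1).
    have -> : u = - c^-1 *: x1.
      move/eqP: e; rewrite eq_sym addr_eq0 => /eqP ->.
      by rewrite scaleNr scalerN opprK scalerA mulVf // scale1r.
    by apply: scal.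
have /choice[s sP] u : exists v, D u -> S' (u, v).
  by have [/tot[v ?]|nDu] := pselect (D u); [exists v|exists 0].
have uniq u v v' : S' (u, v) -> S' (u, v') -> v = v'.
  move=> h h'; apply/eqP; rewrite -subr_eq0; apply/eqP/Sfun.
  have := SL (-1) u v' u v h' h.
  by rewrite !scaleN1r addNr [- _ + _]addrC.
exists s; split.
- by move=> c x y Dx Dy; apply: uniq (sP _ (DL _ _ _ Dx Dy)) (SL _ _ _ _ _ (sP _ Dx) (sP _ Dy)).
- by move=> u Du; have [] := SDR _ _ (sP _ Du).
- by move=> u v guv; apply: uniq (sP _ (gDR _ _ guv).1) (or_intror guv).
Qed.

Lemma linear_choice (U V : lmodType k) (D : U -> Prop) (R : U -> V -> Prop) :
    subspace D -> linear_rel R -> (forall u, D u -> exists v, R u v) ->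
  exists s : U -> V, linear_on D s /\ forall u, D u -> R u (s u).
Proof.
move=> sD lR tot.
have [|||s [sl sR _]] := linear_selection (g := fun u v => u = 0 /\ v = 0) sD lR _ tot.
- by split=> // c x y x' y' [-> ->] [-> ->]; rewrite !scaler0 !addr0.
- by move=> u v [-> ->]; split; [apply: sD.1|apply: lR.1].
- by move=> v [].
by exists s.
Qed.
End LinearSelection.

(** * Hochschild cohomology *)

Section Bimodules.
Variables (k : fieldType).
Implicit Types A B : fdAlg k.

(* A possibly non-unital A-bimodule carried by the subspace [carrier] of V; the
   axioms are only imposed on that subspace, and ract a x is x.a               *)
Record bimod A (V : lmodType k) := Bimod {
  carrier : V -> Prop;
  lact : A -> V -> V;
  ract : A -> V -> V
}.

Record bimod_axioms A V (Y : bimod A V) : Prop := BimodAxioms {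
  carrier_sub : subspace (carrier Y);
  lact_in : forall a x, carrier Y x -> carrier Y (lact Y a x);
  ract_in : forall a x, carrier Y x -> carrier Y (ract Y a x);
  lact_lin : forall a, linear_on (carrier Y) (lact Y a);
  ract_lin : forall a, linear_on (carrier Y) (ract Y a);
  lact_linl : forall x, carrier Y x -> lin (fun a : A => lact Y a x);
  ract_linl : forall x, carrier Y x -> lin (fun a : A => ract Y a x);
  lactM : forall a b x, carrier Y x -> lact Y (a * b) x = lact Y a (lact Y b x);
  ractM : forall a b x, carrier Y x -> ract Y (a * b) x = ract Y b (ract Y a x);
  lact_ract : forall a b x, carrier Y x ->
    lact Y a (ract Y b x) = ract Y b (lact Y a x)
}.

(* The left action is chosen so that H^n(A, shift Y) = H^(n+1)(A, Y) for n > 0: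
   derivations of Y are the invariants of shift Y (derivationP).             *)
Definition shift A V (Y : bimod A V) : bimod A (A -> V) :=
  Bimod (fun psi : A -> V => lin psi /\ forall t, carrier Y (psi t))
    (fun a psi t => psi (t * a) - lact Y t (psi a))
    (fun a psi t => ract Y a (psi t)).

Definition derivation A V (Y : bimod A V) (d : A -> V) :=
  [/\ lin d, forall a, carrier Y (d a) &
    forall a b, d (a * b) = lact Y a (d b) + ract Y b (d a)].

Definition inner A V (Y : bimod A V) (v : V) (a : A) := lact Y a v - ract Y a v.

(* The Hochschild cohomology H^(n+1)(A, Y) vanishes; mind the shift by one.   *)
Fixpoint hoch0 A (n : nat) : forall V, bimod A V -> Prop :=
  match n with
  | 0%N => fun V Y => forall d, derivation Y d ->
      exists v, carrier Y v /\ forall a, d a = inner Y v a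
  | m.+1 => fun V Y => hoch0 m (shift Y)
  end.

Definition invar A V (Y : bimod A V) (v : V) :=
  carrier Y v /\ forall a, lact Y a v = ract Y a v.

Lemma lin_inner A V (Y : bimod A V) v :
  bimod_axioms Y -> carrier Y v -> lin (inner Y v).
Proof.
move=> ax Yv c a b; rewrite /inner (lact_linl ax) // (ract_linl ax) //.
by rewrite scalerBr opprD addrACA.
Qed.

Lemma inner_in A V (Y : bimod A V) v a :
  bimod_axioms Y -> carrier Y v -> carrier Y (inner Y v a).
Proof. by move=> ax Yv; apply: (subspaceB (carrier_sub ax)); [apply: lact_in|apply: ract_in]. Qed.

Lemma derivation_inner A V (Y : bimod A V) v :
  bimod_axioms Y -> carrier Y v -> derivation Y (inner Y v).
Proof.
move=> ax Yv; split=> [|a|a b]; [exact: lin_inner|exact: inner_in|].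
have sY := carrier_sub ax.
rewrite /inner (lactM ax) // (ractM ax) // (lin_onB sY (lact_lin ax a)); first 1 last.
- exact: lact_in.
- exact: ract_in.
rewrite (lin_onB sY (ract_lin ax b)); first 1 last.
- exact: lact_in.
- exact: ract_in.
by rewrite (lact_ract ax) // addrA subrK.
Qed.

Lemma lin_mull A (a : A) : lin (fun t : A => t * a).
Proof. by move=> c x y; rewrite mulrDl -fdscaleAl. Qed.

Lemma lin_mulr A (a : A) : lin (fun t : A => a * t).
Proof. by move=> c x y; rewrite mulrDr -fdscaleAr. Qed.

Lemma shift_axioms A V (Y : bimod A V) : bimod_axioms Y -> bimod_axioms (shift Y).
Proof.
move=> ax; have sY := carrier_sub ax; have [Y0 YL] := sY.
split=> /=.
- split; first by split=> //; apply: lin_fct0.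
  move=> c f g [fl fY] [gl gY]; split=> [|t]; last exact: YL.
  exact: lin_fctL.
- move=> a f [fl fY]; split=> [c x y|t].
    rewrite mulrDl -fdscaleAl fl (lact_linl ax) // scalerBr opprD.
    by rewrite addrACA.
  by apply: (subspaceB sY) => //; apply: lact_in.
- move=> a f [fl fY]; split=> [c x y|t]; last exact: ract_in.
  by rewrite fl (ract_lin ax).
- move=> a c f g [fl fY] [gl gY]; apply/funext => t.
  change (c *: f (t * a) + g (t * a) - lact Y t (c *: f a + g a) =
    c *: (f (t * a) - lact Y t (f a)) + (g (t * a) - lact Y t (g a))).
  by rewrite (lact_lin ax) // scalerBr opprD addrACA.
- move=> a c f g [fl fY] [gl gY]; apply/funext => t.
  exact: (ract_lin ax).
- move=> f [fl fY] c a b; apply/funext => t.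
  change (f (t * (c *: a + b)) - lact Y t (f (c *: a + b)) =
    c *: (f (t * a) - lact Y t (f a)) + (f (t * b) - lact Y t (f b))).
  by rewrite lin_mulr !fl (lact_lin ax) // scalerBr opprD addrACA.
- move=> f [fl fY] c a b; apply/funext => t; exact: (ract_linl ax).
- move=> a b f [fl fY]; apply/funext => t.
  rewrite (lin_onB sY (lact_lin ax t)) // ?mulrA; last exact: lact_in.
  by rewrite (lactM ax) // opprB addrA subrK.
- by move=> a b f [fl fY]; apply/funext => t; apply: (ractM ax).
- move=> a b f [fl fY]; apply/funext => t.
  rewrite (lin_onB sY (ract_lin ax b)) // ?(lact_ract ax) //.
  exact: lact_in.
Qed.

Lemma hoch0_ext A V (Y Y' : bimod A V) n :
    (forall x, carrier Y x <-> carrier Y' x) ->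
    lact Y = lact Y' -> ract Y = ract Y' -> hoch0 n Y -> hoch0 n Y'.
Proof.
case: Y Y' => P l r [P' l' r'] /= PP' <- <-.
by have -> : P = P' by apply/funext => x; apply/propext.
Qed.

Record bimod_hom A V W (Y : bimod A V) (Z : bimod A W) (p : V -> W) : Prop := BimodHom {
  hom_in : forall x, carrier Y x -> carrier Z (p x);
  hom_lin : linear_on (carrier Y) p;
  hom_lact : forall a x, carrier Y x -> p (lact Y a x) = lact Z a (p x);
  hom_ract : forall a x, carrier Y x -> p (ract Y a x) = ract Z a (p x)
}.

(* Along pi : A -> A' and a section iota, not assumed to preserve 1.          *)
Lemma hoch0_retract A A' V V' (Y : bimod A V) (Y' : bimod A' V')
    (pi : A -> A') (iota : A' -> A) (j : V' -> V) (q : V -> V') n :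
    bimod_axioms Y -> bimod_axioms Y' ->
    lin pi -> {morph pi : a b / a * b} -> lin iota -> {morph iota : a b / a * b} ->
    cancel iota pi ->
    (forall x, carrier Y' x -> carrier Y (j x)) -> linear_on (carrier Y') j ->
    (forall a x, carrier Y' x -> j (lact Y' (pi a) x) = lact Y a (j x)) ->
    (forall a x, carrier Y' x -> j (ract Y' (pi a) x) = ract Y a (j x)) ->
    (forall x, carrier Y x -> carrier Y' (q x)) -> linear_on (carrier Y) q ->
    (forall a x, carrier Y x -> q (lact Y (iota a) x) = lact Y' a (q x)) ->
    (forall a x, carrier Y x -> q (ract Y (iota a) x) = ract Y' a (q x)) ->
    (forall x, carrier Y' x -> q (j x) = x) ->
  hoch0 n Y -> hoch0 n Y'.
Proof.
move=> axY axY' pil piM il iM ipK.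
elim: n V V' Y Y' j q axY axY' => [|n IHn] V V' Y Y' j q axY axY' jP jl jL jR qP ql qL qR qj /=.
  move=> zY d [dl dP dD].
  have [|v [Yv dv]] := zY (fun a => j (d (pi a))).
    split=> [c a b|a|a b].
    - by rewrite pil dl jl.
    - exact: jP.
    - rewrite piM dD (lin_onD jl) ?jL ?jR //; [exact: lact_in|exact: ract_in].
  exists (q v); split; first exact: qP.
  move=> a; rewrite -[d a]qj // -[in d a](ipK a) dv /inner.
  by rewrite (lin_onB (carrier_sub axY) ql) ?qL ?qR //; [apply: lact_in|apply: ract_in].
have sY := carrier_sub axY; have sY' := carrier_sub axY'.
apply: (IHn _ _ _ _ (fun f t => j (f (pi t))) (fun f t => q (f (iota t))));
  [exact: shift_axioms|exact: shift_axioms|..].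
- by move=> f [fl fP]; split=> [c a b|a]; [rewrite pil fl jl|apply: jP].
- by move=> c f g [fl fP] [gl gP]; apply/funext => t; apply: jl.
- move=> a f [fl fP]; apply/funext => t /=.
  by rewrite (lin_onB sY' jl) ?jL ?piM //; apply: lact_in.
- by move=> a f [fl fP]; apply/funext => t /=; rewrite jR.
- by move=> f [fl fP]; split=> [c a b|a]; [rewrite il fl ql|apply: qP].
- by move=> c f g [fl fP] [gl gP]; apply/funext => t; apply: ql.
- move=> a f [fl fP]; apply/funext => t /=.
  by rewrite (lin_onB sY ql) ?qL ?iM //; apply: lact_in.
- by move=> a f [fl fP]; apply/funext => t /=; rewrite qR.
- by move=> f [fl fP]; apply/funext => t; rewrite ipK qj.
Qed.

Lemma hoch0_hom_retract A V V' (Y : bimod A V) (Y' : bimod A V')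
    (j : V' -> V) (q : V -> V') n :
    bimod_axioms Y -> bimod_axioms Y' -> bimod_hom Y' Y j -> bimod_hom Y Y' q ->
    (forall x, carrier Y' x -> q (j x) = x) ->
  hoch0 n Y -> hoch0 n Y'.
Proof.
move=> ax ax' [? ? jL jR] [? ? qL qR] qj.
by apply: (@hoch0_retract A A _ _ _ _ id id j q).
Qed.

Lemma hoch0_zero A V (Y : bimod A V) n :
  bimod_axioms Y -> (forall x, carrier Y x -> x = 0) -> hoch0 n Y.
Proof.
elim: n V Y => [|n IHn] V Y ax Y0 /=.
  move=> d [_ dP _]; exists 0; split; first exact: (carrier_sub ax).1.
  by move=> a; rewrite [LHS]Y0 // [RHS]Y0 //; apply: inner_in => //; apply: (carrier_sub ax).1.
apply: IHn; first exact: shift_axioms.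
by move=> f [_ fP]; apply/funext => t; apply: Y0.
Qed.

(* If x.a = 0 for all x and a, every derivation is a |-> a.d(1).              *)
Lemma hoch0_ract0 A V (Y : bimod A V) n :
  bimod_axioms Y -> (forall a x, carrier Y x -> ract Y a x = 0) -> hoch0 n Y.
Proof.
elim: n V Y => [|n IHn] V Y ax Y0 /=.
  move=> d [_ dP dD]; exists (d 1); split=> // a.
  by rewrite /inner -[a in LHS]mulr1 dD !Y0 // addr0 subr0.
apply: IHn; first exact: shift_axioms.
by move=> a f [_ fP]; apply/funext => t; apply: Y0.
Qed.
End Bimodules.

(** * Long exact sequences in Hochschild cohomology *)

Section ExactSequences.
Variables (k : fieldType).
Implicit Types A B : fdAlg k.

Lemma derivationP A V (Y : bimod A V) d :
  derivation Y d <-> invar (shift Y) d.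
Proof.
split=> [[dl dP dD]|[[dl dP] dD]]; split=> // a.
  by apply/funext => t; rewrite /= dD addrC addKr.
move=> b; have /(congr1 (@^~ a)) /= := dD b.
by move/eqP; rewrite subr_eq addrC => /eqP.
Qed.

Lemma inner_linear A V (Y : bimod A V) a :
  bimod_axioms Y -> linear_on (carrier Y) (fun v => inner Y v a).
Proof.
move=> ax c x y Yx Yy; rewrite /inner (lact_lin ax) // (ract_lin ax) //.
by rewrite scalerBr opprD addrACA.
Qed.

Lemma invar_subspace A V (Y : bimod A V) :
  bimod_axioms Y -> subspace (invar Y).
Proof.
move=> ax; have sY := carrier_sub ax; split.
  split=> [|a]; first exact: sY.1.
  by rewrite (lin_on0 sY (lact_lin ax a)) (lin_on0 sY (ract_lin ax a)).
move=> c x y [Yx ix] [Yy iy]; split=> [|a]; first exact: sY.2.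
by rewrite (lact_lin ax) // (ract_lin ax) // ix iy.
Qed.

Definition kernel A V (W : lmodType k) (Y : bimod A V) (p : V -> W) : bimod A V :=
  Bimod (fun x => carrier Y x /\ p x = 0) (lact Y) (ract Y).

Section Sequence.
Variables (A : fdAlg k) (V W : lmodType k) (Y : bimod A V) (Z : bimod A W).
Variable p : V -> W.
Hypotheses (axY : bimod_axioms Y) (axZ : bimod_axioms Z) (pH : bimod_hom Y Z p).

Lemma kernel_axioms : bimod_axioms (kernel Y p).
Proof.
have sY := carrier_sub axY; have [pin pl pL pR] := pH; have sZ := carrier_sub axZ.
split=> /=.
- split; first by split; [exact: sY.1|exact: lin_on0 pl].
  move=> c x y [Yx px] [Yy py]; split; first exact: sY.2.
  by rewrite pl // px py scaler0 addr0.
- move=> a x [Yx px]; split; first exact: lact_in.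
  by rewrite pL // px (lin_on0 sZ (lact_lin axZ a)).
- move=> a x [Yx px]; split; first exact: ract_in.
  by rewrite pR // px (lin_on0 sZ (ract_lin axZ a)).
- by move=> a c x y [Yx _] [Yy _]; apply: (lact_lin axY).
- by move=> a c x y [Yx _] [Yy _]; apply: (ract_lin axY).
- by move=> x [Yx _]; apply: (lact_linl axY).
- by move=> x [Yx _]; apply: (ract_linl axY).
- by move=> a b x [Yx _]; apply: (lactM axY).
- by move=> a b x [Yx _]; apply: (ractM axY).
- by move=> a b x [Yx _]; apply: (lact_ract axY).
Qed.

Lemma shift_hom : bimod_hom (shift Y) (shift Z) (fun f t => p (f t)).
Proof.
have sY := carrier_sub axY; have [pin pl pL pR] := pH.
split=> [f [fl fP]|c f g [fl fP] [gl gP]|a f [fl fP]|a f [fl fP]].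
- by split=> [c x y|t]; [rewrite fl pl|apply: pin].
- by apply/funext => t; apply: pl.
- by apply/funext => t; rewrite /= (lin_onB sY pl) ?pL //; apply: lact_in.
- by apply/funext => t; rewrite /= pR.
Qed.

Lemma shift_kernel n :
  hoch0 n (shift (kernel Y p)) <-> hoch0 n (kernel (shift Y) (fun f t => p (f t))).
Proof.
split; apply: hoch0_ext => // f; split.
- move=> [fl fP]; split; first by split=> // t; have [] := fP t.
  by apply/funext => t; have [] := fP t.
- move=> [[fl fP] pf]; split=> // t; split; first exact: fP.
  by have := congr1 (@^~ t) pf.
- move=> [[fl fP] pf]; split=> // t; split; first exact: fP.
  by have := congr1 (@^~ t) pf.
- move=> [fl fP]; split; first by split=> // t; have [] := fP t.
  by apply/funext => t; have [] := fP t.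
Qed.

Hypothesis p_surj : forall z, carrier Z z -> exists2 y, carrier Y y & p y = z.

(** Hom_k(A, -) is exact: [linear_choice] provides a linear section of [p] on the carriers. *)
Lemma shift_surj f : carrier (shift Z) f ->
  exists2 g, carrier (shift Y) g & (fun t => p (g t)) = f.
Proof.
have sY := carrier_sub axY; have [pin pl _ _] := pH.
move=> [fl fP].
have [||s [sl sP]] := @linear_choice _ W V (carrier Z) (fun z y => carrier Y y /\ p y = z)
   (carrier_sub axZ).
- split; first by split; [exact: sY.1|exact: lin_on0 pl].
  move=> c x y x' y' [Yy <-] [Yy' <-]; split; first exact: sY.2.
  by rewrite pl.
- by move=> z /p_surj[y Yy pz]; exists y.
exists (fun t => s (f t)).
  by split=> [c x y|t]; [rewrite fl sl|have [] := sP _ (fP t)].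
by apply/funext => t; have [] := sP _ (fP t).
Qed.

Lemma inner_hom v a : carrier Y v -> p (inner Y v a) = inner Z (p v) a.
Proof.
move=> Yv; have [pin pl pL pR] := pH; have sY := carrier_sub axY.
by rewrite /inner (lin_onB sY pl) ?pL ?pR //; [exact: lact_in|exact: ract_in].
Qed.

(** The connecting map: the inner derivation of a lift [y] has values in the kernel, hence is inner
    by some [v] of the kernel, and [y - v] is invariant. *)
Lemma invar_lift z : hoch0 0 (kernel Y p) -> invar Z z ->
  exists2 y, invar Y y & p y = z.
Proof.
move=> zK [Zz iz]; have sY := carrier_sub axY; have [pin pl pL pR] := pH.
have [y Yy py] := p_surj Zz.
have [|v [[Yv pv] dv]] := zK (inner Y y).
  have [dl dP dD] := derivation_inner axY Yy; split=> // a; split=> //.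
  by rewrite inner_hom // py /inner iz subrr.
exists (y - v); last by rewrite (lin_onB sY pl) // py pv subr0.
split=> [|a]; first exact: subspaceB.
apply/eqP; rewrite -subr_eq0; apply/eqP.
rewrite -/(inner Y (y - v) a) (lin_onB sY (inner_linear a axY)) // dv.
by rewrite /inner /= subrr.
Qed.

Lemma hoch0_kernel0 : hoch0 0 Y ->
    (forall z, invar Z z -> exists2 y, invar Y y & p y = z) ->
  hoch0 0 (kernel Y p).
Proof.
move=> zY lift d [dl dP dD]; have sY := carrier_sub axY; have [pin pl pL pR] := pH.
have [|v [Yv dv]] := zY d; first by split=> // a; have [] := dP a.
have [|y [Yy iy] py] := lift (p v).
  split=> [|a]; first exact: pin.
  apply/eqP; rewrite -subr_eq0; apply/eqP.
  rewrite -/(inner Z _ a) -inner_hom // -dv.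
  by have [] := dP a.
exists (v - y); split; first by split; [exact: subspaceB|rewrite (lin_onB sY pl) // py subrr].
move=> a; rewrite dv -/(inner Y (v - y) a).
by rewrite [RHS](lin_onB sY (inner_linear a axY)) // [inner Y y a]/inner iy subrr subr0.
Qed.
End Sequence.

(** Exactness of H^(n+1)(kernel) -> H^(n+1)(Y) -> H^(n+1)(Z). *)
Lemma hoch0_middle A V W (Y : bimod A V) (Z : bimod A W) (p : V -> W) n :
    bimod_axioms Y -> bimod_axioms Z -> bimod_hom Y Z p ->
    (forall z, carrier Z z -> exists2 y, carrier Y y & p y = z) ->
  hoch0 n (kernel Y p) -> hoch0 n Z -> hoch0 n Y.
Proof.
elim: n V W Y Z p => [|n IHn] V W Y Z p axY axZ pH ps; last first.
  move=> /(shift_kernel Y p n).1 zK zZ.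
  by apply: (IHn _ _ _ (shift Z) _ _ _ (shift_hom axY pH)) zK zZ;
    [exact: shift_axioms|exact: shift_axioms|exact: shift_surj].
move=> zK zZ d; have sY := carrier_sub axY; have [pin pl pL pR] := pH.
move=> dD; have [dl dP _] := dD; have [|z [Zz dz]] := zZ (fun a => p (d a)).
  have [dl' dP' dD'] := dD; split=> [c a b|a|a b].
  - by rewrite dl' pl.
  - exact: pin.
  - rewrite dD' (lin_onD pl) ?pL ?pR //; [exact: lact_in|exact: ract_in].
have [y Yy py] := ps _ Zz.
have /derivationP[[el eP] ei] : derivation Y (d - inner Y y).
  apply/derivationP; apply: (subspaceB (invar_subspace (shift_axioms axY))).
    by apply/derivationP.
  by apply/derivationP; apply: derivation_inner.
have [|v [[Yv pv] dv]] := zK (d - inner Y y).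
  apply/derivationP; split=> //; split=> // t; split; first exact: eP.
  have -> : (d - inner Y y) t = d t - inner Y y t by [].
  rewrite (lin_onB sY pl) //; last exact: inner_in.
  by rewrite dz (inner_hom axY pH) // py subrr.
exists (v + y); split; first exact: subspaceD.
move=> a; rewrite (lin_onD (inner_linear a axY)) //.
by rewrite -[inner Y v a]dv -[(d - _) a]/(d a - inner Y y a) subrK.
Qed.

(** Exactness of H^(n+1)(Y) -> H^(n+1)(Z) -> H^(n+2)(kernel). *)
Lemma hoch0_cokernel A V W (Y : bimod A V) (Z : bimod A W) (p : V -> W) n :
    bimod_axioms Y -> bimod_axioms Z -> bimod_hom Y Z p ->
    (forall z, carrier Z z -> exists2 y, carrier Y y & p y = z) ->
  hoch0 n Y -> hoch0 n.+1 (kernel Y p) -> hoch0 n Z.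
Proof.
elim: n V W Y Z p => [|n IHn] V W Y Z p axY axZ pH ps; last first.
  move=> zY /(shift_kernel Y p n.+1).1 zK.
  by apply: (IHn _ _ (shift Y) _ _ _ _ (shift_hom axY pH)) zY zK;
    [exact: shift_axioms|exact: shift_axioms|exact: shift_surj].
move=> zY /(shift_kernel Y p 0).1 zK d /derivationP di.
have [g /derivationP gi gd] := invar_lift (shift_axioms axY)
  (shift_hom axY pH) (shift_surj axY axZ pH ps) zK di.
have [v [Yv gv]] := zY _ gi.
exists (p v); split=> [|a]; first exact: hom_in pH _ Yv.
by rewrite -gd gv (inner_hom axY pH).
Qed.

(** Exactness of H^(n+1)(Z) -> H^(n+2)(kernel) -> H^(n+2)(Y). The induction starts in the shifted
    sequence, where the invariants to be lifted are derivations of [Z], which are inner. *)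
Lemma hoch0_kernel A V W (Y : bimod A V) (Z : bimod A W) (p : V -> W) n :
    bimod_axioms Y -> bimod_axioms Z -> bimod_hom Y Z p ->
    (forall z, carrier Z z -> exists2 y, carrier Y y & p y = z) ->
  hoch0 n Z -> hoch0 n.+1 Y -> hoch0 n.+1 (kernel Y p).
Proof.
elim: n V W Y Z p => [|n IHn] V W Y Z p axY axZ pH ps zZ zY.
  apply/(shift_kernel Y p 0).
  apply: (hoch0_kernel0 (shift_axioms axY) (shift_hom axY pH) zY).
  move=> d /derivationP/zZ[z [Zz dz]].
  have [y Yy py] := ps _ Zz.
  exists (inner Y y); first by apply/derivationP; apply: derivation_inner.
  by apply/funext => t; rewrite (inner_hom axY pH) // py dz.
apply/(shift_kernel Y p n.+1).
by apply: (IHn _ _ _ _ _ _ _ (shift_hom axY pH)) zZ zY;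
  [exact: shift_axioms|exact: shift_axioms|exact: shift_surj].
Qed.
End ExactSequences.

(** * Acyclic coefficients *)

Section Acyclicity.
Variables (k : fieldType).
Implicit Types A B : fdAlg k.

Definition lin_bimod A (U V : lmodType k) (Y : bimod A V) : bimod A (U -> V) :=
  Bimod (fun f : U -> V => lin f /\ forall u, carrier Y (f u))
    (fun a f u => lact Y a (f u)) (fun a f u => ract Y a (f u)).

Lemma lin_bimod_axioms A (U V : lmodType k) (Y : bimod A V) :
  bimod_axioms Y -> bimod_axioms (lin_bimod U Y).
Proof.
move=> ax; have [Y0 YL] := carrier_sub ax.
split=> /=.
- split; first by split=> //; apply: lin_fct0.
  by move=> c f g [fl fP] [gl gP]; split=> [|t]; [exact: lin_fctL|exact: YL].
- by move=> a f [fl fP]; split=> [c x y|t]; [rewrite fl (lact_lin ax)|exact: lact_in].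
- by move=> a f [fl fP]; split=> [c x y|t]; [rewrite fl (ract_lin ax)|exact: ract_in].
- by move=> a c f g [fl fP] [gl gP]; apply/funext => u; apply: (lact_lin ax).
- by move=> a c f g [fl fP] [gl gP]; apply/funext => u; apply: (ract_lin ax).
- by move=> f [fl fP] c a b; apply/funext => u; apply: (lact_linl ax).
- by move=> f [fl fP] c a b; apply/funext => u; apply: (ract_linl ax).
- by move=> a b f [fl fP]; apply/funext => u; apply: (lactM ax).
- by move=> a b f [fl fP]; apply/funext => u; apply: (ractM ax).
- by move=> a b f [fl fP]; apply/funext => u; apply: (lact_ract ax).
Qed.

(** A derivation is trivialised separately at every [u], and [linear_choice] makes the trivialising
    elements depend linearly on [u]. *)
Lemma hoch0_lin_bimod A (U V : lmodType k) (Y : bimod A V) n :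
  bimod_axioms Y -> hoch0 n Y -> hoch0 n (lin_bimod U Y).
Proof.
elim: n V Y => [|n IHn] V Y ax /=; have sY := carrier_sub ax.
  move=> zY d [dl dP dD].
  pose R u v := carrier Y v /\ forall a, d a u = inner Y v a.
  have [||s [sl sP]] := @linear_choice _ U V (fun=> True) R (@subspaceT _ U).
  - split.
      split=> [|a]; first exact: sY.1.
      by rewrite (lin0 (dP a).1) (lin_on0 sY (inner_linear a ax)).
    move=> c x y x' y' [Yy dy] [Yy' dy']; split=> [|a]; first exact: sY.2.
    by rewrite (dP a).1 dy dy' (inner_linear a ax).
  - move=> u _; have [|v [Yv dv]] := zY (fun a => d a u); last by exists v.
    split=> [c a b|a|a b]; [by rewrite dl|exact: (dP a).2|by rewrite dD].
  exists s; split; first by split=> [c x y|u]; [exact: sl|exact: (sP u I).1].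
  by move=> a; apply/funext => u; rewrite (sP u I).2.
move=> /(IHn _ _ (shift_axioms ax)).
have axl := lin_bimod_axioms U ax; have axs := shift_axioms ax.
apply: (@hoch0_hom_retract _ A _ _ _ _ (fun f u t => f t u) (fun f t u => f u t));
  [exact: lin_bimod_axioms|exact: shift_axioms|..|by []].
- split=> //.
  move=> f [fl fP]; split=> [c x y|u].
    by apply/funext => t; apply: (fP t).1.
  split=> [c a b|t]; last exact: (fP t).2.
  by rewrite fl.
- split=> //.
  move=> f [fl fP]; split=> [c a b|t].
    by apply/funext => u; apply: (fP u).1.
  split=> [c x y|u]; last exact: (fP u).2.
  by rewrite fl.
Qed.

(* A bimodule retraction onto Y of the coinduced bimodule Hom_k(A, Y).        *)
Definition rcoinduced A V (Y : bimod A V) := exists S : (A -> V) -> V,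
  [/\ forall f, carrier (shift Y) f -> carrier Y (S f),
      linear_on (carrier (shift Y)) S,
      forall y, carrier Y y -> S (fun t => ract Y t y) = y,
      forall a f, carrier (shift Y) f -> S (fun t => f (a * t)) = ract Y a (S f) &
      forall a f, carrier (shift Y) f -> S (fun t => lact Y a (f t)) = lact Y a (S f)].

Definition lcoinduced A V (Y : bimod A V) := exists S : (A -> V) -> V,
  [/\ forall f, carrier (shift Y) f -> carrier Y (S f),
      linear_on (carrier (shift Y)) S,
      forall y, carrier Y y -> S (fun t => lact Y t y) = y,
      forall a f, carrier (shift Y) f -> S (fun t => f (t * a)) = lact Y a (S f) &
      forall a f, carrier (shift Y) f -> S (fun t => ract Y a (f t)) = ract Y a (S f)].

Section CarrierShift.
Variables (A : fdAlg k) (V : lmodType k) (Y : bimod A V).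
Hypothesis ax : bimod_axioms Y.

Lemma shift_lact a f : carrier (shift Y) f ->
  carrier (shift Y) (fun t => lact Y a (f t)).
Proof.
by move=> [fl fP]; split=> [c x y|t]; [rewrite fl (lact_lin ax)|exact: lact_in].
Qed.

Lemma shift_ract a f : carrier (shift Y) f ->
  carrier (shift Y) (fun t => ract Y a (f t)).
Proof.
by move=> [fl fP]; split=> [c x y|t]; [rewrite fl (ract_lin ax)|exact: ract_in].
Qed.

Lemma shift_mull a f : carrier (shift Y) f ->
  carrier (shift Y) (fun t => f (a * t)).
Proof. by move=> [fl fP]; split=> [c x y|t] //; rewrite lin_mulr fl. Qed.

Lemma shift_lactr x : carrier Y x -> carrier (shift Y) (fun t => lact Y t x).
Proof. by move=> Yx; split=> [|t]; [exact: (lact_linl ax)|exact: lact_in]. Qed.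

Lemma shift_ractr x : carrier Y x -> carrier (shift Y) (fun t => ract Y t x).
Proof. by move=> Yx; split=> [|t]; [exact: (ract_linl ax)|exact: ract_in]. Qed.
End CarrierShift.

(** [S] acts as a contracting homotopy: applied to the Leibniz rule for [d (a * t)], read as a
    function of [t], it gives [d a = inner Y (- S d) a]. For [shift Y] the retraction is [S] in the
    outer variable. *)
Lemma hoch0_rcoinduced A V (Y : bimod A V) n :
  bimod_axioms Y -> rcoinduced Y -> hoch0 n Y.
Proof.
elim: n V Y => [|n IHn] V Y ax [S [Sin Sl Sy SR SL]] /=; have sY := carrier_sub ax.
  move=> d [dl dP dD]; have cd : carrier (shift Y) d by [].
  exists (- S d); split; first by apply: subspaceN => //; apply: Sin.
  move=> a; have /esym := SR a d cd.
  rewrite (_ : (fun t => d (a * t)) =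
      (fun t => lact Y a (d t)) + (fun t => ract Y t (d a))); last first.
    by apply/funext => t; apply: dD.
  rewrite (lin_onD Sl) //; last first.
  - exact: shift_ractr.
  - exact: shift_lact.
  rewrite SL // Sy // /inner (lin_onN sY (lact_lin ax a)) ?(lin_onN sY (ract_lin ax a));
    [|exact: Sin..].
  by move=> ->; rewrite opprK addrA addNr add0r.
apply: IHn; first exact: shift_axioms.
have lev (F : A -> A -> V) t : carrier (shift (shift Y)) F ->
    carrier (shift Y) (fun u => F u t).
  by move=> [Fl FP]; split=> [c a b|u]; [rewrite Fl|exact: (FP u).2].
exists (fun F t => S (fun u => F u t)); split.
- move=> F cF; have [Fl FP] := cF; split=> [c a b|t]; last exact/Sin/lev.
  rewrite -Sl; [|exact: lev..]; congr S; apply/funext => u.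
  exact: (FP u).1.
- move=> c F G cF cG; apply/funext => t.
  by apply: (Sl c (fun u => F u t) (fun u => G u t)); apply: lev.
- by move=> f [fl fP]; apply/funext => t; apply: Sy.
- move=> a F cF; apply/funext => t /=.
  by rewrite -SR //; apply: lev.
- move=> a F cF; apply/funext => t /=.
  change (S (fun u => F u (t * a) - lact Y t (F u a)) =
    S (fun u => F u (t * a)) - lact Y t (S (fun u => F u a))).
  rewrite -SL; last exact: lev.
  apply: (@lin_onB _ _ _ _ _ (carrier_sub (shift_axioms ax)) Sl (fun u => F u (t * a))
    (fun u => lact Y t (F u a))); first exact: lev.
  by apply: shift_lact => //; apply: lev.
Qed.

(* The left-right mirror image of [shift].                                    *)
Definition coshift A V (Y : bimod A V) : bimod A (A -> V) :=
  Bimod (carrier (shift Y)) (fun a psi t => lact Y a (psi t))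
    (fun a psi t => psi (a * t) - ract Y t (psi a)).

Lemma coshift_axioms A V (Y : bimod A V) : bimod_axioms Y -> bimod_axioms (coshift Y).
Proof.
move=> ax; have sY := carrier_sub ax.
split=> /=.
- exact: carrier_sub (shift_axioms ax).
- by move=> a f; apply: shift_lact.
- move=> a f [fl fP]; split=> [c x y|t].
    by rewrite lin_mulr fl (ract_linl ax) // scalerBr opprD addrACA.
  by apply: (subspaceB sY) => //; apply: ract_in.
- by move=> a c f g [fl fP] [gl gP]; apply/funext => t; apply: (lact_lin ax).
- move=> a c f g [fl fP] [gl gP]; apply/funext => t.
  change (c *: f (a * t) + g (a * t) - ract Y t (c *: f a + g a) =
    c *: (f (a * t) - ract Y t (f a)) + (g (a * t) - ract Y t (g a))).
  by rewrite (ract_lin ax) // scalerBr opprD addrACA.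
- by move=> f [fl fP] c a b; apply/funext => t; exact: (lact_linl ax).
- move=> f [fl fP] c a b; apply/funext => t.
  change (f ((c *: a + b) * t) - ract Y t (f (c *: a + b)) =
    c *: (f (a * t) - ract Y t (f a)) + (f (b * t) - ract Y t (f b))).
  by rewrite lin_mull !fl (ract_lin ax) // scalerBr opprD addrACA.
- by move=> a b f [fl fP]; apply/funext => t; apply: (lactM ax).
- move=> a b f [fl fP]; apply/funext => t.
  rewrite (lin_onB sY (ract_lin ax t)) // ?mulrA; last exact: ract_in.
  by rewrite (ractM ax) // opprB addrA subrK.
- move=> a b f [fl fP]; apply/funext => t.
  by rewrite (lin_onB sY (lact_lin ax a)) // ?(lact_ract ax) //; apply: ract_in.
Qed.

(** Derivations of [shift Y] and of [coshift Y] are Hochschild 2-cocycles of [Y], curried in the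
    second and in the first argument; exchanging the two arguments passes from one to the other. *)
Lemma hoch0_coshift A V (Y : bimod A V) n :
  bimod_axioms Y -> hoch0 n (coshift Y) -> hoch0 n.+1 Y.
Proof.
elim: n V Y => [|n IHn] V Y ax; have sY := carrier_sub ax.
  move=> zY D [Dl DP DD].
  have [|theta [ctheta Dtheta]] := zY (fun b c => D c b).
    split=> [c a b|b|a b].
    - by apply/funext => t; apply: (DP t).1.
    - by split=> [c x y|t]; [rewrite Dl|exact: (DP t).2].
    - apply/funext => c /=.
      change (D c (a * b) = lact Y a (D c b) + (D (b * c) a - ract Y c (D b a))).
      by rewrite DD /= addrK addrC subrK.
  (* The inner derivations of [theta] in the two shifts are coboundaries of opposite sign. *)
  exists (- theta); split; first exact: (@subspaceN _ _ _ (carrier_sub (shift_axioms ax)) _ ctheta).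
  have [tl tP] := ctheta.
  move=> a; apply/funext => t; have := congr1 (@^~ a) (Dtheta t).
  rewrite /inner /=.
  change (D a t = lact Y t (theta a) - (theta (t * a) - ract Y a (theta t)) ->
    D a t = - theta (t * a) - lact Y t (- theta a) - ract Y a (- theta t)).
  move=> ->; rewrite (lin_onN sY (lact_lin ax t)) // (lin_onN sY (ract_lin ax a)) //.
  by rewrite !opprK opprB addrA addrAC [- theta _ + _]addrC.
move=> zY; apply: (IHn _ (shift Y)); first exact: shift_axioms.
apply: (@hoch0_hom_retract _ A _ _ _ _ (fun f t u => f u t) (fun f u t => f t u) n _ _ _ _ _ zY).
- exact/shift_axioms/coshift_axioms.
- exact/coshift_axioms/shift_axioms.
- split=> // f [fl fP]; split=> [c a b|t].
    by apply/funext => u; apply: (fP u).1.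
  by split=> [c a b|u]; [rewrite fl|exact: (fP u).2].
- split=> // f [fl fP]; split=> [c a b|t].
    by apply/funext => u; apply: (fP u).1.
  by split=> [c a b|u]; [rewrite fl|exact: (fP u).2].
- by [].
Qed.

(** [shift] twists the left action, so that [S] does not pass to it pointwise; the induction goes
    through [coshift], whose left action is pointwise. *)
Lemma hoch0_lcoinduced A V (Y : bimod A V) n :
  bimod_axioms Y -> lcoinduced Y -> hoch0 n Y.
Proof.
elim: n V Y => [|n IHn] V Y ax [S [Sin Sl Sy SL SR]]; have sY := carrier_sub ax.
  move=> d [dl dP dD]; have cd : carrier (shift Y) d by [].
  exists (S d); split; first exact: Sin.
  move=> a; have /esym := SL a d cd.
  rewrite (_ : (fun t => d (t * a)) =
      (fun t => lact Y t (d a)) + (fun t => ract Y a (d t))); last first.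
    by apply/funext => t; apply: dD.
  rewrite (lin_onD Sl) //; last first.
  - exact: shift_ract.
  - exact: shift_lactr.
  by rewrite SR // Sy // /inner => ->; rewrite addrK.
apply: (hoch0_coshift ax); apply: IHn; first exact: coshift_axioms.
have lev (F : A -> A -> V) t : carrier (shift (coshift Y)) F ->
    carrier (shift Y) (fun u => F u t).
  by move=> [Fl FP]; split=> [c a b|u]; [rewrite Fl|exact: (FP u).2].
exists (fun F t => S (fun u => F u t)); split.
- move=> F cF; have [Fl FP] := cF; split=> [c a b|t]; last exact/Sin/lev.
  rewrite -Sl; [|exact: lev..]; congr S; apply/funext => u.
  exact: (FP u).1.
- move=> c F G cF cG; apply/funext => t.
  by apply: (Sl c (fun u => F u t) (fun u => G u t)); apply: lev.
- by move=> f [fl fP]; apply/funext => t; apply: Sy.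
- move=> a F cF; apply/funext => t /=.
  by rewrite -SL //; apply: lev.
- move=> a F cF; apply/funext => t /=.
  change (S (fun u => F u (a * t) - ract Y t (F u a)) =
    S (fun u => F u (a * t)) - ract Y t (S (fun u => F u a))).
  rewrite -SR; last exact: lev.
  apply: (@lin_onB _ _ _ _ _ (carrier_sub (shift_axioms ax)) Sl (fun u => F u (a * t))
    (fun u => ract Y t (F u a))); first exact: lev.
  by apply: shift_ract => //; apply: lev.
Qed.
End Acyclicity.

(** * Commuting bimodule structures *)

Section Exchange.
Variables (k : fieldType).
Implicit Types A B : fdAlg k.

Record commuting A B V (YA : bimod A V) (YB : bimod B V) : Prop := Commuting {
  commuting_carrier : carrier YA = carrier YB;
  commuting_ll : forall a b x, carrier YA x -> lact YA a (lact YB b x) = lact YB b (lact YA a x);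
  commuting_lr : forall a b x, carrier YA x -> lact YA a (ract YB b x) = ract YB b (lact YA a x);
  commuting_rl : forall a b x, carrier YA x -> ract YA a (lact YB b x) = lact YB b (ract YA a x);
  commuting_rr : forall a b x, carrier YA x -> ract YA a (ract YB b x) = ract YB b (ract YA a x)
}.

Lemma commuting_sym A B V (YA : bimod A V) (YB : bimod B V) :
  commuting YA YB -> commuting YB YA.
Proof. by case=> E ll lr rl rr; split=> // *; rewrite ?ll ?lr ?rl ?rr // E. Qed.

Definition fixed A B V (YA : bimod A V) (YB : bimod B V) : bimod A V :=
  Bimod (invar YB) (lact YA) (ract YA).

Lemma fixed_axioms A B V (YA : bimod A V) (YB : bimod B V) :
    bimod_axioms YA -> bimod_axioms YB -> commuting YA YB ->
  bimod_axioms (fixed YA YB).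
Proof.
move=> axA axB [E ll lr rl rr].
have inA x : invar YB x -> carrier YA x by case; rewrite E.
split=> /=.
- exact: invar_subspace.
- move=> a x ix; have Ax := inA _ ix; case: ix => Bx ix.
  split=> [|b]; first by rewrite -E; apply: lact_in.
  by rewrite -ll // -lr // ix.
- move=> a x ix; have Ax := inA _ ix; case: ix => Bx ix.
  split=> [|b]; first by rewrite -E; apply: ract_in.
  by rewrite -rl // -rr // ix.
- by move=> a c x y /inA Ax /inA Ay; apply: (lact_lin axA).
- by move=> a c x y /inA Ax /inA Ay; apply: (ract_lin axA).
- by move=> x /inA; apply: (lact_linl axA).
- by move=> x /inA; apply: (ract_linl axA).
- by move=> a b x /inA; apply: (lactM axA).
- by move=> a b x /inA; apply: (ractM axA).
- by move=> a b x /inA; apply: (lact_ract axA).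
Qed.

Section Shift.
Variables (A B : fdAlg k) (V : lmodType k) (YA : bimod A V) (YB : bimod B V).
Hypotheses (axA : bimod_axioms YA) (axB : bimod_axioms YB) (C : commuting YA YB).

Lemma commuting_shift : commuting (lin_bimod B YA) (shift YB).
Proof.
have [E ll lr rl rr] := C; have sA := carrier_sub axA.
have Bl b x : carrier YA x -> carrier YA (lact YB b x) by rewrite E; apply: lact_in.
split=> [|a b f [fl fP]|a b f [fl fP]|a b f [fl fP]|a b f [fl fP]] /=.
- by rewrite E.
- apply/funext => t; rewrite (lin_onB sA (lact_lin axA a)) ?ll //; exact: Bl.
- by apply/funext => t; rewrite lr.
- apply/funext => t; rewrite (lin_onB sA (ract_lin axA a)) ?rl //; exact: Bl.
- by apply/funext => t; rewrite rr.
Qed.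

(** The target consists of the B-derivations with values in Y. So [inner YB] has the B-invariants as
    kernel, and it is onto once H^1(B, Y) vanishes. *)
Lemma inner_fixed_hom : bimod_hom YA (fixed (lin_bimod B YA) (shift YB)) (inner YB).
Proof.
have [E ll lr rl rr] := C; have sA := carrier_sub axA.
have Bl b x : carrier YA x -> carrier YA (lact YB b x) by rewrite E; apply: lact_in.
have Br b x : carrier YA x -> carrier YA (ract YB b x) by rewrite E; apply: ract_in.
split=> /=.
- by rewrite E => v Yv; apply/derivationP/derivation_inner.
- by move=> c x y; rewrite E => Yx Yy; apply/funext => b; apply: (inner_linear b axB).
- move=> a x Yx; apply/funext => b; rewrite /inner -ll // -lr //.
  by rewrite (lin_onB sA (lact_lin axA a)) //; [apply: Bl|apply: Br].
- move=> a x Yx; apply/funext => b; rewrite /inner -rl // -rr //.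
  by rewrite (lin_onB sA (ract_lin axA a)) //; [apply: Bl|apply: Br].
Qed.

Lemma inner_fixed_surj z : hoch0 0 YB ->
    carrier (fixed (lin_bimod B YA) (shift YB)) z ->
  exists2 y, carrier YA y & inner YB y = z.
Proof.
move=> zB /derivationP/zB[v [Yv dv]]; exists v; last by apply/esym/funext.
by rewrite (commuting_carrier C).
Qed.

Lemma hoch0_inner_kernel n : hoch0 n (kernel YA (inner YB)) -> hoch0 n (fixed YA YB).
Proof.
apply: hoch0_ext => // x /=; rewrite (commuting_carrier C); split=> [] [Yx ix].
  split=> // b; apply/eqP; rewrite -subr_eq0; apply/eqP; exact: (congr1 (@^~ b) ix).
by split=> //; apply/funext => b; rewrite /inner ix subrr.
Qed.
End Shift.

(* If G is acyclic for both structures then both sides compute the cohomology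
   of the double complex of A- and B-cochains of G; the proof shifts along
   0 -> G^B -> G -> (shift_B G)^B -> 0.                                       *)
Lemma hoch0_exchange A B V (YA : bimod A V) (YB : bimod B V) n :
    bimod_axioms YA -> bimod_axioms YB -> commuting YA YB ->
    (forall m, hoch0 m YA) -> (forall m, hoch0 m YB) ->
  hoch0 n (fixed YB YA) -> hoch0 n (fixed YA YB).
Proof.
elim: n V YA YB => [|n IHn] V YA YB axA axB C zA zB zBA.
  have H := inner_fixed_hom axA axB C.
  apply: (hoch0_inner_kernel C); apply: (hoch0_kernel0 axA H (zA 0%N)) => z [iz az].
  (* An A-invariant derivation of B is a derivation into the A-invariants. *)
  have [|v [[Yv iv] dv]] := zBA z.
    have [zl zP zD] := (derivationP _ _).2 iz; split=> // b.
    split; first by rewrite (commuting_carrier C).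
    by move=> a; exact: (congr1 (@^~ b) (az a)).
  by exists v => //; apply/esym/funext.
have axA' := lin_bimod_axioms B axA; have axB' := shift_axioms axB.
have C' := commuting_shift axA axB C.
apply: (hoch0_inner_kernel C).
apply: (hoch0_kernel axA (fixed_axioms axA' axB' C') (inner_fixed_hom axA axB C)).
- by move=> z; apply: inner_fixed_surj => //; apply: (zB 0%N).
- apply: IHn => // [m|m|]; [exact: hoch0_lin_bimod|exact: (zB m.+1)|].
  (* Shifting over B commutes with taking A-invariants. *)
  apply: (@hoch0_ext _ _ _ (shift (fixed YB YA)) _ n _ _ _ zBA) => // f /=; split=> [[fl fP]|[[fl fP] fi]].
    split; first by split=> // t; have [] := fP t.
    by move=> a; apply/funext => t; have [_] := fP t; apply.
  split=> // t; split=> // a; exact: (congr1 (@^~ t) (fi a)).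
- exact: zA.
Qed.
End Exchange.

(** * Modules, free modules and resolutions *)

Section ModuleConstructions.

Definition mklin (R : pzRingType) (U V : lmodType R) (f : U -> V)
  (fl : linear f) : {linear U -> V} := HB.pack f (GRing.isLinear.Build R U V *:%R f fl).

Lemma mklinE (R : pzRingType) (U V : lmodType R) (f : U -> V) (fl : linear f) x :
  mklin fl x = f x.
Proof. by []. Qed.

Definition restr (R S : pzRingType) (g : R -> S) (X : lmodType S) : Type := X.
HB.instance Definition _ R S g X := GRing.Zmodule.on (@restr R S g X).

Section Restriction.
Variables (R S : pzRingType) (g : {rmorphism R -> S}) (X : lmodType S).
Definition restr_scale (a : R) (x : restr g X) : restr g X := g a *: (x : X).
Fact restr_scaleA a b x : restr_scale a (restr_scale b x) = restr_scale (a * b) x.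
Proof. by rewrite /restr_scale scalerA rmorphM. Qed.
Fact restr_scale1 : left_id 1 restr_scale.
Proof. by move=> x; rewrite /restr_scale rmorph1 scale1r. Qed.
Fact restr_scaleDr : right_distributive restr_scale +%R.
Proof. by move=> a x y; apply: scalerDr. Qed.
Fact restr_scaleDl x : {morph restr_scale^~ x : a b / a + b}.
Proof. by move=> a b; rewrite /restr_scale rmorphD scalerDl. Qed.
HB.instance Definition _ := GRing.Zmodule_isLmodule.Build R (restr g X)
  restr_scaleA restr_scale1 restr_scaleDr restr_scaleDl.

Lemma restrE (a : R) (x : restr g X) : a *: x = g a *: (x : X).
Proof. by []. Qed.
End Restriction.

(* sm_act is only meaningful on sm_in.                                        *)
Record submod_data (R : pzRingType) (V : zmodType) := SubmodData {
  sm_in : V -> Prop;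
  sm_act : R -> V -> V;
  sm0 : sm_in 0;
  smB : forall x y, sm_in x -> sm_in y -> sm_in (x - y);
  sm_act_in : forall a x, sm_in x -> sm_in (sm_act a x);
  sm_actA : forall a b x, sm_in x -> sm_act a (sm_act b x) = sm_act (a * b) x;
  sm_act1 : forall x, sm_in x -> sm_act 1 x = x;
  sm_actDr : forall a x y, sm_in x -> sm_in y -> sm_act a (x + y) = sm_act a x + sm_act a y;
  sm_actDl : forall a b x, sm_in x -> sm_act (a + b) x = sm_act a x + sm_act b x
}.

Section Submod.
Variables (R : pzRingType) (V : zmodType) (D : submod_data R V).
Definition sm_pred : pred V := fun x => `[< sm_in D x >].
Fact sm_pred_closed : zmod_closed sm_pred.
Proof.
split; first exact/asboolP/sm0.
by move=> x y /asboolP Dx /asboolP Dy; apply/asboolP/smB.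
Qed.
HB.instance Definition _ := GRing.isZmodClosed.Build V sm_pred sm_pred_closed.
Definition submod : Type := {x : V | sm_pred x}.
HB.instance Definition _ := SubChoice.on submod.
HB.instance Definition _ := [SubChoice_isSubZmodule of submod by <:].

Definition sm_val (x : submod) : V := sval x.
Definition sm_mk (x : V) (Dx : sm_in D x) : submod := exist _ x (asboolT Dx).

Lemma sm_valP (x : submod) : sm_in D (sm_val x).
Proof. exact/asboolP/(svalP x). Qed.
Lemma sm_val_inj : injective sm_val.
Proof. exact: val_inj. Qed.
Lemma sm_valD x y : sm_val (x + y) = sm_val x + sm_val y.
Proof. by []. Qed.
Definition sm_scale (a : R) (x : submod) : submod := sm_mk (sm_act_in a (sm_valP x)).
Fact sm_scaleA a b x : sm_scale a (sm_scale b x) = sm_scale (a * b) x.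
Proof. by apply: sm_val_inj; apply/sm_actA/sm_valP. Qed.
Fact sm_scale1 : left_id 1 sm_scale.
Proof. by move=> x; apply: sm_val_inj; apply/sm_act1/sm_valP. Qed.
Fact sm_scaleDr : right_distributive sm_scale +%R.
Proof. by move=> a x y; apply: sm_val_inj; apply/sm_actDr; apply/sm_valP. Qed.
Fact sm_scaleDl x : {morph sm_scale^~ x : a b / a + b}.
Proof. by move=> a b; apply: sm_val_inj; apply/sm_actDl/sm_valP. Qed.
HB.instance Definition _ := GRing.Zmodule_isLmodule.Build R submod
  sm_scaleA sm_scale1 sm_scaleDr sm_scaleDl.

Lemma sm_valZ a (x : submod) : sm_val (a *: x) = sm_act D a (sm_val x).
Proof. by []. Qed.
End Submod.

Section Ker.
Variables (R : pzRingType) (X Y : lmodType R) (f : {linear X -> Y}).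

Fact ker_data : submod_data R X.
Proof.
apply: (@SubmodData R X (fun x => f x = 0) (fun a x => a *: x)).
- exact: linear0.
- by move=> x y fx fy; rewrite linearB fx fy subrr.
- by move=> a x fx; rewrite linearZ /= fx scaler0.
- by move=> a b x _; rewrite scalerA.
- by move=> x _; rewrite scale1r.
- by move=> a x y _ _; rewrite scalerDr.
- by move=> a b x _; rewrite scalerDl.
Defined.

Definition ker : lmodType R := submod ker_data.
Definition ker_val_fun (x : ker) : X := sm_val x.
Fact ker_val_linear : linear ker_val_fun.
Proof. by []. Qed.
Definition ker_val : {linear ker -> X} := mklin ker_val_linear.

Lemma ker_valK x : f (ker_val x) = 0.
Proof. exact: (sm_valP x). Qed.

Lemma ker_val_inj : injective ker_val.
Proof. exact: sm_val_inj. Qed.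

Lemma ker_val_onto x : f x = 0 -> exists y, ker_val y = x.
Proof. by move=> fx; exists (@sm_mk _ _ ker_data x fx). Qed.

Section Corestriction.
Variables (Z : lmodType R) (g : {linear Z -> X}).
Hypothesis fg : forall z, f (g z) = 0.
Definition ker_corestr_fun (z : Z) : ker := @sm_mk _ _ ker_data (g z) (fg z).
Fact ker_corestr_linear : linear ker_corestr_fun.
Proof. by move=> a x y; apply: ker_val_inj; rewrite /= /ker_val_fun /= linearP. Qed.
Definition ker_corestr : {linear Z -> ker} := mklin ker_corestr_linear.

Lemma ker_corestrK z : ker_val (ker_corestr z) = g z.
Proof. by []. Qed.
End Corestriction.
End Ker.
End ModuleConstructions.

(** * Modules induced from vector spaces *)

Section FreeModules.
Variables (R : pzRingType) (k : fieldType) (kap : {rmorphism k -> R}).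

Definition free_ra (c : k) (r : R) : R := r * kap c.
Definition free_la (X : lmodType k) (c : k) (x : X) : X := c *: x.

(* The tensor product of R and X over k.                                      *)
Definition free_mod (X : lmodType k) : Type := tens free_ra (@free_la X).
HB.instance Definition _ X := GRing.Zmodule.on (free_mod X).

Section Free.
Variable X : lmodType k.
Definition free_cls (s : seq (R * X)) : free_mod X := tens_cls free_ra (@free_la X) s.

Lemma free_ind (P : free_mod X -> Prop) : (forall s, P (free_cls s)) -> forall x, P x.
Proof. exact: tens_ind. Qed.

Lemma free_addE s t : free_cls s + free_cls t = free_cls (s ++ t).
Proof. exact: tens_addE. Qed.

Definition free_scale (a : R) (x : free_mod X) : free_mod X :=
  free_cls [seq (a * p.1, p.2) | p <- repr (x : tens free_ra (@free_la X))].

Lemma free_scaleE a s : free_scale a (free_cls s) = free_cls [seq (a * p.1, p.2) | p <- s].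
Proof.
apply/tens_clsP; move: (repr _) (tens_repr free_ra (@free_la X) s) => t; elim=> {s t} /=.
- by move=> t; apply: tens_refl.
- by move=> t u _; apply: tens_sym.
- by move=> t u v _ IH1 _; apply: tens_trans IH1.
- by move=> t t' u u' _ IH1 _ IH2; rewrite !map_cat; apply: tens_cat.
- by move=> t u; rewrite !map_cat; apply: tens_catC.
- by move=> n; rewrite mulr0; apply: tens_0l.
- by move=> m; apply: tens_0r.
- by move=> m m' n; rewrite mulrDr; apply: tens_Dl.
- by move=> m n n'; apply: tens_Dr.
- by move=> c m n; rewrite /free_ra mulrA; apply: tens_bal.
Qed.

Fact free_scaleA a b x : free_scale a (free_scale b x) = free_scale (a * b) x.
Proof.
elim/free_ind: x => s; rewrite !free_scaleE -map_comp; congr free_cls.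
by apply: eq_map => p /=; rewrite mulrA.
Qed.

Fact free_scale1 : left_id 1 free_scale.
Proof.
elim/free_ind=> s; rewrite free_scaleE; congr free_cls.
by rewrite -[RHS]map_id; apply: eq_map => -[a x]; rewrite /= mul1r.
Qed.

Fact free_scaleDr : right_distributive free_scale +%R.
Proof.
by move=> a; elim/free_ind=> s; elim/free_ind=> t; rewrite free_addE !free_scaleE free_addE map_cat.
Qed.

Fact free_scaleDl x : {morph free_scale^~ x : a b / a + b}.
Proof.
elim/free_ind: x => s a b /=; rewrite !free_scaleE free_addE; apply/tens_clsP.
elim: s => [|[r x] s IHs] /=; first exact: tens_refl.
apply: (@tens_trans _ _ _ _ _ _
  ([:: (a * r, x); (b * r, x)] ++ ([seq (a * p.1, p.2) | p <- s] ++ [seq (b * p.1, p.2) | p <- s]))).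
  rewrite mulrDl; apply: (tens_cat (s := [:: (a * r + b * r, x)]) _ IHs); exact: tens_Dl.
apply: tens_rel_perm; rewrite /= perm_cons.
by rewrite -[(b * r, x) :: _]cat1s -[(b * r, x) :: [seq _ | _ <- _]]cat1s perm_catCA.
Qed.
HB.instance Definition _ := GRing.Zmodule_isLmodule.Build R (free_mod X)
  free_scaleA free_scale1 free_scaleDr free_scaleDl.

Lemma scale_free_cls a s : a *: free_cls s = free_cls [seq (a * p.1, p.2) | p <- s].
Proof. exact: free_scaleE. Qed.

Definition free_gen (x : X) : free_mod X := free_cls [:: (1, x)].

Lemma free_clsE s : free_cls s = \sum_(p <- s) p.1 *: free_gen p.2.
Proof.
elim: s => [|[r x] s IHs]; first by rewrite big_nil.
by rewrite big_cons -IHs scale_free_cls free_addE /= mulr1.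
Qed.

Lemma free_gen_lin c x y : free_gen (c *: x + y) = kap c *: free_gen x + free_gen y.
Proof.
rewrite scale_free_cls free_addE /= mulr1; apply/tens_clsP.
apply: tens_trans (tens_Dr _ _ _ _ _) _.
apply: (tens_cat (s := [:: _]) (s' := [:: _])); last exact: tens_refl.
apply: tens_sym; rewrite -[kap c]mul1r; exact: tens_bal.
Qed.

Section Lift.
Variables (G : zmodType) (phi : R -> X -> G).
Hypotheses (phiDl : forall r r' x, phi (r + r') x = phi r x + phi r' x)
  (phiDr : forall r x x', phi r (x + x') = phi r x + phi r x')
  (phiZ : forall c r x, phi (r * kap c) x = phi r (c *: x)).

Lemma free_biadd : exists h : free_mod X -> G, (forall u v, h (u + v) = h u + h v) /\
  forall r x, h (r *: free_gen x) = phi r x.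
Proof.
exists (tens_lift phi).
have liftE s : tens_lift phi (free_cls s) = \sum_(p <- s) phi p.1 p.2.
  by apply: tens_liftE => // c r x; apply: phiZ.
split; last by move=> r x; rewrite scale_free_cls liftE big_seq1 /= mulr1.
by elim/free_ind=> s; elim/free_ind=> t; rewrite free_addE !liftE big_cat.
Qed.
End Lift.

Lemma free_additive_ext (G : zmodType) (h h' : free_mod X -> G) :
    (forall u v, h (u + v) = h u + h v) -> (forall u v, h' (u + v) = h' u + h' v) ->
    (forall r x, h (r *: free_gen x) = h' (r *: free_gen x)) ->
  h =1 h'.
Proof.
move=> hD h'D hh'; have h0 : h 0 = 0 by apply: (addrI (h 0)); rewrite -hD !addr0.
have h'0 : h' 0 = 0 by apply: (addrI (h' 0)); rewrite -h'D !addr0.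
elim/free_ind=> s; rewrite free_clsE; elim: s => [|p s IHs]; first by rewrite big_nil h0 h'0.
by rewrite big_cons hD h'D hh' IHs.
Qed.
End Free.

Lemma free_lift (X : lmodType k) (Y : lmodType R) (h : X -> Y) :
    (forall c x y, h (c *: x + y) = kap c *: h x + h y) ->
  exists f : {linear free_mod X -> Y}, forall x, f (free_gen x) = h x.
Proof.
move=> hl; have hD x y : h (x + y) = h x + h y.
  by rewrite -[x in LHS]scale1r hl rmorph1 scale1r.
have h0 : h 0 = 0 by apply: (addrI (h 0)); rewrite -hD !addr0.
have hZ c x : h (c *: x) = kap c *: h x by rewrite -[c *: x]addr0 hl h0 addr0.
have [|||f [fD fE]] := @free_biadd X Y (fun r x => r *: h x).
- by move=> r r' x; rewrite scalerDl.
- by move=> r x x'; rewrite hD scalerDr.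
- by move=> c r x; rewrite hZ scalerA.
have fl : linear f.
  move=> a u v; rewrite fD; congr (_ + _).
  move: u; apply: free_additive_ext => [u u'|u u'|r x].
  - by rewrite scalerDr fD.
  - by rewrite fD scalerDr.
  - by rewrite scalerA !fE scalerA.
by exists (mklin fl) => x; rewrite mklinE -[free_gen x]scale1r fE scale1r.
Qed.

(** Only the generators have to be lifted, and [linear_selection] lifts them k-linearly. *)
Lemma free_projective (X : lmodType k) : projective (free_mod X).
Proof.
move=> Y Z g f gs.
pose Rel (x : X) (y : restr kap Y) := g y = f (free_gen x).
have [||s [sl sR]] := @linear_choice k X (restr kap Y) (fun=> True) Rel (@subspaceT _ X).
- have f0 : f (free_gen 0) = 0.
    have := free_gen_lin 1 (0 : X) 0; rewrite !scale1r rmorph1 scale1r addr0 => E.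
    apply: (addrI (f (free_gen 0))); rewrite -linearD -E addr0; done.
  split; first by rewrite /Rel linear0 f0.
  move=> c x y x' y'; rewrite /Rel => Rxy Rxy'.
  by rewrite free_gen_lin !linearP /= -Rxy -Rxy' -linearP.
- by move=> x _; have [y gy] := gs (f (free_gen x)); exists y.
have [h hE] := @free_lift X Y s (fun c x y => sl c x y I I).
exists h; apply: free_additive_ext => [u v|u v|r x].
- by rewrite !linearD.
- by rewrite linearD.
- by rewrite !linearZ /= hE sR.
Qed.

Lemma free_cover (M : lmodType R) :
  exists f : {linear free_mod (restr kap M) -> M}, forall x, f (free_gen x) = x.
Proof. exact: (@free_lift (restr kap M) M id). Qed.

Lemma projective_section (P : lmodType R) : projective P ->
  exists f : {linear free_mod (restr kap P) -> P}, exists s : {linear P -> free_mod (restr kap P)},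
    (forall x, f (free_gen x) = x) /\ forall p, f (s p) = p.
Proof.
move=> pP; have [f fE] := free_cover P.
have [|s sE] := pP _ _ f (mklin (f := @id P) (fun _ _ _ => erefl)).
  by move=> y; exists (@free_gen (restr kap P) y); apply: fE.
by exists f, s.
Qed.
End FreeModules.

(** * Bimodules of linear maps and short exact sequences of modules *)

Section Coefficients.
Variables (k : fieldType) (A : fdAlg k) (R : pzRingType) (kap : {rmorphism k -> R}).
Hypothesis kapC : forall c r, kap c * r = r * kap c.

(* Data turning X |-> Hom_k(X, E), for R-modules X, into a contravariant
   functor to A-bimodules, through (a phi)(x) = cl a (phi (clam a x)) and
   (phi a)(x) = cr a (phi (crho a x)).                                        *)
Record coef := Coef {
  cE : lmodType k;
  cP : cE -> Prop;
  cl : A -> cE -> cE;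
  cr : A -> cE -> cE;
  clam : A -> R;
  crho : A -> R;
  cP_sub : subspace cP;
  cl_in : forall a v, cP v -> cP (cl a v);
  cr_in : forall a v, cP v -> cP (cr a v);
  cl_lin : forall a, linear_on cP (cl a);
  cr_lin : forall a, linear_on cP (cr a);
  clam_linl : forall f : restr kap R^o -> cE, lin f -> (forall u, cP (f u)) ->
    lin (fun a : A => cl a (f (clam a)));
  crho_linl : forall f : restr kap R^o -> cE, lin f -> (forall u, cP (f u)) ->
    lin (fun a : A => cr a (f (crho a)));
  clM : forall a b v, cP v -> cl (a * b) v = cl a (cl b v);
  crM : forall a b v, cP v -> cr (a * b) v = cr b (cr a v);
  clr : forall a b v, cP v -> cl a (cr b v) = cr b (cl a v);
  clamM : forall a b, clam (a * b) = clam b * clam a;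
  crhoM : forall a b, crho (a * b) = crho a * crho b;
  clamrho : forall a b, clam a * crho b = crho b * clam a
}.

Variable c : coef.

Definition klin (X : lmodType R) (f : X -> cE c) := @lin k (restr kap X) (cE c) f.

Lemma klinE (X : lmodType R) (f : X -> cE c) : klin f <-> forall s x y, f (kap s *: x + y) = s *: f x + f y.
Proof. by []. Qed.

Definition Hom_bimod (X : lmodType R) : bimod A (X -> cE c) :=
  Bimod (fun f : X -> cE c => klin f /\ forall x, cP (f x))
    (fun a f x => cl a (f (clam c a *: x))) (fun a f x => cr a (f (crho c a *: x))).

Lemma klin_scale (X : lmodType R) (f : X -> cE c) (r : R) : klin f -> klin (fun x => f (r *: x)).
Proof.
move=> fl s x y; rewrite -[RHS](fl s (r *: (x : X)) (r *: (y : X))).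
change (f (r *: (kap s *: (x : X) + y)) = f (kap s *: (r *: (x : X)) + r *: (y : X))).
by rewrite scalerDr !scalerA kapC.
Qed.

Lemma klin_eval (X : lmodType R) (f : X -> cE c) (x : X) : klin f ->
  @lin k (restr kap R^o) (cE c) (fun r : R => f (r *: x)).
Proof.
move=> fl s r r'; rewrite -[RHS](fl s ((r : R) *: x) ((r' : R) *: x)).
change (f ((kap s * r + r' : R) *: x) = f (kap s *: ((r : R) *: x) + (r' : R) *: x)).
by rewrite scalerA scalerDl.
Qed.

Lemma Hom_bimod_axioms X : bimod_axioms (Hom_bimod X).
Proof.
have [P0 PL] := cP_sub c.
split=> /=.
- split; first by split=> //; apply: lin_fct0.
  by move=> s f g [fl fP] [gl gP]; split=> [|x]; [apply: (@lin_fctL k (restr kap X))|exact: PL].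
- move=> a f [fl fP]; split=> [s x y|x]; last exact: cl_in.
  by rewrite (klin_scale _ fl) cl_lin.
- move=> a f [fl fP]; split=> [s x y|x]; last exact: cr_in.
  by rewrite (klin_scale _ fl) cr_lin.
- by move=> a s f g [fl fP] [gl gP]; apply/funext => x; apply: cl_lin.
- by move=> a s f g [fl fP] [gl gP]; apply/funext => x; apply: cr_lin.
- move=> f [fl fP] s a b; apply/funext => x.
  by apply: (clam_linl (klin_eval x fl)).
- move=> f [fl fP] s a b; apply/funext => x.
  by apply: (crho_linl (klin_eval x fl)).
- by move=> a b f [fl fP]; apply/funext => x; rewrite clM // scalerA clamM.
- by move=> a b f [fl fP]; apply/funext => x; rewrite crM // scalerA crhoM.
- by move=> a b f [fl fP]; apply/funext => x; rewrite clr // !scalerA clamrho.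
Qed.

Lemma Hom_bimod_comp (X Y : lmodType R) (g : {linear X -> Y}) :
  bimod_hom (Hom_bimod Y) (Hom_bimod X) (fun f x => f (g x)).
Proof.
split=> //=.
- move=> f [fl fP]; split=> // s x y.
  by rewrite -(fl s (g x) (g y)); congr f; rewrite linearP.
- by move=> a f _; apply/funext => x; rewrite linearZ.
- by move=> a f _; apply/funext => x; rewrite linearZ.
Qed.

Lemma klin0 (X : lmodType R) (f : X -> cE c) : klin f -> f 0 = 0.
Proof. exact: lin0. Qed.

Lemma klinB (X : lmodType R) (f : X -> cE c) x y : klin f -> f (x - y) = f x - f y.
Proof. by move=> fl; apply: (linB fl). Qed.

Lemma klinD (X : lmodType R) (f : X -> cE c) x y : klin f -> f (x + y) = f x + f y.
Proof. by move=> fl; apply: (linD fl). Qed.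

Lemma Hom_bimod_extend (X Y : lmodType R) (g : {linear X -> Y}) f :
    injective g -> carrier (Hom_bimod X) f ->
  exists2 h, carrier (Hom_bimod Y) h & (fun x => h (g x)) = f.
Proof.
move=> gi [fl fP]; have [P0 PL] := cP_sub c.
have [|||||s [sl sP sE]] := @linear_selection k (restr kap Y) (cE c) (fun=> True) (fun _ v => cP v)
  (fun y v => exists x, y = g x /\ v = f x) (@subspaceT _ _).
- by split=> // *; apply: PL.
- split; first by exists 0; rewrite linear0 klin0.
  move=> s _ _ _ _ [x [-> ->]] [y [-> ->]]; exists (kap s *: x + y).
  by rewrite linearP (klinE _).1.
- by move=> y _; exists 0.
- by move=> u v [x [_ ->]].
- move=> v [x [gx ->]]; have -> : x = 0 by apply: gi; rewrite linear0 -gx.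
  exact: klin0.
exists s; first by split=> // [s0 x y|y]; [apply: sl|exact: sP].
by apply/funext => x; apply: sE; exists x.
Qed.

Lemma Hom_bimod_factor (X Y : lmodType R) (g : {linear X -> Y}) f :
    (forall y, exists x, g x = y) -> carrier (Hom_bimod X) f ->
    (forall x, g x = 0 -> f x = 0) ->
  exists2 h, carrier (Hom_bimod Y) h & forall x, h (g x) = f x.
Proof.
move=> gs [fl fP] fg; have /choice[s gsK] := gs.
have E x x' : g x = g x' -> f x = f x'.
  move=> gx; apply/eqP; rewrite -subr_eq0 -klinB //; apply/eqP/fg.
  by rewrite linearB gx subrr.
exists (fun y => f (s y)); last by move=> x; apply: E; rewrite gsK.
split=> // a x y; rewrite -[RHS](fl a (s x) (s y)); apply: E.
by rewrite gsK linearP !gsK.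
Qed.

Lemma Hom_bimod_invar (X Y : lmodType R) (g : {linear X -> Y}) f :
    (forall y, exists x, g x = y) -> carrier (Hom_bimod Y) f ->
  invar (Hom_bimod X) (fun x => f (g x)) -> invar (Hom_bimod Y) f.
Proof.
move=> gs fY [_ fi]; split=> // a; apply/funext => y /=; have [x <-] := gs y.
by have := congr1 (@^~ x) (fi a); rewrite /= !linearZ.
Qed.

Section Exact.
Variables (K P M : lmodType R) (i : {linear K -> P}) (p : {linear P -> M}).
Hypotheses (i_inj : injective i) (p_surj : forall m, exists x, p x = m).
Hypotheses (pi0 : forall x, p (i x) = 0) (ip : forall x, p x = 0 -> exists y, i y = x).
Let res (f : P -> cE c) x := f (i x).

Let res_surj z : carrier (Hom_bimod K) z ->
  exists2 y, carrier (Hom_bimod P) y & res y = z.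
Proof. exact: Hom_bimod_extend. Qed.

(** Maps in the kernel are constant on the fibres of [p], so any set-theoretic section of [p]
    identifies the kernel with [Hom_bimod M]. *)
Let hoch0_res_kernel n :
  hoch0 n (kernel (Hom_bimod P) res) <-> hoch0 n (Hom_bimod M).
Proof.
have /choice[s pK] := p_surj.
have axM := Hom_bimod_axioms M.
have axK := kernel_axioms (Hom_bimod_axioms P) (Hom_bimod_axioms K) (Hom_bimod_comp i).
have E f x x' : carrier (kernel (Hom_bimod P) res) f -> p x = p x' -> f x = f x'.
  move=> [[fl _] fi] pxx'; apply/eqP; rewrite -subr_eq0 -klinB //.
  have [|y <-] := ip (x := x - x'); first by rewrite linearB pxx' subrr.
  by rewrite -[f (i y)]/(res f y) fi.
have jH : bimod_hom (Hom_bimod M) (kernel (Hom_bimod P) res) (fun f x => f (p x)).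
  have [h1 h2 h3 h4] := Hom_bimod_comp p; split=> // f Mf; split; first exact: h1.
  by apply/funext => x; rewrite /res pi0 klin0 //; case: Mf.
have qH : bimod_hom (kernel (Hom_bimod P) res) (Hom_bimod M) (fun f x => f (s x)).
  split=> //=.
  - move=> f Kf; have [[fl fP] _] := Kf; split=> // a x y.
    rewrite -[RHS](fl a (s x) (s y)); apply: (E _ _ _ Kf).
    by rewrite pK linearP !pK.
  - move=> a f Kf; apply/funext => x; congr (cl a _); apply: (E _ _ _ Kf).
    by rewrite linearZ /= !pK.
  - move=> a f Kf; apply/funext => x; congr (cr a _); apply: (E _ _ _ Kf).
    by rewrite linearZ /= !pK.
split.
  apply: (hoch0_hom_retract axK axM jH qH) => f Mf.
  by apply/funext => x; rewrite pK.
apply: (hoch0_hom_retract axM axK qH jH) => f Kf.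
by apply/funext => x; apply: (E _ _ _ Kf); rewrite pK.
Qed.

Lemma hoch0_Hom_invar : hoch0 0 (Hom_bimod M) ->
  forall f, invar (Hom_bimod K) f -> exists2 g, invar (Hom_bimod P) g & forall x, g (i x) = f x.
Proof.
move=> /hoch0_res_kernel zK f fi.
have [g gi gf] := invar_lift (Hom_bimod_axioms P) (Hom_bimod_comp i) res_surj zK fi.
by exists g => // x; rewrite -gf.
Qed.

Lemma hoch0_Hom0 : hoch0 0 (Hom_bimod P) ->
    (forall f, invar (Hom_bimod K) f ->
      exists2 g, invar (Hom_bimod P) g & forall x, g (i x) = f x) ->
  hoch0 0 (Hom_bimod M).
Proof.
move=> zP lift; apply/hoch0_res_kernel.
apply: (hoch0_kernel0 (Hom_bimod_axioms P) (Hom_bimod_comp i) zP) => f /lift[g gi gf].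
by exists g => //; apply/funext.
Qed.

Lemma hoch0_HomS n : hoch0 n (Hom_bimod K) -> hoch0 n.+1 (Hom_bimod P) ->
  hoch0 n.+1 (Hom_bimod M).
Proof.
move=> zK zP; apply/hoch0_res_kernel.
exact: (hoch0_kernel (Hom_bimod_axioms P) (Hom_bimod_axioms K) (Hom_bimod_comp i)).
Qed.

Lemma hoch0_Hom_syzygy n : hoch0 n (Hom_bimod P) -> hoch0 n.+1 (Hom_bimod M) ->
  hoch0 n (Hom_bimod K).
Proof.
move=> zP /hoch0_res_kernel zM.
exact: (hoch0_cokernel (Hom_bimod_axioms P) (Hom_bimod_axioms K) (Hom_bimod_comp i)) zP zM.
Qed.
End Exact.

Section ExactKer.
Variables (P M : lmodType R) (p : {linear P -> M}).
Hypothesis p_surj : forall m, exists x, p x = m.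

Lemma hoch0_ker_invar : hoch0 0 (Hom_bimod M) ->
  forall f, invar (Hom_bimod (ker p)) f ->
  exists2 g, invar (Hom_bimod P) g & forall x, g (ker_val p x) = f x.
Proof. exact: hoch0_Hom_invar (@ker_val_inj _ _ _ p) p_surj (@ker_valK _ _ _ p) (@ker_val_onto _ _ _ p). Qed.

Lemma hoch0_ker0 : hoch0 0 (Hom_bimod P) ->
    (forall f, invar (Hom_bimod (ker p)) f ->
      exists2 g, invar (Hom_bimod P) g & forall x, g (ker_val p x) = f x) ->
  hoch0 0 (Hom_bimod M).
Proof. exact: hoch0_Hom0 p_surj (@ker_valK _ _ _ p) (@ker_val_onto _ _ _ p). Qed.

Lemma hoch0_kerS n : hoch0 n (Hom_bimod (ker p)) -> hoch0 n.+1 (Hom_bimod P) ->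
  hoch0 n.+1 (Hom_bimod M).
Proof. exact: hoch0_HomS (@ker_val_inj _ _ _ p) p_surj (@ker_valK _ _ _ p) (@ker_val_onto _ _ _ p) n. Qed.

Lemma hoch0_ker n : hoch0 n (Hom_bimod P) -> hoch0 n.+1 (Hom_bimod M) ->
  hoch0 n (Hom_bimod (ker p)).
Proof. exact: hoch0_Hom_syzygy (@ker_val_inj _ _ _ p) p_surj (@ker_valK _ _ _ p) (@ker_val_onto _ _ _ p) n. Qed.
End ExactKer.

(** [P] is a retract of the free module on its underlying space, and by adjunction Hom(R (x) P, E)
    is Hom_k(P, Hom(R, E)), to which [hoch0_lin_bimod] applies. *)
Lemma hoch0_Hom_projective (P : lmodType R) n : projective P ->
  hoch0 n (Hom_bimod R^o) -> hoch0 n (Hom_bimod P).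
Proof.
move=> /(projective_section kap)[f [s [fE fs]]].
have axR := Hom_bimod_axioms R^o; have axP := Hom_bimod_axioms P.
move=> /(hoch0_lin_bimod (restr kap P) axR).
have axl := lin_bimod_axioms (restr kap P) axR.
pose good (F : restr kap P -> R -> cE c) := carrier (lin_bimod (restr kap P) (Hom_bimod R^o)) F.
pose mult F (h : free_mod kap (restr kap P) -> cE c) :=
  (forall u v, h (u + v) = h u + h v) /\ forall r x, h (r *: free_gen kap x) = F x r.
(* [m F] will be the additive map induced by a bilinear [F]; for all other [F] the value 0 is a
   placeholder. *)
have multE F : exists h, good F -> mult F h.
  have [[Fl FP]|nF] := pselect (good F); last by exists 0 => /nF.
  have [|||h hm] := @free_biadd R k kap (restr kap P) (cE c) (fun r x => F x r).
  - by move=> r r' x; apply: (klinD _ _ (FP x).1).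
  - by move=> r x x'; rewrite (linD Fl).
  - move=> s0 r x; rewrite (linZ Fl) -kapC.
    by rewrite -[LHS]/((F x) (s0 *: (r : restr kap R^o))) (linZ (FP x).1).
  by exists h.
have {multE} [m mP] := choice multE.
have mP0 F u : good F -> cP (m F u).
  move=> gF; have [mD mE] := mP F gF; have [P0 PL] := cP_sub c.
  elim/free_ind: u => l; rewrite free_clsE; elim: l => [|p l IHl].
    by rewrite big_nil (_ : m F 0 = 0) //; apply: (addrI (m F 0)); rewrite -mD !addr0.
  rewrite big_cons mD mE; apply: (subspaceD (cP_sub c)) => //.
  exact: (gF.2 _).2.
have mZ F a (u : free_mod kap (restr kap P)) : good F -> m F (kap a *: u) = a *: m F u.
  move=> gF; have [mD mE] := mP F gF.
  move: u; apply: free_additive_ext => [u v|u v|r x].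
  - by rewrite scalerDr mD.
  - by rewrite mD scalerDr.
  - by rewrite scalerA !mE -[LHS]/((F x) (a *: (r : restr kap R^o))) (linZ (gF.2 x).1).
have eqm F (h : free_mod kap (restr kap P) -> cE c) : good F -> mult F h -> h =1 m F.
  move=> gF [hD hE]; have [mD mE] := mP F gF.
  by apply: free_additive_ext => // r x; rewrite hE mE.
apply: (@hoch0_hom_retract _ A _ _ _ _ (fun (g : P -> cE c) (x : P) (r : R) => g (r *: x))
  (fun F p => m F (s p))) => //.
- split=> //=.
  + move=> g [gl gP]; split=> [a x y|x].
      apply/funext => r; rewrite restrE scalerDr scalerA -kapC -scalerA.
      exact: gl.
    by split=> [a r r'|r]; [apply: klin_eval|exact: gP].
  + move=> a g [gl gP]; apply/funext => x; apply/funext => r.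
    by rewrite scalerA.
  + move=> a g [gl gP]; apply/funext => x; apply/funext => r.
    by rewrite scalerA.
- split=> /=.
  + move=> F gF; split=> [a x y|x]; last exact: mP0.
    by rewrite restrE linearP (mP F gF).1 mZ.
  + move=> a F G gF gG; apply/funext => x.
    have gFG : good (a *: F + G) by apply: (carrier_sub axl).2.
    rewrite -(eqm _ (a *: m F + m G) gFG) //; split.
      move=> u v; change (a *: m F (u + v) + m G (u + v) = a *: m F u + m G u + (a *: m F v + m G v)).
      by rewrite (mP F gF).1 (mP G gG).1 scalerDr addrACA.
    move=> r y; change (a *: m F (r *: free_gen kap y) + m G (r *: free_gen kap y) = a *: F y r + G y r).
    by rewrite (mP F gF).2 (mP G gG).2.
  + move=> a F gF; apply/funext => x.
    have gaF := lact_in axl a gF.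
    rewrite -(eqm _ (fun u => cl a (m F (clam c a *: u))) gaF); first by rewrite linearZ.
    split; last by move=> r y; rewrite scalerA (mP F gF).2.
    by move=> u v; rewrite scalerDr (mP F gF).1 (lin_onD (@cl_lin c a)) //; apply: mP0.
  + move=> a F gF; apply/funext => x.
    have gaF := ract_in axl a gF.
    rewrite -(eqm _ (fun u => cr a (m F (crho c a *: u))) gaF); first by rewrite linearZ.
    split; last by move=> r y; rewrite scalerA (mP F gF).2.
    by move=> u v; rewrite scalerDr (mP F gF).1 (lin_onD (@cr_lin c a)) //; apply: mP0.
- move=> g [gl gP]; apply/funext => p.
  set F := fun x r => _.
  have gF : good F.
    split=> [a x y|x].
      apply/funext => r; rewrite /F restrE scalerDr scalerA -kapC -scalerA.
      exact: gl.
    by split=> [a r r'|r]; [apply: klin_eval|exact: gP].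
  rewrite -(eqm _ (fun u => g (f u)) gF); first by rewrite fs.
  split; first by move=> u v; rewrite linearD (klinD _ _ gl).
  by move=> r x; rewrite linearZ /= fE.
Qed.
End Coefficients.

(** * Cohomology computed by projective resolutions *)

Section Resolutions.
Variables (k : fieldType) (A : fdAlg k) (R : pzRingType) (kap : {rmorphism k -> R}).
Hypothesis kapC : forall c r, kap c * r = r * kap c.
Variable c : coef A kap.
Local Notation H X := (Hom_bimod c X).

Section ShiftResolution.
Variables (M : lmodType R) (P : proj_resolution M).

Fact shift_res_augP x : res_aug P (res_d P 0 x) = 0.
Proof. by apply/res_exact0; exists x. Qed.

Definition shift_res : proj_resolution (ker (res_aug P)).
Proof.
apply: (@ProjResolution R (ker (res_aug P)) (fun n => P n.+1) (fun n => res_d P n.+1)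
  (ker_corestr shift_res_augP)).
- by move=> n; apply: res_proj.
- move=> x; have [y yx] := (res_exact0 (ker_val _ x)).1 (ker_valK x).
  by exists y; apply: ker_val_inj.
- move=> x; split=> [/(congr1 (ker_val _))|].
    by rewrite ker_corestrK linear0 => /res_exactS.
  by move=> h; apply: ker_val_inj; rewrite ker_corestrK linear0; apply/res_exactS.
- by move=> n x; apply: res_exactS.
Defined.
End ShiftResolution.

(** Exactness in degree [n.+1] of the complex of invariants of Hom(P, E). *)
Definition factor_condition (M : lmodType R) (P : proj_resolution M) n :=
  forall f, invar (H (P n.+1)) f -> (forall y, f (res_d P n.+1 y) = 0) ->
  exists2 g, invar (H (P n)) g & forall x, g (res_d P n x) = f x.

(** Acyclicity passes from the regular module to the projectives; hence replacing [M] by the kernel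
    of the augmentation lowers the degree, while the resolution loses its first term. In the lowest
    degree the invariants on that kernel are the invariants on [P 1] killed by the next
    differential. *)
Lemma hoch0_resolution (M : lmodType R) (P : proj_resolution M) n :
  (forall m, hoch0 m (H R^o)) -> hoch0 n (H M) <-> factor_condition P n.
Proof.
move=> zR; have zP (Q : lmodType R) m : projective Q -> hoch0 m (H Q).
  by move=> /hoch0_Hom_projective; apply.
elim: n M P => [|n IHn] M P.
  have ex := @hoch0_ker_invar _ _ _ _ kapC c _ _ _ (@res_aug_surj _ _ P).
  have ex' := @hoch0_ker0 _ _ _ _ kapC c _ _ _ (@res_aug_surj _ _ P).
  pose a := res_aug (shift_res P); have as_ := @res_aug_surj _ _ (shift_res P).
  have aE x : ker_val _ (a x) = res_d P 0 x by [].
  split=> [zM f fi fd|lift].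
    have [|h hK hE] := @Hom_bimod_factor _ _ _ _ c _ _ a f as_ fi.1.
      move=> x ax; have [|y <-] := (res_exactS (n := 0) x).1; last exact: fd.
      by rewrite -aE ax linear0.
    have hi : invar (H (ker (res_aug P))) h.
      apply: (@Hom_bimod_invar _ _ _ _ c _ _ a h as_ hK).
      by rewrite (_ : (fun x => _) = f) //; apply/funext.
    have [g gi gE] := ex zM h hi.
    by exists g => // x; rewrite -aE gE hE.
  apply: ex' => [|f fi]; first exact/zP/res_proj.
  have [h1 h2 h3 h4] := Hom_bimod_comp c a.
  have [|y|g gi gE] := lift (fun x => f (a x)).
  - split=> [|b]; first exact: h1 fi.1.
    by have := congr1 (fun F x => F (a x)) (fi.2 b); rewrite h3 ?h4 //; apply: fi.1.
  - rewrite (_ : a _ = 0) ?(klin0 (fi.1.1)) //.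
    by apply: ker_val_inj; rewrite aE linear0; apply/(res_exactS (n := 0)); exists y.
  - by exists g => // y; have [x <-] := as_ y; rewrite aE gE.
have step : hoch0 n.+1 (H M) <-> hoch0 n (H (ker (res_aug P))).
  split; first by apply: (hoch0_ker kapC (@res_aug_surj _ _ P)); apply/zP/res_proj.
  by move=> zK; apply: (hoch0_kerS kapC (@res_aug_surj _ _ P)) => //; apply/zP/res_proj.
exact: iff_trans step (IHn _ (shift_res P)).
Qed.

(** Dimension shifting along a resolution that is zero from [P d] on. Allowing [m0 > 0] matters for
    B and C, over which the regular L- or C-module is acyclic only in high degrees. *)
Lemma hoch0_bounded_resolution (M : lmodType R) (P : proj_resolution M) m0 d :
    (forall m, (m0 <= m)%N -> hoch0 m (H R^o)) ->
    (forall n, (d <= n)%N -> forall x : P n, x = 0) ->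
  forall m, (m0 + d <= m)%N -> hoch0 m (H M).
Proof.
move=> zR; elim: d M P => [|d IHd] M P P0 m lem.
  apply: hoch0_zero; first exact: Hom_bimod_axioms.
  move=> f [fl _]; apply/funext => x; have [y <-] := @res_aug_surj _ _ P x.
  by rewrite (P0 0%N (leqnn _) y) linear0 (klin0 fl).
case: m lem => [|m]; first by rewrite addnS.
rewrite addnS ltnS => lem.
apply: (hoch0_kerS kapC (@res_aug_surj _ _ P)).
  by apply: (IHd _ (shift_res P)) => // n len; apply: P0.
apply: hoch0_Hom_projective => //; first exact: res_proj.
by apply: zR; apply: leq_trans (leqW lem); apply: leq_addr.
Qed.

Section ConsResolution.
Variables (F M : lmodType R) (f : {linear F -> M}).
Hypotheses (Fp : projective F) (fs : forall y, exists x, f x = y).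
Variable P : proj_resolution (ker f).

Let obj n := if n is m.+1 then P m else F.
Let d n : {linear obj n.+1 -> obj n} :=
  match n with
  | 0%N => mklin (f := fun x : P 0%N => ker_val f (res_aug P x))
      (fun a x y => etrans (congr1 (ker_val f) (linearP (res_aug P) a x y)) (linearP (ker_val f) a _ _))
  | m.+1 => res_d P m
  end.

Definition cons_res : proj_resolution M.
Proof.
apply: (@ProjResolution R M obj d f).
- by case=> [|n] //; apply: res_proj.
- exact: fs.
- move=> x; split=> [/ker_val_onto[y <-]|[y <-]]; last exact: ker_valK.
  by have [z <-] := @res_aug_surj _ _ P y; exists z.
- case=> [|n] x; last exact: res_exactS.
  apply: iff_trans (res_exact0 x); split=> [h|h].
    by apply: ker_val_inj; rewrite linear0.
  by change (ker_val f (res_aug P x) = 0); rewrite h linear0.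
Defined.

End ConsResolution.

Section CanonicalResolution.
Definition cover (M : lmodType R) : {linear free_mod kap (restr kap M) -> M} :=
  projT1 (cid (free_cover kap M)).

Lemma coverE (M : lmodType R) (x : M) : cover M (free_gen kap (x : restr kap M)) = x.
Proof. exact: (projT2 (cid (free_cover kap M))). Qed.

Lemma cover_surj (M : lmodType R) y : exists x, cover M x = y.
Proof. by exists (free_gen kap (y : restr kap M)); apply: coverE. Qed.

Variable M : lmodType R.
Fixpoint syzygy n : lmodType R :=
  match n with 0%N => M | n.+1 => ker (cover (syzygy n)) end.

Lemma exists_resolution : inhabited (proj_resolution M).
Proof.
pose obj n : lmodType R := free_mod kap (restr kap (syzygy n)).
have dl n : linear (fun x : obj n.+1 => ker_val (cover (syzygy n)) (cover (syzygy n.+1) x) : obj n).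
  by move=> a x y; rewrite !linearP.
constructor; apply: (@ProjResolution R M obj (fun n => mklin (dl n)) (cover M)).
- by move=> n; apply: free_projective.
- exact: cover_surj.
- move=> x; split=> [/ker_val_onto[y <-]|[y <-]]; last exact: ker_valK.
  by have [z <-] := cover_surj y; exists z.
- move=> n x; rewrite mklinE; split=> [h|[y <-]].
    have /ker_val_onto[y <-] : cover (syzygy n.+1) x = 0.
      by apply: ker_val_inj; rewrite h linear0.
    by have [z <-] := cover_surj y; exists z.
  by rewrite mklinE ker_valK linear0.
Qed.
End CanonicalResolution.
End Resolutions.

(** * Tor and balanced forms *)

Section TensorForms.

Section Tens.
Variables (T : Type) (M N : zmodType) (ra : T -> M -> M) (la : T -> N -> N).
Local Notation cls := (tens_cls ra la).

Lemma tens_cls_sum s : cls s = \sum_(p <- s) cls [:: p].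
Proof.
elim: s => [|p s IHs]; first by rewrite big_nil.
by rewrite big_cons -IHs; symmetry; apply: tens_addE.
Qed.

Lemma tens_additive_ext (G : zmodType) (h h' : tens ra la -> G) :
    (forall u v, h (u + v) = h u + h v) -> (forall u v, h' (u + v) = h' u + h' v) ->
    (forall m n, h (cls [:: (m, n)]) = h' (cls [:: (m, n)])) ->
  h =1 h'.
Proof.
move=> hD h'D hh'; have h0 : h 0 = 0 by apply: (addrI (h 0)); rewrite -hD !addr0.
have h'0 : h' 0 = 0 by apply: (addrI (h' 0)); rewrite -h'D !addr0.
elim/tens_ind=> s; rewrite tens_cls_sum; elim: s => [|[m n] s IHs].
  by rewrite big_nil h0 h'0.
by rewrite big_cons hD h'D hh' IHs.
Qed.

Lemma tens_biadd (G : zmodType) (phi : M -> N -> G) :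
    (forall m m' n, phi (m + m') n = phi m n + phi m' n) ->
    (forall m n n', phi m (n + n') = phi m n + phi m n') ->
    (forall r m n, phi (ra r m) n = phi m (la r n)) ->
  exists h : tens ra la -> G, (forall u v, h (u + v) = h u + h v) /\
    forall m n, h (cls [:: (m, n)]) = phi m n.
Proof.
move=> Dl Dr Z; exists (tens_lift phi); split; last first.
  by move=> m n; rewrite tens_liftE // big_seq1.
elim/tens_ind=> s; elim/tens_ind=> t.
by rewrite [_ + _](tens_addE ra la s t) !tens_liftE // big_cat.
Qed.

Lemma tens_addl m m' n : cls [:: (m + m', n)] = cls [:: (m, n)] + cls [:: (m', n)].
Proof. by symmetry; rewrite [_ + _](tens_addE ra la); symmetry; apply/tens_clsP/tens_Dl. Qed.

Lemma tens_addr m n n' : cls [:: (m, n + n')] = cls [:: (m, n)] + cls [:: (m, n')].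
Proof. by symmetry; rewrite [_ + _](tens_addE ra la); symmetry; apply/tens_clsP/tens_Dr. Qed.
End Tens.

Variables (k : fieldType) (R : pzRingType) (kap : {rmorphism k -> R^c}).
Hypothesis kapC : forall c r, kap c * r = r * kap c.

Lemma tensmod_map_additive (X Y : lmodType R^c) (N : lmodType R) (f : {linear X -> Y})
    (u v : tensmod X N) :
  tensmod_map f (u + v) = tensmod_map f u + tensmod_map f v.
Proof.
elim/tens_ind: u => s; elim/tens_ind: v => t.
rewrite [_ + _](tens_addE _ _ s t) !tensmod_mapE map_cat.
by symmetry; apply: tens_addE.
Qed.

Section Scale.
Variables (X : lmodType R^c) (N : lmodType R).

Fact kscale_linear c : linear (fun x : X => kap c *: x).
Proof. by move=> a x y; rewrite scalerDr !scalerA kapC. Qed.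

Definition tmod : Type := tensmod X N.
HB.instance Definition _ := GRing.Zmodule.on tmod.

Definition tgen (x : X) (n : N) : tmod :=
  tens_cls (fun (r : R^c) (m : X) => r *: m) (fun (r : R) (n : N) => r *: n) [:: (x, n)].

Definition tmod_scale (c : k) (u : tmod) : tmod := tensmod_map (mklin (kscale_linear c)) u.

Lemma tmod_scale_gen c x n : tmod_scale c (tgen x n) = tgen (kap c *: x) n.
Proof. exact: tensmod_mapE. Qed.

Lemma tmod_additive_ext (G : zmodType) (h h' : tmod -> G) :
    (forall u v, h (u + v) = h u + h v) -> (forall u v, h' (u + v) = h' u + h' v) ->
    (forall x n, h (tgen x n) = h' (tgen x n)) ->
  h =1 h'.
Proof. exact: tens_additive_ext. Qed.

Fact tmod_scaleDr : right_distributive tmod_scale +%R.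
Proof. by move=> c u v; apply: tensmod_map_additive. Qed.

Fact tmod_scaleA a b x : tmod_scale a (tmod_scale b x) = tmod_scale (a * b) x.
Proof.
move: x; apply: tmod_additive_ext => [u v|u v|x n]; rewrite ?tmod_scaleDr //.
by rewrite !tmod_scale_gen scalerA rmorphM.
Qed.

Fact tmod_scale1 : left_id 1 tmod_scale.
Proof.
apply: tmod_additive_ext => [u v|u v|x n]; rewrite ?tmod_scaleDr //.
by rewrite tmod_scale_gen rmorph1 scale1r.
Qed.

Fact tmod_scaleDl x : {morph tmod_scale^~ x : a b / a + b}.
Proof.
move=> a b; move: x; apply: tmod_additive_ext => [u v|u v|x n].
- by rewrite tmod_scaleDr.
- by rewrite !tmod_scaleDr addrACA.
- by rewrite !tmod_scale_gen rmorphD scalerDl; apply: tens_addl.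
Qed.
HB.instance Definition _ := GRing.Zmodule_isLmodule.Build k tmod
  tmod_scaleA tmod_scale1 tmod_scaleDr tmod_scaleDl.

Lemma tmod_scaleE c x n : c *: tgen x n = tgen (kap c *: x) n.
Proof. exact: tmod_scale_gen. Qed.

Record balanced (V : lmodType k) (b : X -> N -> V) : Prop := Balanced {
  balDl : forall x x' n, b (x + x') n = b x n + b x' n;
  balDr : forall x n n', b x (n + n') = b x n + b x n';
  balZ : forall c x n, b (kap c *: x) n = c *: b x n;
  balR : forall (r : R^c) x n, b (r *: x) n = b x ((r : R) *: n)
}.

Lemma tmod_lift (V : lmodType k) (b : X -> N -> V) : balanced b ->
  exists h : tmod -> V, lin h /\ forall x n, h (tgen x n) = b x n.
Proof.
move=> [Dl Dr Z B]; have [h [hD hE]] := tens_biadd Dl Dr B.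
exists h; split=> // c u v; rewrite hD; congr (_ + _); move: u.
apply: tmod_additive_ext => [u u'|u u'|x n].
- by rewrite scalerDr hD.
- by rewrite hD scalerDr.
- by rewrite tmod_scaleE [LHS]hE Z -hE.
Qed.

Lemma lin_balanced (V : lmodType k) (h : tmod -> V) : lin h ->
  balanced (fun x n => h (tgen x n)).
Proof.
move=> hl; split=> [x x' n|x n n'|c x n|r x n].
- by rewrite -(linD hl); congr h; apply: tens_addl.
- by rewrite -(linD hl); congr h; apply: tens_addr.
- by rewrite -(linZ hl) tmod_scaleE.
- by congr h; apply/tens_clsP/tens_bal.
Qed.
End Scale.

Section Map.
Variables (X Y : lmodType R^c) (N : lmodType R) (f : {linear X -> Y}).
Definition tmap (u : tmod X N) : tmod Y N := tensmod_map f u.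

Lemma tmap_gen x n : tmap (tgen x n) = tgen (f x) n.
Proof. exact: tensmod_mapE. Qed.

Lemma tmap_lin : lin tmap.
Proof.
move=> c u v; rewrite /tmap tensmod_map_additive; congr (_ + _); move: u.
apply: tmod_additive_ext => [u u'|u u'|x n].
- by rewrite scalerDr; apply: tensmod_map_additive.
- by rewrite [tensmod_map _ _]tensmod_map_additive scalerDr.
- by rewrite tmod_scaleE -!/(tmap _) !tmap_gen tmod_scaleE linearZ.
Qed.
End Map.

Variables (M : lmodType R^c) (N : lmodType R) (P : proj_resolution M).

(** Exactness of P (x) N at [n.+1], read on Q-valued linear maps out of the tensor products. *)
Definition forms_factor (V : lmodType k) (Q : V -> Prop) n := forall b : P n.+1 -> N -> V,
  balanced b -> (forall x m, Q (b x m)) -> (forall y m, b (res_d P n.+1 y) m = 0) ->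
  exists g : P n -> N -> V, [/\ balanced g, forall x m, Q (g x m) &
    forall x m, g (res_d P n x) m = b x m].

(** A form killed by the next differential vanishes on boundaries, hence on cycles. So it is defined
    on the image of the differential, from where it extends k-linearly with values in [Q]. *)
Lemma tor_forms (V : lmodType k) (Q : V -> Prop) n : subspace Q ->
    (forall x : tensmod (P n.+1) N, tor_cycle x -> tor_boundary x) ->
  forms_factor Q n.
Proof.
move=> sQ ex b bb bQ bd; have [h [hl hE]] := tmod_lift bb.
have hd (y : tmod (P n.+2) N) : h (tmap (res_d P n.+1) y) = 0.
  have : (fun y => h (tmap (res_d P n.+1) y)) =1 (fun=> 0); last exact.
  apply: tmod_additive_ext => [u v|u v|x m].
  - by rewrite (linD (@tmap_lin _ _ _ _)) (linD hl).
  - by rewrite addr0.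
  - by rewrite tmap_gen hE bd.
have [|||||s [sl sQs sE]] := @linear_selection k (tmod (P n) N) V (fun=> True) (fun _ v => Q v)
  (fun u v => exists x, u = tmap (res_d P n) x /\ v = h x) (@subspaceT _ _).
- by split=> [|c u v u' v' Qv Qv']; [exact: sQ.1|exact: sQ.2].
- split; first by exists 0; rewrite (lin0 (@tmap_lin _ _ _ _)) (lin0 hl).
  move=> c _ _ _ _ [x [-> ->]] [y [-> ->]]; exists (c *: x + y).
  by rewrite tmap_lin hl.
- by move=> u _; exists 0; apply: sQ.1.
- move=> u v [x [_ ->]]; split=> //; move: x; elim/tens_ind=> l.
  rewrite tens_cls_sum; elim: l => [|[x m] l IHl]; first by rewrite big_nil (lin0 hl); apply: sQ.1.
  by rewrite big_cons (linD hl) [h (tens_cls _ _ _)]hE; apply: subspaceD.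
- move=> v [x [x0 ->]]; have [|y <-] := ex x; first exact: esym.
  exact: hd.
have sl' : lin s by move=> c x y; apply: sl.
exists (fun x m => s (tgen x m)); split=> [|x m|]; [exact: lin_balanced|exact: sQs|].
by move=> x m; rewrite -hE; apply: sE; exists (tgen x m); rewrite tmap_gen.
Qed.

(** A cycle that is not a boundary is separated from the boundaries by a functional taking the value
    1 on it; factored through the differential, the same functional takes the value 0. *)
Lemma forms_tor n : forms_factor (V := k^o) (fun=> True) n ->
  forall x : tensmod (P n.+1) N, tor_cycle x -> tor_boundary x.
Proof.
move=> ff x xc; apply: contrapT => nb.
have nb' (y : tmod (P n.+2) N) c : tmap (res_d P n.+1) y + c *: (x : tmod _ _) = 0 -> c = 0.
  move=> e; have [//|c0] := eqVneq c 0; case: nb.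
  exists ((- c^-1) *: y : tmod _ _); rewrite -/(tmap _ _) (linZ (@tmap_lin _ _ _ _)).
  move/eqP: e; rewrite addr_eq0 => /eqP ->.
  by rewrite scaleNr scalerN opprK scalerA mulVf // scale1r.
have [|||||s [sl _ sE]] := @linear_selection k (tmod (P n.+1) N) k^o (fun=> True) (fun _ _ => True)
  (fun u v => exists y, u = tmap (res_d P n.+1) y + v *: (x : tmod _ _)) (@subspaceT _ _).
- by [].
- split; first by exists 0; rewrite (lin0 (@tmap_lin _ _ _ _)) scale0r addr0.
  move=> c u v u' v' [y ->] [y' ->]; exists (c *: y + y').
  by rewrite tmap_lin scalerDr scalerDl -!addrA scalerA; congr (_ + _); rewrite addrCA.
- by move=> u _; exists 0.
- by [].
- by move=> v [y] /esym/nb'.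
have sl' : lin s by move=> c u v; apply: sl.
have [||y m|g [gb _ gE]] := ff (fun x m => s (tgen x m)) => //; first exact: lin_balanced.
  by apply: sE; exists (tgen y m); rewrite tmap_gen scale0r addr0.
have [h [hl hE]] := tmod_lift gb.
have : s x = h (tmap (res_d P n) x).
  move: (x : tmod _ _); apply: tmod_additive_ext => [u v|u v|z m].
  - exact: linD.
  - by rewrite (linD (@tmap_lin _ _ _ _)) (linD hl).
  - by rewrite tmap_gen hE gE.
rewrite (sE _ 1); last by exists 0; rewrite (lin0 (@tmap_lin _ _ _ _)) add0r scale1r.
have -> : tmap (res_d P n) x = 0 by [].
by rewrite (lin0 hl) => /eqP; rewrite oner_eq0.
Qed.
End TensorForms.

(** * Global dimension, Tor and Hochschild homology as cohomology *)

Section ScalarMorphisms.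
Variables (k : fieldType) (A : fdAlg k).

Definition scal_fun (c : k) : A := c *: (1 : A).
Fact scal_zmod : zmod_morphism scal_fun.
Proof. by move=> a b; apply: scalerBl. Qed.
Fact scal_monoid : monoid_morphism scal_fun.
Proof.
split; first exact: scale1r.
by move=> a b; rewrite /scal_fun -fdscaleAl mul1r scalerA.
Qed.
Definition scal : {rmorphism k -> A} := HB.pack scal_fun
  (GRing.isZmodMorphism.Build k A scal_fun scal_zmod)
  (GRing.isMonoidMorphism.Build k A scal_fun scal_monoid).

Lemma scalE c : scal c = scal_fun c.
Proof. by []. Qed.

Lemma scalM c (a : A) : scal c * a = c *: a.
Proof. by rewrite scalE /scal_fun -fdscaleAl mul1r. Qed.

Lemma Mscal c (a : A) : a * scal c = c *: a.
Proof. by rewrite scalE /scal_fun -fdscaleAr mulr1. Qed.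

Lemma scalC c (a : A) : scal c * a = a * scal c.
Proof. by rewrite scalM Mscal. Qed.

Fact scalop_monoid : monoid_morphism (scal_fun : k -> A^c).
Proof.
split; first exact: scale1r.
by move=> a b; rewrite [RHS](esym (scal_monoid.2 b a)) mulrC.
Qed.
Definition scalop : {rmorphism k -> A^c} := HB.pack (scal_fun : k -> A^c)
  (GRing.isZmodMorphism.Build k A^c scal_fun scal_zmod)
  (GRing.isMonoidMorphism.Build k A^c scal_fun scalop_monoid).

Lemma scalopC c (a : A^c) : scalop c * a = a * scalop c.
Proof. exact: esym (scalC c a). Qed.
End ScalarMorphisms.

Section LeftModuleCoefficients.
Variables (k : fieldType) (A : fdAlg k) (R : pzRingType) (kap : {rmorphism k -> R}).
Variables (g : A -> R) (E : lmodType k) (Y : bimod A E).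
Hypotheses (gl : forall c a b, g (c *: a + b) = kap c * g a + g b).
Hypotheses (gM : {morph g : a b / a * b}) (ax : bimod_axioms Y).

(* Hom_k(X, Y) for a left A-module Y and an R-module X made into an A-module
   along g, which need not be unital                                           *)
Definition left_coef : coef A kap.
Proof.
apply: (@Coef k A R kap E (carrier Y) (lact Y) (fun _ v => v) (fun=> 1) g) => //.
- exact: carrier_sub.
- exact: lact_in.
- exact: lact_lin.
- by move=> f _ fP; apply: lact_linl.
- by move=> f fl _ c a b; rewrite -[RHS](fl c (g a : R^o) (g b : R^o)) gl.
- exact: lactM.
- by move=> a b; rewrite mulr1.
- by move=> a b; rewrite mul1r mulr1.
Defined.
End LeftModuleCoefficients.

(** * Global dimension through Ext *)

Section GlobalDimension.
Variables (k : fieldType).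

(** [Hom_lmod] below takes its right action from the source module, so a left module enters with the
    zero right action, which the non-unital axioms permit. *)
Definition lmod_bimod (A : fdAlg k) (Y : lmodType A) : bimod A (restr (scal A) Y) :=
  Bimod (fun _ : restr (scal A) Y => True) (fun a y => a *: (y : Y)) (fun _ _ => 0).

Lemma lmod_bimod_axioms (A : fdAlg k) (Y : lmodType A) : bimod_axioms (lmod_bimod Y).
Proof.
split=> //=.
- by move=> a c x y _ _; rewrite scalerDr !restrE !scalerA scalC.
- by move=> a c x y _ _; rewrite scaler0 addr0.
- by move=> x _ c a b; rewrite scalerDl -scalM -scalerA.
- by move=> x _ c a b; rewrite scaler0 addr0.
- by move=> a b x _; rewrite scalerA.
- by move=> a b x _; rewrite scaler0.
Qed.

Section One.
Variable A : fdAlg k.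

Fact id_lin c (a b : A) : id (c *: a + b) = scal A c * id a + id b.
Proof. by rewrite scalM. Qed.
Fact id_mul : {morph (id : A -> A) : a b / a * b}.
Proof. by []. Qed.

Definition hom_coef (E : lmodType k) (Y : bimod A E) ax : coef A (scal A) :=
  left_coef id_lin id_mul ax (Y := Y).

(** Hom_k(A, Y) is coinduced on the right; the retraction evaluates at 1. *)
Lemma hoch0_hom_regular (E : lmodType k) (Y : bimod A E) ax n :
  hoch0 n (Hom_bimod (hom_coef ax (Y := Y)) A^o).
Proof.
apply: hoch0_rcoinduced; first exact/Hom_bimod_axioms/scalC.
exists (fun psi x => psi x 1); split=> /=.
- move=> f [fl fP]; split=> [c x y|x]; last exact: (fP x).2.
  by rewrite restrE [scal A c *: _]scalM fl.
- by [].
- by move=> f _; apply/funext => x; rewrite [x *: _]mulr1.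
- by [].
- by move=> a f _; apply/funext => x; rewrite !scale1r.
Qed.

(** The cohomology of this bimodule is Ext_A(X, Y). *)
Definition Hom_lmod (X Y : lmodType A) := Hom_bimod (hom_coef (lmod_bimod_axioms Y)) X.

Lemma Hom_lmod_axioms X Y : bimod_axioms (Hom_lmod X Y).
Proof. exact/Hom_bimod_axioms/scalC. Qed.

Lemma invar_Hom_lmodP (X Y : lmodType A) (f : X -> Y) :
  invar (Hom_lmod X Y) f <-> linear f.
Proof.
split=> [[[fl _] fi] a x y|fl].
  have := congr1 (@^~ x) (fi a); rewrite /= scale1r => ->.
  by have := fl 1 (a *: x) y; rewrite !scale1r.
have f0 : f 0 = 0.
  by apply: (addrI (f 0)); have := fl 1 0 0; rewrite !scale1r !addr0 => <-.
split; first by split=> // c x y; rewrite !restrE; apply: fl.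
move=> a; apply/funext => x /=.
by rewrite scale1r -[a *: x in RHS]addr0 fl f0 addr0.
Qed.

(** As Ext^1 vanishes, the identity on the kernel of the free cover extends to a retraction of the
    cover onto its kernel, so the cover splits. *)
Lemma hoch0_projective (X : lmodType A) :
  (forall Y, hoch0 0 (Hom_lmod X Y)) -> projective X.
Proof.
move=> zX; pose f := cover (scal A) X.
have [|r /invar_Hom_lmodP rl rK] :=
  hoch0_ker_invar (@scalC _ A) (cover_surj (scal A) (M := X)) (zX (ker f)) (f := id).
  exact/invar_Hom_lmodP.
pose r' := mklin rl; have r'K y : r' (ker_val f y) = y := rK y.
have /choice[s sK] := cover_surj (scal A) (M := X).
pose t x := s x - ker_val f (r' (s x)).
(* The splitting does not depend on the chosen preimage, because [r'] is the identity on the kernel;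
   its linearity follows. *)
have tE x y : f y = x -> y - ker_val f (r' y) = t x.
  move=> fy; have [|z zE] := @ker_val_onto _ _ _ f (y - s x).
    by rewrite linearB fy sK subrr.
  have : ker_val f (r' y) - ker_val f (r' (s x)) = y - s x by rewrite -!linearB -zE r'K.
  rewrite /t; set a := ker_val f (r' y); set b := ker_val f _ => e.
  by rewrite -[y](subrK (s x)) -e addrAC [a - b - a]addrAC subrr add0r addrC.
have tl : linear t.
  move=> a x y; symmetry; rewrite -(@tE (a *: x + y) (a *: s x + s y)); last by rewrite linearP !sK.
  have -> : ker_val f (r' (a *: s x + s y)) = a *: ker_val f (r' (s x)) + ker_val f (r' (s y)).
    by rewrite !linearP.
  by rewrite /t scalerBr opprD addrACA.
have tK x : f (t x) = x by rewrite linearB ker_valK subr0 sK.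
move=> U V g h gs; have [h' h'E] := @free_projective _ _ (scal A) _ U V g (h \o f) gs.
by exists (h' \o mklin tl) => x; rewrite /= h'E /= tK.
Qed.

Lemma zero_resolution (R : pzRingType) (Z : lmodType R) : (forall z : Z, z = 0) ->
  exists P : proj_resolution Z, forall n (x : P n), x = 0.
Proof.
move=> Z0; pose i : {linear Z -> Z} := mklin (f := id) (fun _ _ _ => erefl).
have pZ : projective Z.
  move=> X Y g f gs; have l0 : linear (fun _ : Z => 0 : X) by move=> a x y; rewrite scaler0 addr0.
  by exists (mklin l0) => p; rewrite mklinE (Z0 p) !linear0.
have ex (x : Z) : i x = 0 <-> exists y, i y = x.
  by split=> _; [exists 0; rewrite [RHS]Z0; apply: Z0|apply: Z0].
have is_ (x : Z) : exists y, i y = x by exists x.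
by exists (@ProjResolution R Z (fun=> Z) (fun=> i) i (fun=> pZ) is_ ex (fun=> ex)).
Qed.

(** [hoch0 m] stands for Ext^(m+1): at [d = 0] all Ext^1 vanish and [M], being projective, resolves
    itself. Otherwise the syzygy has the same property with [d] lowered by one. *)
Lemma hoch0_finite_resolution d (M : lmodType A) :
    (forall Y m, (d <= m)%N -> hoch0 m (Hom_lmod M Y)) ->
  exists P : proj_resolution M, forall n, (d < n)%N -> forall x : P n, x = 0.
Proof.
elim: d M => [|d IHd] M zM.
  pose i : {linear M -> M} := mklin (f := id) (fun _ _ _ => erefl).
  have is_ : forall y, exists x, i x = y by move=> y; exists y.
  have [|P P0] := @zero_resolution A (ker i).
    by move=> z; apply: ker_val_inj; rewrite linear0; apply: (ker_valK z).
  exists (cons_res (hoch0_projective (fun Y => zM Y 0%N isT)) is_ P).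
  by case=> // n _; apply: P0.
have [|P P0] := IHd (ker (cover (scal A) M)).
  move=> Y m dm; apply: (hoch0_ker (@scalC _ A) (cover_surj (scal A) (M := M))); last exact: zM.
  apply: hoch0_Hom_projective; [exact: scalC|exact: free_projective|exact: hoch0_hom_regular].
exists (cons_res (@free_projective _ _ _ _) (cover_surj (scal A) (M := M)) P).
by case=> // n dn; apply: P0.
Qed.

Lemma finite_gldimP : finite_gldim A <->
  exists d, forall (X Y : lmodType A) m, (d <= m)%N -> hoch0 m (Hom_lmod X Y).
Proof.
split=> [[d res]|[d zA]]; last by exists d => M; apply: hoch0_finite_resolution => Y m; apply: zA.
(* The terms of the resolution vanish strictly after [d], that is from [d.+1] on. *)
exists d.+1 => X Y m dm; have [P P0] := res X.
by apply: (hoch0_bounded_resolution (@scalC _ A) (P := P) (m0 := 0) (d := d.+1)) => // n _; apply: hoch0_hom_regular.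
Qed.
End One.
End GlobalDimension.

(** * Vanishing of Tor as acyclicity of bimodules of forms *)

Section TorVanishing.
Variables (k : fieldType) (A : fdAlg k) (W : lmodType A^c) (V : lmodType A).
Variables (E : lmodType k) (Q : E -> Prop).
Hypothesis sQ : subspace Q.

(* Hom_k(W, Hom_k(V, Q)): its cohomology is dual to Tor^A(W, V).              *)
Definition form_coef : coef A (scalop A).
Proof.
apply: (@Coef k A A^c (scalop A) (V -> E)
  (fun f => @lin k (restr (scal A) V) E f /\ forall v, Q (f v))
  (fun _ f => f) (fun a f v => f (a *: v)) (fun a => (a : A^c)) (fun=> 1)) => //=.
- split; first by split=> [|v]; [exact: (@lin_fct0 k (restr (scal A) V))|exact: sQ.1].
  move=> c f g [fl fQ] [gl gQ]; split=> [|v]; last exact: sQ.2.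
  exact: (@lin_fctL k (restr (scal A) V)).
- move=> a f [fl fQ]; split=> // c x y; rewrite -[RHS](fl c (a *: (x : V)) (a *: (y : V))).
  by rewrite !restrE scalerDr !scalerA scalC.
- move=> f fl _ c a b; rewrite -fl; congr f.
  by rewrite restrE; congr (_ + _); symmetry; apply: (@Mscal _ A).
- move=> f _ fQ c a b; apply/funext => v.
  change (f 1 ((c *: a + b) *: v) = c *: f 1 (a *: v) + f 1 (b *: v)).
  by rewrite -[RHS](fQ 1).1 scalerDl restrE scalerA scalM.
- by move=> a b f _; apply/funext => v; rewrite scalerA.
- by move=> a b; rewrite mulr1.
- by move=> a b; rewrite mul1r mulr1.
Defined.

Definition Form := Hom_bimod form_coef W.

Lemma Form_axioms : bimod_axioms Form.
Proof. exact/Hom_bimod_axioms/scalopC. Qed.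

Lemma hoch0_form_regular n : hoch0 n (Hom_bimod form_coef A^c^o).
Proof.
apply: hoch0_lcoinduced; first exact/Hom_bimod_axioms/scalopC.
exists (fun psi u => psi u 1); split=> /=.
- move=> f [fl fP]; split=> [c x y|x]; last exact: (fP x).2.
  rewrite -[f (x : A) 1 in RHS]/((f (x : A)) 1).
  change (f (scalop A c * (x : A^c) + y) 1 = (c *: f x + f y) 1).
  rewrite -fl; congr (f _ 1); congr (_ + _).
  exact: (@Mscal _ A).
- by [].
- by move=> f _; apply/funext => u; rewrite [u *: _]mulr1.
- by [].
- by move=> a f _; apply/funext => u; rewrite !scale1r.
Qed.

Lemma invar_form (X : lmodType A^c) (f : X -> V -> E) : invar (Hom_bimod form_coef X) f <->
  balanced (scalop A) f /\ forall x v, Q (f x v).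
Proof.
split=> [[[fl fP] fi]|[[Dl Dr Z B] fQ]].
  split=> [|x v]; last exact: (fP x).2.
  split=> [x x' n|x n n'|c x n|r x n].
  - by rewrite (klinD _ _ fl).
  - by rewrite (linD (fP x).1).
  - by have := congr1 (@^~ n) (linZ fl c x).
  - have := congr1 (fun h => h x n) (fi (r : A)); rewrite /= scale1r //.
split.
  split=> [c x y|x].
    by apply/funext => v; rewrite restrE Dl Z.
  by split=> // c u v; rewrite restrE Dr -B Z.
by move=> a; apply/funext => x; apply/funext => v; rewrite /= B scale1r.
Qed.

(** By [invar_form] the invariants are the balanced forms, so [factor_condition] is
    [forms_factor]. *)
Lemma tor_hoch0 : (forall n, Tor_eq0 W V n.+1) -> forall n, hoch0 n Form.
Proof.
move=> tor n; have [P] := exists_resolution (scalop A) W.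
apply/(hoch0_resolution (@scalopC _ A) P n); first exact: hoch0_form_regular.
move=> f /invar_form[fb fQ] fd.
have [|g [gb gQ gE]] := tor_forms (@scalopC _ A) sQ (@tor n P) fb fQ.
  by move=> y v; rewrite fd.
exists g; first exact/invar_form.
by move=> x; apply/funext => v; apply: gE.
Qed.
End TorVanishing.

(** * Hochschild homology as cohomology of the dual bimodule *)

Section HochschildHomology.
Variables (k : fieldType) (A : fdAlg k).

Definition env_kap_fun (c : k) : (env A)^c := env_cls [:: (c *: (1 : A), (1 : A) : A^c)].

Lemma env_mulc s t : (env_cls s : (env A)^c) * env_cls t = env_cls (env_mul_seq t s).
Proof. exact: (env_mul_def t s). Qed.

Lemma env_gen_addl (a a' : A) (b : A^c) :
  env_cls [:: (a + a', b)] = env_cls [:: (a, b)] + env_cls [:: (a', b)].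
Proof. exact: tens_addl. Qed.

Lemma env_gen_addr (a : A) (b b' : A^c) :
  env_cls [:: (a, b + b')] = env_cls [:: (a, b)] + env_cls [:: (a, b')].
Proof. exact: tens_addr. Qed.

Lemma env_gen_bal c (a : A) (b : A^c) :
  env_cls [:: (c *: a, b)] = env_cls [:: (a, (c *: (b : A) : A^c))].
Proof. exact/tens_clsP/tens_bal. Qed.

Fact env_kap_zmod : zmod_morphism env_kap_fun.
Proof.
move=> a b; apply/eqP; rewrite eq_sym subr_eq; apply/eqP.
by rewrite /env_kap_fun -[RHS]env_gen_addl -scalerDl subrK.
Qed.
Fact env_kap_monoid : monoid_morphism env_kap_fun.
Proof.
split; first by rewrite /env_kap_fun scale1r.
move=> a b; rewrite /env_kap_fun env_mulc /env_mul_seq /= mulr1.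
by rewrite -fdscaleAl mul1r scalerA mulrC.
Qed.
Definition env_kap : {rmorphism k -> (env A)^c} := HB.pack env_kap_fun
  (GRing.isZmodMorphism.Build k (env A)^c env_kap_fun env_kap_zmod)
  (GRing.isMonoidMorphism.Build k (env A)^c env_kap_fun env_kap_monoid).

Lemma env_kapC c (r : (env A)^c) : env_kap c * r = r * env_kap c.
Proof.
elim/env_ind: r => s; rewrite [env_kap c](erefl (env_kap_fun c)) !env_mulc; congr env_cls.
rewrite /env_mul_seq allpairs1r /= cats0; apply: eq_map => -[a b] /=.
by rewrite -fdscaleAl -fdscaleAr mul1r !mulr1 mul1r.
Qed.

Lemma env_kap_gen c (a : A) (b : A^c) :
  env_kap c * env_cls [:: (a, b)] = env_cls [:: (c *: a, b)].
Proof. by rewrite [LHS]env_mulc /env_mul_seq /= mulr1 -fdscaleAr mulr1. Qed.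

Definition env_r (a : A) : (env A)^c := env_cls [:: (a, (1 : A) : A^c)].
Definition env_l (a : A) : (env A)^c := env_cls [:: (1, a : A^c)].

Lemma env_gen_mul (a b : A) : env_l b * env_r a = env_cls [:: (a, b : A^c)].
Proof. by rewrite env_mulc /env_mul_seq /= mulr1 mul1r. Qed.

Lemma env_genC (a b : A) : env_r a * env_l b = env_l b * env_r a.
Proof. by rewrite !env_mulc /env_mul_seq /= !mulr1 !mul1r. Qed.

Lemma env_r_lin c a b : env_r (c *: a + b) = env_kap c * env_r a + env_r b.
Proof.
rewrite /env_r [LHS]env_gen_addl; congr (_ + _).
by rewrite [RHS]env_mulc /env_mul_seq /= mulr1 -fdscaleAr mulr1.
Qed.

Lemma env_l_lin c a b : env_l (c *: a + b) = env_kap c * env_l a + env_l b.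
Proof.
rewrite /env_l [LHS]env_gen_addr; congr (_ + _).
by rewrite [RHS]env_mulc /env_mul_seq /= mulr1 mul1r [RHS]env_gen_bal.
Qed.

Lemma env_rM a b : env_r (a * b) = env_r b * env_r a.
Proof. by rewrite env_mulc /env_mul_seq /= mulr1. Qed.

Lemma env_lM a b : env_l (a * b) = env_l a * env_l b.
Proof. by rewrite env_mulc /env_mul_seq /= mulr1. Qed.

(* An A-bimodule is a right module over the enveloping algebra, hence a module
   over its converse.                                                         *)
Definition dual_coef : coef A env_kap.
Proof.
apply: (@Coef k A (env A)^c env_kap k^o (fun=> True) (fun _ f => f) (fun _ f => f)
  env_r env_l) => //.
- by move=> f fl _ c a b; rewrite env_r_lin -[RHS]fl.
- by move=> f fl _ c a b; rewrite env_l_lin -[RHS]fl.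
- exact: env_rM.
- exact: env_lM.
- exact: env_genC.
Defined.

(** The dual of the enveloping algebra is Hom_k(A, DA) by currying, hence coinduced. The retraction
    [m] sends [psi] to the functional whose value at a (x) b is that of [psi b] at a (x) 1. *)
Lemma hoch0_dual_regular n : hoch0 n (Hom_bimod dual_coef (env A)^c^o).
Proof.
have ax := Hom_bimod_axioms env_kapC dual_coef (env A)^c^o.
apply: hoch0_rcoinduced => //.
pose good psi := carrier (shift (Hom_bimod dual_coef (env A)^c^o)) psi.
pose mult (psi : A -> (env A)^c -> k^o) (h : (env A)^c -> k^o) :=
  (forall u v, h (u + v) = h u + h v) /\
  forall (a : A) (b : A^c), h (env_cls [:: (a, b)]) = psi (b : A) (env_r a).
have multE psi : exists h, good psi -> mult psi h.
  have [[pl pP]|np] := pselect (good psi); last by exists 0 => /np.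
  have [|||h [hD hE]] := @tens_biadd _ _ _ (@env_ra _ A) (@env_la _ A) k^o
    (fun (a : A) (b : A^c) => psi (b : A) (env_r a)).
  - move=> a a' b; rewrite -(klinD _ _ (pP _).1); congr (psi _ _); exact: env_gen_addl.
  - by move=> a b b'; rewrite (linD pl).
  - move=> c a b; rewrite (linZ pl) /env_ra.
    rewrite -[RHS](linZ (pP _).1); congr (psi _ _).
    exact: esym (env_kap_gen _ _ _).
  by exists h.
have {multE} [m mP] := choice multE.
have uniq psi h : good psi -> mult psi h -> m psi = h.
  move=> gp [hD hE]; have [mD mE] := mP _ gp; apply/funext.
  by apply: (@tens_additive_ext _ _ _ (@env_ra _ A) (@env_la _ A)) => // a b; rewrite [LHS]mE [RHS]hE.
have shiftE (x : (env A)^c) (u v : (env A)^c) : x * (u + v) = x * u + x * v by rewrite mulrDr.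
exists m; split=> //=.
- move=> psi gp; have [mD mE] := mP _ gp; split=> // c u v.
  rewrite restrE mD; congr (_ + _); move: u.
  apply: (@tens_additive_ext _ _ _ (@env_ra _ A) (@env_la _ A)) => [u v'|u v'|a b].
  + by rewrite scalerDr mD.
  + by rewrite mD scalerDr.
  + rewrite [X in m psi X](env_kap_gen c a b).
    rewrite mE [m psi _]mE -[RHS](linZ (gp.2 _).1); congr (psi _ _).
    exact: esym (env_kap_gen _ _ _).
- move=> c f g gf gg; apply: uniq.
    exact: (carrier_sub (shift_axioms ax)).2.
  have [fD fE] := mP _ gf; have [gD gE] := mP _ gg; split.
    move=> u v; change (c *: m f (u + v) + m g (u + v) = c *: m f u + m g u + (c *: m f v + m g v)).
    by rewrite fD gD scalerDr addrACA.
  move=> a b; change (c *: m f (env_cls [:: (a, b)]) + m g (env_cls [:: (a, b)]) =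
    c *: f (b : A) (env_r a) + g (b : A) (env_r a)).
  by rewrite fE gE.
- move=> f gf; apply: uniq; first exact: (shift_ractr ax gf).
  by split=> [u v|a b]; [rewrite (klinD _ _ gf.1)|rewrite [_ *: _]env_gen_mul].
- move=> a f gf; apply: uniq; first exact: (@shift_mull _ _ _ (Hom_bimod dual_coef (env A)^c^o) a f gf).
  have [fD fE] := mP _ gf.
  split=> [u v|x y]; first by rewrite scalerDr fD.
  by rewrite [_ *: _]env_mulc /env_mul_seq /= mulr1 fE.
- move=> a f gf; apply: uniq; first exact: (@shift_lact _ _ _ _ ax a f gf).
  have [fD fE] := mP _ gf.
  split=> [u v|x y]; first by rewrite scalerDr fD.
  rewrite [_ *: _]env_mulc /env_mul_seq /= mulr1 fE; congr (f _ _).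
  by rewrite [RHS]env_mulc /env_mul_seq /= mulr1.
Qed.

Lemma env_l_lenvmod (a : A) (x : lenvmod A) : (env_l a : env A) *: x = (x : A) * a.
Proof. by rewrite [LHS]lenvmod_scaleE big_seq1 mul1r. Qed.

Lemma env_r_lenvmod (a : A) (x : lenvmod A) : (env_r a : env A) *: x = a * (x : A).
Proof. by rewrite [LHS]lenvmod_scaleE big_seq1 mulr1. Qed.

(** Invariants are traces: f(xa) = f(ax). They correspond to the functionals on X (x) A over the
    enveloping algebra by b(x, n) = f(nx), with inverse the evaluation at n = 1. *)
Lemma trace_balanced (X : lmodType (env A)^c) (f : X -> k^o) :
  invar (Hom_bimod dual_coef X) f ->
  balanced env_kap (fun x (n : lenvmod A) => f (env_l n *: x)).
Proof.
move=> [[fl _] fi]; have tr a x : f (env_r a *: x) = f (env_l a *: x).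
  by have := congr1 (@^~ x) (fi a).
split=> [x x' n|x n n'|c x n|r x n].
- by rewrite scalerDr (klinD _ _ fl).
- rewrite -(klinD _ _ fl) -scalerDl; congr (f (_ *: _)).
  by have := env_l_lin 1 n n'; rewrite scale1r rmorph1 mul1r.
- by rewrite -(linZ fl) restrE !scalerA env_kapC.
- move: r; apply: (@tens_additive_ext _ _ _ (@env_ra _ A) (@env_la _ A)) => [u v|u v|a b].
  + by rewrite scalerDl scalerDr (klinD _ _ fl).
  + rewrite -(klinD _ _ fl) -scalerDl; congr (f (_ *: _)).
    have -> : ((u + v : tens (@env_ra _ A) (@env_la _ A)) : env A) *: n =
      (u : env A) *: n + (v : env A) *: n by exact: scalerDl.
    by have := env_l_lin 1 ((u : env A) *: n) ((v : env A) *: n); rewrite scale1r rmorph1 mul1r.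
  + rewrite [X in X *: x](_ : _ = env_l b * env_r a); last by rewrite env_gen_mul.
    rewrite [X in X *: n](_ : _ = env_cls [:: (a, b)]) // [_ *: n]lenvmod_scaleE big_seq1 /=.
    rewrite scalerA mulrA -env_lM -env_genC -scalerA tr scalerA -env_lM.
    by rewrite -mulrA.
Qed.

Lemma balanced_trace (X : lmodType (env A)^c) (b : X -> lenvmod A -> k^o) :
    balanced env_kap b ->
  invar (Hom_bimod dual_coef X) (fun x => b x (1 : A)) /\
  forall x n, b x n = b (env_l n *: x) (1 : A).
Proof.
move=> [Dl Dr Z B]; split; last by move=> x n; rewrite B env_l_lenvmod mul1r.
split; first by split=> // c x y; rewrite restrE Dl Z.
move=> a; apply/funext => x; rewrite /= !B env_l_lenvmod env_r_lenvmod.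
by rewrite mulr1 mul1r.
Qed.

Lemma HH_hoch0_dual n :
  HH_eq0 A n.+1 <-> hoch0 n (Hom_bimod dual_coef (renvmod A)).
Proof.
have res (P : proj_resolution (renvmod A)) := hoch0_resolution env_kapC P n hoch0_dual_regular.
split=> [hh|].
  have [P] := exists_resolution env_kap (renvmod A).
  apply/(res P) => f fi fd.
  have [||g [gb _ gE]] := tor_forms env_kapC (@subspaceT _ _) (@hh P) (trace_balanced fi).
  - by [].
  - move=> y m; rewrite -linearZ; exact: fd.
  have [gi gtr] := balanced_trace gb.
  exists (fun x => g x (1 : A)); first exact: gi.
  by move=> x; rewrite gE [env_l _](_ : _ = 1) ?scale1r.
move=> hD P; apply: (forms_tor env_kapC) => b bb _ bd.
have [bi btr] := balanced_trace bb.
have [|g gi gE] := (res P).1 hD (fun x => b x (1 : A)) bi.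
  by move=> y; apply: bd.
exists (fun x m => g (env_l m *: x)); split=> //; first exact: trace_balanced.
by move=> x m; rewrite -linearZ gE -btr.
Qed.

Definition dual : bimod A (A -> k^o) := Bimod (fun f : A -> k^o => lin f)
  (fun a f x => f (x * a)) (fun a f x => f (a * x)).

Lemma HH_hoch0 n : HH_eq0 A n.+1 <-> hoch0 n dual.
Proof.
apply: iff_trans (HH_hoch0_dual n) _.
have cE : forall f, carrier (Hom_bimod dual_coef (renvmod A)) f <-> carrier dual f.
  have kE c (x : renvmod A) : env_kap c *: x = c *: (x : A).
    by rewrite [LHS]renvmod_scaleE big_seq1 mul1r -fdscaleAr mulr1.
  move=> f; split=> [[fl _] c x y|fl].
    by have := fl c x y; rewrite restrE kE.
  by split=> // c x y; rewrite restrE kE; apply: fl.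
have lE : lact (Hom_bimod dual_coef (renvmod A)) = lact dual.
  apply/funext => a; apply/funext => f; apply/funext => x /=; congr f.
  by rewrite [LHS]renvmod_scaleE big_seq1 mul1r.
have rE : ract (Hom_bimod dual_coef (renvmod A)) = ract dual.
  apply/funext => a; apply/funext => f; apply/funext => x /=; congr f.
  by rewrite [LHS]renvmod_scaleE big_seq1 mulr1.
by split; apply: hoch0_ext => // f; apply: iff_sym.
Qed.

Lemma dual_axioms : bimod_axioms dual.
Proof.
split=> //=.
- by split=> [|c f g fl gl]; [apply: lin_fct0|apply: lin_fctL].
- by move=> a f fl c x y; rewrite lin_mull fl.
- by move=> a f fl c x y; rewrite lin_mulr fl.
- by move=> f fl c a b; apply/funext => x; rewrite lin_mulr fl.
- by move=> f fl c a b; apply/funext => x; rewrite lin_mull fl.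
- by move=> a b f _; apply/funext => x; rewrite mulrA.
- by move=> a b f _; apply/funext => x; rewrite mulrA.
- by move=> a b f _; apply/funext => x; rewrite mulrA.
Qed.
End HochschildHomology.

(** * Hochschild homology and the corners *)

Section Stratified.
Variables (k : fieldType) (L B C : fdAlg k) (e : L).
Variables (iB : B -> L) (pB : L -> B) (iC : C -> L) (pC : L -> C).
Local Notation f := (1 - e).

(* B and C are identified with the corners e L e and f L f.                   *)
Record corners : Prop := Corners {
  idem_e : e * e = e;
  iB_lin : lin iB;
  iB_mul : {morph iB : a b / a * b};
  pB_lin : lin pB;
  iBK : cancel iB pB;
  pBK : forall x, iB (pB x) = e * x * e;
  iC_lin : lin iC;
  iC_mul : {morph iC : a b / a * b};
  pC_lin : lin pC;
  iCK : cancel iC pC;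
  pCK : forall x, iC (pC x) = f * x * f;
  NM0 : forall x y, f * x * e * y * f = 0
}.

Section FormBimodules.
Variables (V : lmodType k) (Q : V -> Prop).

Definition is_form (b : L -> L -> V) :=
  [/\ lin b, forall x, lin (b x), forall x y, Q (b x y) &
    forall x y, b (x * e) y = b x y /\ b x (e * y) = b x y].

(* A bilinear form on Le x eL is encoded as a form on L x L that is unchanged
   by x |-> x e and y |-> e y.                                                *)
Definition form_bimod : bimod B (L -> L -> V) :=
  Bimod is_form (fun b beta x y => beta (x * iB b) y) (fun b beta x y => beta x (iB b * y)).
End FormBimodules.

(* Tor^B_n(Le, eL) = 0 for all n > 0.                                         *)
Definition tor_acyclic := forall (V : lmodType k) (Q : V -> Prop), subspace Q ->
  forall n, hoch0 n (form_bimod Q).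

(* fLe (x)_B eLf = 0.                                                         *)
Definition form_trivial := forall (V : lmodType k) (b : L -> L -> V),
  invar (form_bimod (fun=> True)) b -> forall x y, b (f * x) (y * f) = 0.

Record stratified : Prop := Stratified {
  strat_corners : corners;
  strat_tor : tor_acyclic;
  strat_trivial : form_trivial
}.

Section Corners.
Hypothesis CS : corners.
Let ee := idem_e CS.

Lemma fe0 : f * e = 0. Proof. by rewrite mulrBl mul1r ee subrr. Qed.
Lemma ff : f * f = f. Proof. by rewrite mulrBr mulr1 fe0 subr0. Qed.

Lemma e_iB b : e * iB b = iB b.
Proof. by rewrite -(iBK CS b) (pBK CS) !mulrA ee. Qed.
Lemma iB_e b : iB b * e = iB b.
Proof. by rewrite -(iBK CS b) (pBK CS) -!mulrA ee. Qed.
Lemma f_iC c : f * iC c = iC c.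
Proof. by rewrite -(iCK CS c) (pCK CS) !mulrA ff. Qed.
Lemma iB1 : iB 1 = e.
Proof.
have h : iB (pB e) = e by rewrite (pBK CS) !ee.
by rewrite -[LHS]e_iB -[X in X * _]h -(iB_mul CS) mulr1.
Qed.
Lemma iC1 : iC 1 = f.
Proof.
have h : iC (pC f) = f by rewrite (pCK CS) !ff.
by rewrite -[LHS]f_iC -[X in X * _]h -(iC_mul CS) mulr1.
Qed.
Lemma pB1 : pB 1 = 1.
Proof. by apply: (can_inj (iBK CS)); rewrite (pBK CS) mulr1 ee iB1. Qed.
Lemma pC1 : pC 1 = 1.
Proof. by apply: (can_inj (iCK CS)); rewrite (pCK CS) mulr1 ff iC1. Qed.

(** The defect fabf - (faf)(fbf) equals faebf, which is 0 by [NM0]. Together with [pCe0] this makes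
    [pC] the quotient map of L by LeL. *)
Lemma pCM : {morph pC : a b / a * b}.
Proof.
move=> a b; apply: (can_inj (iCK CS)); rewrite (iC_mul CS) !(pCK CS).
rewrite -[f * a * f * _]mulrA [f * (_ * f)]mulrA [f * (f * b)]mulrA ff !mulrA.
apply/eqP; rewrite -subr_eq0 -mulrBl -mulrBl [f * a * f]mulrBr mulr1 opprB addrC subrK.
by rewrite (NM0 CS).
Qed.

Lemma pCe0 x y : pC (x * e * y) = 0.
Proof.
apply: (can_inj (iCK CS)); rewrite (pCK CS) (lin0 (iC_lin CS)).
by rewrite !mulrA (NM0 CS).
Qed.

Section FormAxioms.
Variables (V : lmodType k) (Q : V -> Prop).
Hypothesis sQ : subspace Q.

Lemma is_form_subspace : subspace (is_form Q).
Proof.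
split.
  split=> [|x|x y|x y]; [exact: lin_fct0|exact: lin_fct0|exact: sQ.1|by []].
move=> c b b' [bl br bQ be] [bl' br' bQ' be']; split.
- exact: lin_fctL.
- by move=> x; apply: lin_fctL.
- by move=> x y; apply: sQ.2.
- move=> x y; have [h1 h2] := be x y; have [h3 h4] := be' x y.
  split; first by change (c *: b (x * e) y + b' (x * e) y = c *: b x y + b' x y); rewrite h1 h3.
  by change (c *: b x (e * y) + b' x (e * y) = c *: b x y + b' x y); rewrite h2 h4.
Qed.

Lemma form_bimod_axioms : bimod_axioms (form_bimod Q).
Proof.
split=> //=.
- exact: is_form_subspace.
- move=> b beta [bl br bQ be]; split=> // [c x y|x y].
    by rewrite lin_mull bl.
  by rewrite -mulrA e_iB (be _ _).2.
- move=> b beta [bl br bQ be]; split=> // [c x y|x c y y'|x y].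
  + by apply/funext => z; rewrite bl.
  + by rewrite lin_mulr br.
  + by rewrite mulrA iB_e (be _ _).1.
- by move=> beta [bl _ _ _] c a b; apply/funext => x; rewrite (iB_lin CS) lin_mulr bl.
- move=> beta [_ br _ _] c a b; apply/funext => x; apply/funext => y.
  by rewrite (iB_lin CS) lin_mull br.
- by move=> a b beta _; apply/funext => x; rewrite (iB_mul CS) mulrA.
- by move=> a b beta _; apply/funext => x; apply/funext => y; rewrite (iB_mul CS) -mulrA.
Qed.

End FormAxioms.
End Corners.

Hypothesis S : stratified.
Let CS := strat_corners S.
Let ee := idem_e CS.

Section Forms.
Variables (V : lmodType k) (Q : V -> Prop).
Hypothesis sQ : subspace Q.

(* Balanced forms on Le x eL are the forms (x, y) |-> theta (x y) with theta
   linear on L, because eLe (x) eL, fLe (x) eLe and fLe (x) eLf are eL, fLe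
   and 0.                                                                     *)
Definition form_ext (b : L -> L -> V) (z : L) := b e z + b (f * z) e.

(** Split x along 1 = e + f, and y as well in the term with fx. The balancing moves exe and eye
    across, and the remaining term b(fx, yf) vanishes by [strat_trivial]. *)
Lemma form_extE b : invar (form_bimod Q) b -> forall x y, form_ext b (x * e * y) = b x y.
Proof.
move=> [[bl br bQ be] bi] x y.
have bal c x' y' : b (x' * iB c) y' = b x' (iB c * y').
  by have := congr1 (fun h => h x' y') (bi c).
have be1 x' y' : b (x' * e) y' = b x' y' by have [] := be x' y'.
have be2 x' y' : b x' (e * y') = b x' y' by have [] := be x' y'.
have b0 : b (f * x) (y * f) = 0.
  by apply: (strat_trivial S) => //; split=> //; split.
rewrite /form_ext.
have -> : b e (x * e * y) = b (e * x) y.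
  rewrite -be2 !mulrA -[e * x * e](pBK CS) -bal (pBK CS) !mulrA ee.
  exact: be1.
have -> : b (f * (x * e * y)) e = b (f * x) (y * e).
  rewrite -be1 (_ : f * (x * e * y) * e = f * x * iB (pB y)); last by rewrite (pBK CS) !mulrA.
  by rewrite bal (pBK CS) -mulrA ee -mulrA be2.
have -> : b (f * x) (y * e) = b (f * x) y.
  have yE : y = y * e + y * f by rewrite -mulrDr addrC subrK mulr1.
  by rewrite [in RHS]yE (linD (br _)) b0 addr0.
rewrite -[b (e * x) y + _]/((b (e * x) + b (f * x)) y) -(linD bl) -mulrDl.
by rewrite addrC subrK mul1r.
Qed.

Lemma form_ext_lin b : is_form Q b -> lin (form_ext b).
Proof.
move=> [bl br _ _] c x y; rewrite /form_ext br lin_mulr bl scalerDr -!addrA; congr (_ + _).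
by rewrite addrCA.
Qed.

Lemma form_ext_in b z : is_form Q b -> Q (form_ext b z).
Proof. by move=> [_ _ bQ _]; apply: subspaceD. Qed.

Lemma form_of_lin (theta : L -> V) : lin theta -> (forall z, Q (theta z)) ->
  invar (form_bimod Q) (fun x y => theta (x * e * y)).
Proof.
move=> tl tQ; split.
  split=> //.
  - by move=> c x x'; apply/funext => y; rewrite !mulrDl -!fdscaleAl tl.
  - by move=> x c y y'; rewrite lin_mulr tl.
  - by move=> x y; rewrite -!mulrA [e * (e * y)]mulrA ee.
move=> b; apply/funext => x; apply/funext => y /=.
by rewrite -!mulrA [e * (_ * _)]mulrA (e_iB CS) [iB b * (e * y)]mulrA (iB_e CS).
Qed.

Section FormL.
Variables (cr : L -> V -> V) (rho : L -> L).
Hypotheses (cr_in : forall a v, Q v -> Q (cr a v)) (cr_lin : forall a, linear_on Q (cr a)).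
Hypothesis rho_lin : forall g : L -> V, lin g -> (forall u, Q (g u)) ->
  lin (fun a => cr a (g (rho a))).
Hypothesis crM : forall a b v, Q v -> cr (a * b) v = cr b (cr a v).
Hypothesis rhoM : {morph rho : a b / a * b}.

(** Two cases are covered: forms with values in an inflated C-bimodule, acting on the right through
    the values ([rho] constantly 1), and k-valued forms with (ba)(x, y) = b(ax, y) ([rho] the
    identity). *)
Definition form_bimodL : bimod L (L -> L -> V) :=
  Bimod (is_form Q) (fun a b x y => b x (y * a)) (fun a b x y => cr a (b (rho a * x) y)).

Lemma form_bimodL_axioms : bimod_axioms form_bimodL.
Proof.
split=> /=.
- exact: is_form_subspace.
- move=> a b [bl br bQ be]; split=> // [c x y|x c y y'|x y].
  + by apply/funext => z; rewrite bl.
  + by rewrite lin_mull br.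
  + by split; [rewrite (be _ _).1|rewrite -mulrA (be _ _).2].
- move=> a b [bl br bQ be]; split=> [c x y|x c y y'|x y|x y].
  + by apply/funext => z; rewrite lin_mulr bl; apply: cr_lin.
  + by rewrite br cr_lin.
  + exact: cr_in.
  + by split; [rewrite mulrA (be _ _).1|rewrite (be _ _).2].
- by [].
- move=> a c b b' [_ _ bQ _] [_ _ bQ' _]; apply/funext => x; apply/funext => y.
  exact: cr_lin.
- by move=> b [_ br _ _] c a a'; apply/funext => x; apply/funext => y; rewrite lin_mulr br.
- move=> b [bl br bQ be] c a a'; apply/funext => x; apply/funext => y.
  apply: (rho_lin (g := fun u => b (u * x) y)) => // d u u'.
  by rewrite lin_mull bl.
- by move=> a a' b _; apply/funext => x; apply/funext => y; rewrite mulrA.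
- by move=> a a' b [_ _ bQ _]; apply/funext => x; apply/funext => y; rewrite crM // rhoM mulrA.
- by [].
Qed.

Lemma form_bimodL_commuting : commuting form_bimodL (form_bimod Q).
Proof.
split=> //= a b beta _; apply/funext => x; apply/funext => y; by rewrite ?mulrA.
Qed.

(** The left action multiplies the variable of eL on the right, and eL is a direct summand of L: the
    forms are coinduced on the left. *)
Lemma form_bimodL_acyclic n : hoch0 n form_bimodL.
Proof.
apply: hoch0_lcoinduced; first exact: form_bimodL_axioms.
exists (fun psi x y => psi (e * y) x e); split=> /=.
- move=> psi [pl pF]; split.
  + by move=> c x y; apply/funext => z; have [bl _ _ _] := pF (e * z); rewrite bl.
  + by move=> x c y y'; rewrite lin_mulr pl.
  + by move=> x y; have [_ _ bQ _] := pF (e * y).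
  + move=> x y; have [_ _ _ be] := pF (e * y).
    by rewrite mulrA ee (be _ _).1.
- by [].
- by move=> b [_ _ _ be]; apply/funext => x; apply/funext => y; rewrite !(be _ _).2.
- by move=> a psi _; apply/funext => x; apply/funext => y; rewrite mulrA.
- by [].
Qed.

Lemma form_bimodL_exchange n :
  hoch0 n (fixed (form_bimod Q) form_bimodL) -> hoch0 n (fixed form_bimodL (form_bimod Q)).
Proof.
apply: hoch0_exchange; [exact: form_bimodL_axioms|exact: (form_bimod_axioms CS)|
  exact: form_bimodL_commuting|exact: form_bimodL_acyclic|move=> m; exact: (strat_tor S)].
Qed.

Lemma form_bimodL_exchange' n :
  hoch0 n (fixed form_bimodL (form_bimod Q)) -> hoch0 n (fixed (form_bimod Q) form_bimodL).
Proof.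
apply: hoch0_exchange; [exact: (form_bimod_axioms CS)|exact: form_bimodL_axioms|
  exact/commuting_sym/form_bimodL_commuting|move=> m; exact: (strat_tor S)|exact: form_bimodL_acyclic].
Qed.
End FormL.
End Forms.

(** * Inflation along L -> C preserves cohomology *)

Definition inflation V (Y : bimod C V) : bimod L V :=
  Bimod (carrier Y) (fun a => lact Y (pC a)) (fun a => ract Y (pC a)).

Lemma inflation_axioms V (Y : bimod C V) : bimod_axioms Y -> bimod_axioms (inflation Y).
Proof.
move=> ax; split=> /=.
- exact: carrier_sub.
- by move=> a; apply: lact_in.
- by move=> a; apply: ract_in.
- by move=> a; apply: lact_lin.
- by move=> a; apply: ract_lin.
- by move=> x Yx; apply: lin_comp (lact_linl ax Yx) (pC_lin CS).
- by move=> x Yx; apply: lin_comp (ract_linl ax Yx) (pC_lin CS).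
- by move=> a b x Yx; rewrite (pCM CS) (lactM ax).
- by move=> a b x Yx; rewrite (pCM CS) (ractM ax).
- by move=> a b x Yx; rewrite (lact_ract ax).
Qed.

Lemma lact0 (A : fdAlg k) (V : lmodType k) (Y : bimod A V) x : bimod_axioms Y -> carrier Y x -> lact Y 0 x = 0.
Proof. by move=> ax Yx; rewrite (lin0 (lact_linl ax Yx)). Qed.

Lemma ract0 (A : fdAlg k) (V : lmodType k) (Y : bimod A V) x : bimod_axioms Y -> carrier Y x -> ract Y 0 x = 0.
Proof. by move=> ax Yx; rewrite (lin0 (ract_linl ax Yx)). Qed.

Lemma pC0e x : pC (x * e) = 0. Proof. by rewrite -[x * e]mulr1 (pCe0 CS). Qed.
Lemma pCe0r x : pC (e * x) = 0. Proof. by rewrite -[e]mul1r (pCe0 CS). Qed.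

Lemma lin_factor (V : lmodType k) (theta : L -> V) : lin theta ->
  (forall x y, theta (x * e * y) = 0) -> forall z, theta (iC (pC z)) = theta z.
Proof.
move=> tl t0 z; have te x : theta (x * e) = 0 by rewrite -[x * e]mulr1.
have et y : theta (e * y) = 0 by rewrite -[e]mul1r.
rewrite (pCK CS) mulrBr mulr1 (linB tl) te subr0.
by rewrite mulrBl mul1r (linB tl) et subr0.
Qed.

Section InflatedShift.
Variables (V : lmodType k) (Y : bimod C V).
Hypothesis ax : bimod_axioms Y.
Let axI := inflation_axioms ax.
Let rho (a : L) : L := 1.

Lemma inflation_rho_lin (g : L -> V) : lin g -> (forall u, carrier Y (g u)) ->
  lin (fun a => ract (inflation Y) a (g (rho a))).
Proof. by move=> _ gY; apply: (ract_linl axI (gY 1)). Qed.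

Let FY := form_bimodL (carrier Y) (ract (inflation Y)) rho.

Lemma inflated_form_axioms : bimod_axioms FY.
Proof.
apply: form_bimodL_axioms.
- exact: carrier_sub.
- exact: (ract_in axI).
- exact: (ract_lin axI).
- exact: inflation_rho_lin.
- exact: (ractM axI).
- by move=> a b; rewrite /rho mulr1.
Qed.

Lemma fixed_inflated_axioms : bimod_axioms (fixed FY (form_bimod (carrier Y))).
Proof.
apply: fixed_axioms; [exact: inflated_form_axioms|exact/(form_bimod_axioms CS)/carrier_sub|].
exact: form_bimodL_commuting.
Qed.

(** Invariance reads b(x, za) = b(x, z) pC(a). As pC(e) = 0, it kills b(x, e), and b(x, y) = b(x, e)
    pC(y). *)
Lemma inflated_form_invar0 b : invar FY b -> b = 0.
Proof.
move=> [[bl br bQ be] bi]; apply/funext => x; apply/funext => y.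
have h a z : b x (z * a) = ract Y (pC a) (b (1 * x) z).
  by have := congr1 (fun h => h x z) (bi a).
have be0 : b x e = 0.
  by rewrite -[X in b x X]ee h -[X in pC X]mulr1 pCe0r ract0.
by rewrite -(be x y).2 h mul1r be0 (lin_on0 (carrier_sub ax) (ract_lin ax _)).
Qed.

(** After the exchange the coefficients over B are the L-invariant forms, and these are zero. *)
Lemma hoch0_fixed_inflated n : hoch0 n (fixed FY (form_bimod (carrier Y))).
Proof.
apply: form_bimodL_exchange.
- exact: carrier_sub.
- exact: (ract_in axI).
- exact: (ract_lin axI).
- exact: inflation_rho_lin.
- exact: (ractM axI).
- by move=> a b; rewrite /rho mulr1.
apply: hoch0_zero.
  apply: fixed_axioms; [exact/(form_bimod_axioms CS)/carrier_sub|exact: inflated_form_axioms|].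
  exact/commuting_sym/form_bimodL_commuting.
exact: inflated_form_invar0.
Qed.

Let p (theta : L -> V) x y := theta (x * e * y).

Lemma shift_form_hom : bimod_hom (shift (inflation Y)) (fixed FY (form_bimod (carrier Y))) p.
Proof.
split=> /=.
- by move=> th [tl tY]; apply: form_of_lin.
- by [].
- move=> a th [tl tY]; apply/funext => x; apply/funext => y; rewrite /p.
  by rewrite (pCe0 CS) lact0 // subr0 mulrA.
- by move=> a th [tl tY]; apply/funext => x; apply/funext => y; rewrite /p mul1r.
Qed.

Lemma shift_form_surj z : carrier (fixed FY (form_bimod (carrier Y))) z ->
  exists2 y, carrier (shift (inflation Y)) y & p y = z.
Proof.
move=> iz; exists (form_ext z).
  split; first exact: (form_ext_lin (Q := carrier Y) iz.1).
  by move=> t; apply: form_ext_in (carrier_sub ax) _ _ iz.1.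
by apply/funext => x; apply/funext => y; apply: form_extE iz _ _.
Qed.

(** The kernel consists of the maps vanishing on LeL, and by [lin_factor] these are the maps defined
    on C. *)
Lemma inflation_shift n :
  hoch0 n (inflation (shift Y)) <-> hoch0 n (kernel (shift (inflation Y)) p).
Proof.
have axs := inflation_axioms (shift_axioms ax).
have axk := kernel_axioms (shift_axioms axI) fixed_inflated_axioms shift_form_hom.
have kerE th : carrier (kernel (shift (inflation Y)) p) th -> forall z, th (iC (pC z)) = th z.
  move=> [[tl _] p0]; apply: lin_factor => // x y.
  exact: (congr1 (fun h => h x y) p0).
have jH : bimod_hom (inflation (shift Y)) (kernel (shift (inflation Y)) p) (fun psi t => psi (pC t)).
  split=> //=.
  - move=> psi [sl sY]; split; first by split=> // c a b; rewrite (pC_lin CS) sl.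
    by apply/funext => x; apply/funext => y; rewrite /p (pCe0 CS) (lin0 sl).
  - by move=> a psi _; apply/funext => t; rewrite (pCM CS).
have qH : bimod_hom (kernel (shift (inflation Y)) p) (inflation (shift Y)) (fun th c => th (iC c)).
  split=> //=.
  - by move=> th [[tl tY] _]; split=> // c a b; rewrite (iC_lin CS) tl.
  - move=> a th Kth; apply/funext => c; rewrite (iCK CS) (kerE _ Kth).
    by rewrite -(kerE _ Kth (iC c * a)) (pCM CS) (iCK CS).
split.
  apply: (hoch0_hom_retract axs axk qH jH) => th Kth.
  by apply/funext => z; apply: kerE.
apply: (hoch0_hom_retract axk axs jH qH) => psi _.
by apply/funext => c; rewrite (iCK CS).
Qed.

(** A derivation kills xey = (xe)(ey), because both factors act by zero on Y; so it comes from C. *)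
Lemma hoch0_inflation0 : hoch0 0 (inflation Y) <-> hoch0 0 Y.
Proof.
split=> zY d [dl dP dD].
  have [|v [Yv dv]] := zY (fun a => d (pC a)).
    by split=> [c a b|a|a b]; [rewrite (pC_lin CS) dl|exact: dP|rewrite (pCM CS) dD].
  by exists v; split=> // c; rewrite -[c](iCK CS) dv /inner /= (iCK CS).
have d0 x y : d (x * e * y) = 0.
  have -> : x * e * y = (x * e) * (e * y) by rewrite -!mulrA [e * (e * y)]mulrA ee.
  by rewrite dD /= pC0e pCe0r (lact0 ax (dP _)) (ract0 ax (dP _)) addr0.
have dE := lin_factor dl d0.
have [|v [Yv dv]] := zY (fun c => d (iC c)).
  split=> [c a b|a|a b]; [by rewrite (iC_lin CS) dl|exact: dP|].
  by rewrite (iC_mul CS) dD /= !(iCK CS).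
by exists v; split=> // a; rewrite -dE dv.
Qed.
End InflatedShift.

(** Shifting over L and shifting over C differ by the bimodule of forms, which has no cohomology, so
    the two dimension shifts run in parallel. *)
Lemma hoch0_inflation V (Y : bimod C V) n : bimod_axioms Y ->
  hoch0 n (inflation Y) <-> hoch0 n Y.
Proof.
elim: n V Y => [|n IHn] V Y ax; first exact: hoch0_inflation0.
apply: (iff_trans (B := hoch0 n (kernel (shift (inflation Y)) (fun theta x y => theta (x * e * y))))).
  have axS := shift_axioms (inflation_axioms ax).
  split=> [z|z].
    case: n z {IHn} => [|n] z.
      (* In the lowest degree the absence of nonzero invariant forms takes the place of vanishing
         cohomology. *)
      apply: (hoch0_kernel0 axS (shift_form_hom ax) z) => y iy.
      exists 0; first exact: (invar_subspace axS).1.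
      apply/esym; apply: (@inflated_form_invar0 _ Y ax).
      by case: iy => -[cy _] h; split.
    apply: (hoch0_kernel axS (fixed_inflated_axioms ax) (shift_form_hom ax)) => //.
      exact: shift_form_surj.
    exact: hoch0_fixed_inflated.
  apply: (hoch0_middle axS (fixed_inflated_axioms ax) (shift_form_hom ax)) z _.
    exact: shift_form_surj.
  exact: hoch0_fixed_inflated.
apply: iff_trans (iff_sym (inflation_shift ax n)) _.
exact/IHn/shift_axioms.
Qed.

(** * Hochschild homology of L, B and C *)

Section Dual.
Let FD := form_bimodL (fun _ : k^o => True) (fun _ v => v) id.

Lemma dual_form_axioms : bimod_axioms FD.
Proof.
apply: form_bimodL_axioms => //; exact: subspaceT.
Qed.

Lemma fixed_dual_axioms : bimod_axioms (fixed FD (form_bimod (fun=> True))).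
Proof.
apply: fixed_axioms; [exact: dual_form_axioms|exact/(form_bimod_axioms CS)/subspaceT|].
exact: form_bimodL_commuting.
Qed.

Let p (theta : L -> k^o) x y := theta (x * e * y).

Lemma dual_form_hom : bimod_hom (dual L) (fixed FD (form_bimod (fun=> True))) p.
Proof.
split=> //=.
- by move=> th tl; apply: form_of_lin.
- by move=> a th _; apply/funext => x; apply/funext => y; rewrite /p mulrA.
- by move=> a th _; apply/funext => x; apply/funext => y; rewrite /p !mulrA.
Qed.

Lemma dual_form_surj z : carrier (fixed FD (form_bimod (fun=> True))) z ->
  exists2 y, carrier (dual L) y & p y = z.
Proof.
move=> iz; exists (form_ext z); first exact: form_ext_lin iz.1.
by apply/funext => x; apply/funext => y; apply: form_extE iz _ _.
Qed.

Lemma hoch0_dual_kernel n : hoch0 n (dual C) -> hoch0 n (kernel (dual L) p).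
Proof.
have axs := inflation_axioms (dual_axioms C).
have axk := kernel_axioms (dual_axioms L) fixed_dual_axioms dual_form_hom.
have kerE th : carrier (kernel (dual L) p) th -> forall z, th (iC (pC z)) = th z.
  move=> [tl p0]; apply: lin_factor => // x y.
  exact: (congr1 (fun h => h x y) p0).
move=> /(hoch0_inflation n (dual_axioms C)).
apply: (hoch0_hom_retract axs axk (j := fun th c => th (iC c)) (q := fun psi t => psi (pC t))).
- split=> //=.
  + by move=> th [tl _] c a b; rewrite (iC_lin CS) tl.
  + move=> a th Kth; apply/funext => c.
    by rewrite -(kerE _ Kth (iC c * a)) (pCM CS) (iCK CS).
  + move=> a th Kth; apply/funext => c.
    by rewrite -(kerE _ Kth (a * iC c)) (pCM CS) (iCK CS).
- split=> //=.
  + move=> psi sl; split; first by move=> c a b; rewrite (pC_lin CS) sl.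
    by apply/funext => x; apply/funext => y; rewrite /p (pCe0 CS) (lin0 sl).
  + by move=> a psi _; apply/funext => t; rewrite (pCM CS).
  + by move=> a psi _; apply/funext => t; rewrite (pCM CS).
- by move=> th Kth; apply/funext => z; apply: kerE.
Qed.

(** After the exchange the coefficients are the forms with b(x, ya) = b(ax, y). These are the
    phi(eyxe) with phi a functional on eLe, as eL (x)_L Le = eLe. *)
Lemma hoch0_dual_corner n :
  hoch0 n (fixed FD (form_bimod (fun=> True))) <-> hoch0 n (dual B).
Proof.
have sT := subspaceT k^o.
have E : hoch0 n (fixed FD (form_bimod (fun=> True))) <-> hoch0 n (fixed (form_bimod (fun=> True)) FD).
  by split; [apply: form_bimodL_exchange'|apply: form_bimodL_exchange].
apply: (iff_trans E).
have axF : bimod_axioms (fixed (form_bimod (fun=> True)) FD).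
  apply: fixed_axioms; [exact/(form_bimod_axioms CS)/subspaceT|exact: dual_form_axioms|].
  exact/commuting_sym/form_bimodL_commuting.
have inv b a x y : invar FD b -> b x (y * a) = b (a * x) y.
  by move=> [_ bi]; have := congr1 (fun h => h x y) (bi a).
have jH : bimod_hom (dual B) (fixed (form_bimod (fun=> True)) FD) (fun phi x y => phi (pB (y * x))).
  split=> //=.
  - move=> phi pl; split; first split=> //.
    + by move=> c x y; apply/funext => z; rewrite lin_mulr (pB_lin CS) pl.
    + by move=> x c y y'; rewrite lin_mull (pB_lin CS) pl.
    + move=> x y; split; congr phi; apply: (can_inj (iBK CS)); rewrite !(pBK CS) !mulrA ?ee //.
      by rewrite -[_ * e * e]mulrA ee.
    by move=> a; apply/funext => x; apply/funext => y; rewrite /= !mulrA.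
  - move=> a phi _; apply/funext => x; apply/funext => y; congr phi.
    apply: (can_inj (iBK CS)); rewrite (iB_mul CS) !(pBK CS) -!mulrA (iB_e CS).
    by rewrite [e * iB a](e_iB CS).
  - move=> a phi _; apply/funext => x; apply/funext => y; congr phi.
    apply: (can_inj (iBK CS)); rewrite (iB_mul CS) !(pBK CS) !mulrA (e_iB CS).
    by rewrite (iB_e CS).
have qH : bimod_hom (fixed (form_bimod (fun=> True)) FD) (dual B) (fun b t => b e (iB t)).
  split=> //=.
  - by move=> b [[_ br _ _] _] c x y; rewrite (iB_lin CS) br.
  - move=> a b ib; apply/funext => t; rewrite (iB_mul CS) inv //.
    by rewrite (e_iB CS) (iB_e CS).
  - by move=> a b _; apply/funext => t; rewrite (iB_mul CS).
split.
  apply: (hoch0_hom_retract axF (dual_axioms B) jH qH) => phi _.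
  by apply/funext => t; rewrite (iB_e CS) (iBK CS).
apply: (hoch0_hom_retract (dual_axioms B) axF qH jH) => b ib.
apply/funext => x; apply/funext => y; have [[_ _ _ be] _] := ib.
by rewrite (pBK CS) inv // ee (be _ _).2 inv // (be _ _).1.
Qed.

(** [iC] splits the quotient map multiplicatively, so DC is a retract of DL along [pC] and [iC]. *)
Lemma hoch0_dual_C n : hoch0 n (dual L) -> hoch0 n (dual C).
Proof.
apply: (@hoch0_retract _ L C _ _ _ _ pC iC (fun psi t => psi (pC t)) (fun th c => th (iC c)));
  rewrite ?/=; [exact: dual_axioms|exact: dual_axioms|exact: pC_lin CS|exact: (pCM CS)|
    exact: iC_lin CS|exact: iC_mul CS|exact: iCK CS|..] => //=.
- by move=> psi sl c a b; rewrite (pC_lin CS) sl.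
- by move=> a psi _; apply/funext => t; rewrite (pCM CS).
- by move=> a psi _; apply/funext => t; rewrite (pCM CS).
- by move=> th tl c a b; rewrite (iC_lin CS) tl.
- by move=> a th _; apply/funext => c; rewrite (iC_mul CS).
- by move=> a th _; apply/funext => c; rewrite (iC_mul CS).
- by move=> psi _; apply/funext => c; rewrite (iCK CS).
Qed.

Lemma HH_finite_stratified : HH_finite L <-> HH_finite B /\ HH_finite C.
Proof.
have ps := dual_form_surj.
split=> [[N HHL]|[[N HHB] [N' HHC]]].
  have zL n : (N <= n)%N -> hoch0 n (dual L) by move=> Nn; apply/HH_hoch0/HHL.
  have zC n : (N <= n)%N -> hoch0 n (dual C) by move=> /zL/hoch0_dual_C.
  split; exists N => -[//|n] Nn; apply/HH_hoch0; last exact: zC.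
  apply/hoch0_dual_corner.
  (* The form term in degree n+1 lies between DL in degree n+1 and DC in degree n+2. *)
  apply: (hoch0_cokernel (dual_axioms L) fixed_dual_axioms dual_form_hom) => //.
    exact: zL.
  exact/hoch0_dual_kernel/zC/leqW.
exists (maxn N N') => -[//|n]; rewrite ltnS geq_max => /andP[Nn Nn']; apply/HH_hoch0.
apply: (hoch0_middle (dual_axioms L) fixed_dual_axioms dual_form_hom) => //.
  exact/hoch0_dual_kernel/HH_hoch0/HHC.
exact/hoch0_dual_corner/HH_hoch0/HHB.
Qed.
End Dual.
End Stratified.

(** * Global dimension and the corners *)

Section StratifiedGlobalDimension.
Variables (k : fieldType) (L B C : fdAlg k) (e : L).
Variables (iB : B -> L) (pB : L -> B) (iC : C -> L) (pC : L -> C).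
Hypothesis S : stratified e iB pB iC pC.
Let CS := strat_corners S.
Let ee := idem_e CS.
Local Notation f := (1 - e).

Fact iB_scal c a b : iB (c *: a + b) = scal L c * iB a + iB b.
Proof. by rewrite (iB_lin CS) scalM. Qed.

Fact pC_scal c a b : pC (c *: a + b) = scal C c * pC a + pC b.
Proof. by rewrite (pC_lin CS) scalM. Qed.

Fact pC_zmod : zmod_morphism pC.
Proof. by move=> a b; rewrite (linB (pC_lin CS)). Qed.
Fact pC_monoid : monoid_morphism pC.
Proof. by split; [exact: pC1 CS|exact: pCM CS]. Qed.
Definition pC_morph : {rmorphism L -> C} := HB.pack pC
  (GRing.isZmodMorphism.Build L C pC pC_zmod) (GRing.isMonoidMorphism.Build L C pC pC_monoid).

(* Hom_k(K, Y) for an L-module K and a left B-module Y.                       *)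
Definition HomB (E : lmodType k) (Y : bimod B E) (ax : bimod_axioms Y) (K : lmodType L) :=
  Hom_bimod (left_coef iB_scal (iB_mul CS) ax) K.

(* Hom_k(X, Y) for a C-module X and an L-module Y.                            *)
Definition HomC (Y : lmodType L) (X : lmodType C) :=
  Hom_bimod (left_coef pC_scal (pCM CS) (lmod_bimod_axioms Y)) X.

Lemma HomB_axioms E Y ax K : bimod_axioms (@HomB E Y ax K).
Proof. exact/Hom_bimod_axioms/scalC. Qed.

Lemma HomC_axioms Y X : bimod_axioms (HomC Y X).
Proof. exact/Hom_bimod_axioms/scalC. Qed.

Lemma pC_scal1 c : pC_morph (scal L c) = scal C c.
Proof. by rewrite /= /scal_fun (linZ (pC_lin CS)) (pC1 CS). Qed.

(** Both sides are Ext over L of the inflated module. [HomC] keeps C as the base ring of [X], so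
    that projective resolutions over C apply to it. *)
Lemma hoch0_restr Y X n : hoch0 n (Hom_lmod (restr pC_morph X) Y) <-> hoch0 n (HomC Y X).
Proof.
have cE g : carrier (Hom_lmod (restr pC_morph X) Y) g <-> carrier (HomC Y X) g.
  split=> -[gl _]; split=> // c x y.
    by have := gl c x y; rewrite !restrE pC_scal1.
  by have := gl c x y; rewrite !restrE pC_scal1.
split; apply: hoch0_ext => //.
- by apply/funext => a; apply/funext => g; apply/funext => x; rewrite /= !scale1r.
- by move=> g; apply: iff_sym.
- by apply/funext => a; apply/funext => g; apply/funext => x; rewrite /= !scale1r.
Qed.

(** For C-modules Ext_C(X, Y) = Ext_L(X, Y), by [hoch0_inflation] for Hom_k(X, Y). *)
Lemma finite_gldim_C : finite_gldim L -> finite_gldim C.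
Proof.
move=> /finite_gldimP[d zL]; apply/finite_gldimP; exists d => X Y m dm.
have ax := Hom_lmod_axioms X Y; apply/(hoch0_inflation S m ax).
have := zL (restr pC_morph X) (restr pC_morph Y) m dm.
apply: (@hoch0_hom_retract k L _ _ (Hom_lmod (restr pC_morph X) (restr pC_morph Y))
  (inflation pC (Hom_lmod X Y)) (fun g x => g x) (fun g x => g x) m (Hom_lmod_axioms _ _)
  (inflation_axioms S ax)) => //.
- split=> //=.
  + move=> g [gl _]; split=> // c x y.
    by have := gl c x y; rewrite !restrE !pC_scal1.
  + move=> c g g' _ _; apply/funext => x.
    change (scal C c *: g x + g' x = scal L c *: (g x : restr pC_morph Y) + g' x).
    by rewrite restrE pC_scal1.
  + by move=> a g _; apply/funext => x; rewrite !scale1r.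
- split=> //=.
  + move=> g [gl _]; split=> // c x y.
    by have := gl c x y; rewrite !restrE !pC_scal1.
  + move=> c g g' _ _; apply/funext => x.
    change (scal L c *: (g x : restr pC_morph Y) + g' x = scal C c *: g x + g' x).
    by rewrite restrE pC_scal1.
  + by move=> a g _; apply/funext => x; rewrite !scale1r.
Qed.

Section CornerModule.
Variable K : lmodType L.
Fact corner_data : submod_data B K.
Proof.
apply: (@SubmodData B K (fun x => e *: x = x) (fun b x => iB b *: x)).
- exact: scaler0.
- by move=> x y ex ey; rewrite scalerBr ex ey.
- by move=> b x _; rewrite scalerA (e_iB CS).
- by move=> a b x _; rewrite scalerA (iB_mul CS).
- by move=> x ex; rewrite (iB1 CS).
- by move=> b x y _ _; rewrite scalerDr.
- by move=> a b x _; rewrite (linD (iB_lin CS)) scalerDl.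
Defined.
Definition corner_mod : lmodType B := submod corner_data.

Definition to_corner (x : K) : corner_mod :=
  @sm_mk _ _ corner_data (e *: x) (etrans (scalerA _ _ _) (congr1 (fun u => u *: x) ee)).

Lemma to_cornerK x : sm_val (to_corner x) = e *: x.
Proof. by []. Qed.

Lemma sm_val_corner (x : corner_mod) : e *: sm_val x = sm_val x.
Proof. exact: (sm_valP x). Qed.
End CornerModule.

(** Restricting maps from K to eK is onto, and B acts by zero on the right of the kernel since bx
    lies in eK. What remains is Ext_B(eK, Y), where the carrier of [Y] is turned into a genuine
    unital module [Z]. *)
Lemma hoch0_HomB (b0 : nat) (E : lmodType k) (Y : bimod B E) (ax : bimod_axioms Y) K m :
    (forall (X Z : lmodType B) m, (b0 <= m)%N -> hoch0 m (Hom_lmod X Z)) ->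
    (forall y, carrier Y y -> lact Y 1 y = y) ->
  (b0 <= m)%N -> hoch0 m (HomB ax K).
Proof.
move=> zB Y1 bm; have sY := carrier_sub ax.
have D : {D : submod_data B E | sm_in D = carrier Y & sm_act D = lact Y}.
  unshelve eexists (@SubmodData B E (carrier Y) (lact Y) _ _ _ _ _ _ _) => //.
  - exact: sY.1.
  - by move=> x y; apply: subspaceB.
  - exact: lact_in.
  - by move=> a b x Yx; rewrite (lactM ax).
  - by move=> b x y Yx Yy; rewrite (lin_onD (lact_lin ax b)).
  - by move=> a b x Yx; rewrite (linD (lact_linl ax Yx)).
case: D => D inD actD; pose Z : lmodType B := submod D.
(* The inverse of [sm_val], with dummy value 0 outside the carrier. *)
have toZ y : exists z : Z, carrier Y y -> sm_val z = y.
  have [Yy|nYy] := pselect (carrier Y y); last by exists 0.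
  by rewrite -inD in Yy; exists (sm_mk Yy).
have [g gK] := choice toZ.
have valZ c (z : Z) : sm_val (scal B c *: z) = c *: sm_val z.
  rewrite sm_valZ actD [scal B c](erefl (scal_fun B c)) /scal_fun.
  have Yz : carrier Y (sm_val z) by rewrite -inD; apply: sm_valP.
  by rewrite (linZ (lact_linl ax Yz)) Y1.
have val_in (z : Z) : carrier Y (sm_val z) by rewrite -inD; apply: sm_valP.
pose X := corner_mod K; have axX := Hom_bimod_axioms (@scalC _ B) (hom_coef ax) X.
have zX : hoch0 m (Hom_bimod (hom_coef ax) X).
  apply: (@hoch0_hom_retract k B _ _ (Hom_lmod X Z) (Hom_bimod (hom_coef ax) X)
      (fun h x => g (h x)) (fun h x => sm_val (h x)) m _ _ _ _ _ (zB X Z m bm)).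
  - exact: Hom_lmod_axioms.
  - exact: axX.
  - split=> /=.
    + move=> h [hl hY]; split=> // c x y; apply: sm_val_inj.
      rewrite [sm_val (_ + _)]sm_valD restrE valZ !gK //; exact: hl.
    + move=> c h h' [_ hY] [_ hY']; apply/funext => x; apply: sm_val_inj.
      rewrite [sm_val ((_ + _) x)]sm_valD; change (sm_val (g (c *: h x + h' x)) = sm_val (scal B c *: g (h x)) + sm_val (g (h' x))).
      by rewrite valZ !gK //; apply: sY.2.
    + move=> a h [_ hY]; apply/funext => x; apply: sm_val_inj.
      by rewrite sm_valZ actD !gK //; apply: lact_in.
    + by [].
  - split=> /=.
    + move=> h [hl _]; split=> [c x y|x]; last exact: val_in.
      by rewrite -valZ -sm_valD -[in RHS]restrE -hl.
    + move=> c h h' _ _; apply/funext => x.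
      change (sm_val (scal B c *: h x + h' x) = c *: sm_val (h x) + sm_val (h' x)).
      by rewrite sm_valD valZ.
    + by move=> a h _; apply/funext => x; rewrite -actD.
    + by [].
  - by move=> h [_ hY]; apply/funext => x; exact: gK (hY x).
pose p (h : K -> E) (x : X) := h (sm_val x).
have kap_val c (x : X) : sm_val (scal B c *: x) = scal L c *: sm_val x.
  rewrite sm_valZ [sm_act _ _ _](erefl (iB (scal_fun B c) *: sm_val x)) /scal_fun.
  by rewrite (linZ (iB_lin CS)) (iB1 CS) -scalM -scalerA sm_val_corner.
have pH : bimod_hom (HomB ax K) (Hom_bimod (hom_coef ax) X) p.
  split=> //=.
  - move=> h [hl hY]; split=> [c x y|x]; last exact: hY.
    by rewrite /p -[RHS](hl c (sm_val x) (sm_val y)) restrE sm_valD kap_val.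
  - by move=> a h _; apply/funext => x; rewrite /p !scale1r.
have axK := HomB_axioms ax K.
apply: (hoch0_middle axK axX pH _ _ zX).
- move=> h [hl hY]; exists (fun x => h (to_corner x)); last first.
    apply/funext => x; rewrite /p; congr h; apply: sm_val_inj.
    by rewrite to_cornerK sm_val_corner.
  split=> [c x y|x]; last exact: hY.
  rewrite -[RHS](hl c (to_corner x) (to_corner y)); congr h.
  apply: sm_val_inj; rewrite !restrE sm_valD kap_val !to_cornerK scalerDr !scalerA.
  by rewrite scalC.
- apply: hoch0_ract0; first exact: kernel_axioms axK axX pH.
  move=> b h [_ ph]; apply/funext => x /=.
  have -> : iB b *: x = sm_val (to_corner (iB b *: x)).
    by rewrite to_cornerK scalerA (e_iB CS).
  exact: (congr1 (@^~ _) ph).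
Qed.

Section ModuleForms.
Variable Y : lmodType L.
Local Notation V := (restr (scal L) Y).

Lemma kscaleC (M : lmodType L) (a : L) c (x : M) : a *: (scal L c *: x) = scal L c *: (a *: x).
Proof. by rewrite !scalerA scalC. Qed.

(* Hom_k(Le, Y) as a left B-module.                                           *)
Definition LeY_bimod : bimod B (L -> V) :=
  Bimod (fun h : L -> V => lin h /\ forall t, h (t * e) = h t)
    (fun b h t => h (t * iB b)) (fun _ _ => 0).

Lemma LeY_axioms : bimod_axioms LeY_bimod.
Proof.
split=> //=.
- split; first by split=> //; apply: lin_fct0.
  move=> c h h' [hl he] [hl' he']; split=> [|t]; first exact: lin_fctL.
  by change (c *: h (t * e) + h' (t * e) = c *: h t + h' t); rewrite he he'.
- move=> b h [hl he]; split=> [c x y|t]; first by rewrite lin_mull hl.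
  by rewrite -mulrA (e_iB CS).
- by move=> _ h _; split=> //; apply: lin_fct0.
- by move=> b c h h' _ _; rewrite scaler0 addr0.
- by move=> h [hl _] c a b; apply/funext => t; rewrite (iB_lin CS) lin_mulr hl.
- by move=> h _ c a b; rewrite scaler0 addr0.
- by move=> a b h _; apply/funext => t; rewrite (iB_mul CS) mulrA.
Qed.

Lemma LeY_unital h : carrier LeY_bimod h -> lact LeY_bimod 1 h = h.
Proof. by move=> [_ he]; apply/funext => t; rewrite /= (iB1 CS). Qed.

Definition eY_bimod : bimod B V :=
  Bimod (fun y : V => e *: (y : Y) = y) (fun b y => iB b *: (y : Y)) (fun _ _ => 0).

Lemma eY_axioms : bimod_axioms eY_bimod.
Proof.
split=> //=.
- split; first exact: scaler0.
  by move=> c x y ex ey; rewrite scalerDr restrE kscaleC ex ey.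
- by move=> b y _; rewrite scalerA (e_iB CS).
- by move=> _ y _; rewrite scaler0.
- by move=> b c x y _ _; rewrite scalerDr !restrE kscaleC.
- by move=> b c x y _ _; rewrite scaler0 addr0.
- by move=> y _ c a b; rewrite (iB_lin CS) scalerDl restrE scalerA scalM.
- by move=> y _ c a b; rewrite scaler0 addr0.
- by move=> a b y _; rewrite (iB_mul CS) scalerA.
- by move=> a b y _; rewrite scaler0.
Qed.

Lemma eY_unital y : carrier eY_bimod y -> lact eY_bimod 1 y = y.
Proof. by move=> /= ey; rewrite (iB1 CS). Qed.

Section OneModule.
Variable K : lmodType L.

(* Bilinear forms on K x Le with values in Y, as a B- and as an L-bimodule.   *)
Definition formKB := HomB LeY_axioms K.
Definition formKL : bimod L (K -> L -> V) :=
  Bimod (carrier formKB) (fun a b x t => a *: (b x t : Y)) (fun a b x t => b x (a * t)).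

Lemma formKB_axioms : bimod_axioms formKB. Proof. exact: HomB_axioms. Qed.

Lemma formKL_axioms : bimod_axioms formKL.
Proof.
split=> //=.
- exact: carrier_sub formKB_axioms.
- move=> a b [bl bh]; split=> [c x y|x].
    apply/funext => t; rewrite bl.
    change (a *: (scal L c *: (b x t : Y) + b y t) = scal L c *: (a *: (b x t : Y)) + a *: (b y t : Y)).
    by rewrite scalerDr kscaleC.
  have [hl he] := bh x; split=> [c u v|t]; last by rewrite he.
  by rewrite hl scalerDr !restrE kscaleC.
- move=> a b [bl bh]; split=> [c x y|x]; first by apply/funext => t; rewrite bl.
  have [hl he] := bh x; split=> [c u v|t]; first by rewrite lin_mulr hl.
  by rewrite mulrA he.
- move=> a c b b' _ _; apply/funext => x; apply/funext => t.
  change (a *: (scal L c *: (b x t : Y) + b' x t) = scal L c *: (a *: (b x t : Y)) + a *: (b' x t : Y)).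
  by rewrite scalerDr kscaleC.
- move=> b _ c a a'; apply/funext => x; apply/funext => t.
  change ((c *: a + a') *: (b x t : Y) = scal L c *: (a *: (b x t : Y)) + a' *: (b x t : Y)).
  by rewrite scalerDl scalerA scalM.
- by move=> b [bl bh] c a a'; apply/funext => x; apply/funext => t; rewrite lin_mull (bh x).1.
- by move=> a a' b _; apply/funext => x; apply/funext => t; rewrite scalerA.
- by move=> a a' b _; apply/funext => x; apply/funext => t; rewrite mulrA.
Qed.

Lemma formK_commuting : commuting formKL formKB.
Proof. by split=> //= a b beta _; apply/funext => x; apply/funext => t; rewrite ?scale1r ?mulrA. Qed.

Lemma formKL_acyclic n : hoch0 n formKL.
Proof.
apply: hoch0_rcoinduced; first exact: formKL_axioms.
exists (fun psi x t => psi (t * e) x e); split=> /=.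
- move=> psi [pl pF]; split.
    move=> c x y; apply/funext => t; have [bl _] := pF (t * e).
    by rewrite bl.
  by move=> x; split=> [c u v|t]; [rewrite lin_mull pl|rewrite -mulrA ee].
- by [].
- by move=> b [_ bh]; apply/funext => x; apply/funext => t; rewrite -mulrA ee (bh x).2.
- by move=> a psi _; apply/funext => x; apply/funext => t; rewrite mulrA.
- by [].
Qed.

Definition formK := fixed formKL formKB.
Lemma formK_axioms : bimod_axioms formK.
Proof. by apply: fixed_axioms; [exact: formKL_axioms|exact: formKB_axioms|exact: formK_commuting]. Qed.

(** An L-invariant form is t phi(x) with phi : K -> eY, obtained at t = e. So, when [formKB] is
    acyclic, the exchange turns cohomology of Hom(Le (x)_B eK, Y) over L into Ext_B(eK, eY). *)
Lemma hoch0_formK n : (forall m, hoch0 m formKB) ->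
  hoch0 n formK <-> hoch0 n (HomB eY_axioms K).
Proof.
move=> zB; apply: (iff_trans (B := hoch0 n (fixed formKB formKL))).
  split; apply: hoch0_exchange; try exact: formKL_acyclic; try exact: zB;
    try exact: formKL_axioms; try exact: formKB_axioms; try exact: formK_commuting.
  exact/commuting_sym/formK_commuting.
have axF : bimod_axioms (fixed formKB formKL).
  by apply: fixed_axioms; [exact: formKB_axioms|exact: formKL_axioms|exact/commuting_sym/formK_commuting].
have inv b a x t : invar formKL b -> a *: (b x t : Y) = b x (a * t).
  by move=> [_ bi]; have := congr1 (fun h => h x t) (bi a).
have jH : bimod_hom (HomB eY_axioms K) (fixed formKB formKL) (fun phi x t => t *: (phi x : Y)).
  split=> /=.
  - move=> phi [pl pe]; split; last first.
      by move=> a; apply/funext => x; apply/funext => t; rewrite /= scalerA.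
    split.
      move=> c x y; apply/funext => t; rewrite pl.
      change (t *: (scal L c *: (phi x : Y) + phi y) = scal L c *: (t *: (phi x : Y)) + t *: (phi y : Y)).
      by rewrite scalerDr kscaleC.
    move=> x; split=> [c u v|t]; last by rewrite -scalerA pe.
    by rewrite scalerDl restrE scalerA scalM.
  - move=> c phi phi' _ _; apply/funext => x; apply/funext => t.
    change (t *: (scal L c *: (phi x : Y) + phi' x) = scal L c *: (t *: (phi x : Y)) + t *: (phi' x : Y)).
    by rewrite scalerDr kscaleC.
  - by move=> a phi _; apply/funext => x; apply/funext => t; rewrite !scale1r scalerA.
  - by [].
have qH : bimod_hom (fixed formKB formKL) (HomB eY_axioms K) (fun b x => b x e).
  split=> //=.
  - move=> b ib; have [[bl bh] _] := ib; split=> [c x y|x]; first by rewrite bl.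
    by rewrite inv // ee.
  - by move=> a b ib; apply/funext => x; rewrite inv // !scale1r (e_iB CS) (iB_e CS).
split.
  apply: (hoch0_hom_retract axF (HomB_axioms _ _) jH qH) => phi [_ pe].
  by apply/funext => x; apply: pe.
apply: (hoch0_hom_retract (HomB_axioms _ _) axF qH jH) => b ib.
apply/funext => x; apply/funext => t; rewrite inv //.
by have [[_ bh] _] := ib; rewrite (bh x).2.
Qed.

(** Restriction along the multiplication Le (x)_B eK -> K. *)
Definition formK_of (th : K -> V) (x : K) (t : L) : V := th ((t * e) *: x).

Lemma formK_hom : bimod_hom (Hom_lmod K Y) formK formK_of.
Proof.
split=> /=.
- move=> th [tl _]; split.
    split.
      move=> c x y; apply/funext => t; rewrite /formK_of.
      rewrite -[RHS](tl c ((t * e) *: x) ((t * e) *: y)); congr th.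
      by rewrite !restrE scalerDr kscaleC.
    move=> x; split=> [c u v|t]; last by rewrite /formK_of -mulrA ee.
    rewrite /formK_of -[RHS](tl c ((u * e) *: x) ((v * e) *: x)); congr th.
    by rewrite lin_mull scalerDl restrE scalerA scalM.
  move=> b; apply/funext => x; apply/funext => t; rewrite /= scale1r /formK_of.
  by rewrite scalerA -!mulrA (e_iB CS) (iB_e CS).
- by [].
- by move=> a th _; apply/funext => x; apply/funext => t; rewrite /formK_of !scale1r.
- by move=> a th _; apply/funext => x; apply/funext => t; rewrite /formK_of scalerA mulrA.
Qed.

(* The kernel is Hom_k(K / LeK, Y), and K / LeK is a C-module; it is realised
   on a complement of LeK in K.                                               *)
Lemma formK_kernel : exists Q : lmodType C, forall n,
  hoch0 n (HomC Y Q) -> hoch0 n (kernel (Hom_lmod K Y) formK_of).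
Proof.
pose KV := restr (scal L) K.
(* [U] is LeK, as the smallest subspace containing the products. *)
pose U (x : KV) := forall P : KV -> Prop, subspace P -> (forall t y, P ((t * e) *: (y : K))) -> P x.
have sU : subspace U.
  split; first by move=> P sP _; apply: sP.1.
  by move=> c x y Ux Uy P sP Pe; apply: sP.2; [apply: Ux|apply: Uy].
have Ue t y : U ((t * e) *: (y : K)) by move=> P _; apply.
have UL a x : U x -> U (a *: (x : K)).
  move=> Ux; apply: (Ux (fun z => U (a *: (z : K)))) => [|t y]; last by rewrite scalerA mulrA; apply: Ue.
  split; first by rewrite scaler0; apply: sU.1.
  by move=> c z z' Uz Uz'; rewrite scalerDr restrE kscaleC; apply: (sU.2 c).
(* [tau] is a k-linear projection with kernel [U]; its image represents K / LeK. *)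
have [|||||tau [taul tauU tau0]] := @linear_selection k KV KV (fun=> True)
  (fun x y => U (x - y)) (fun x y => U x /\ y = 0) (@subspaceT _ KV).
- split; first by rewrite subrr; apply: sU.1.
  move=> c x y x' y' Ux Ux'.
  rewrite (_ : _ - _ = c *: (x - y) + (x' - y')); first exact: sU.2.
  by rewrite scalerBr opprD addrACA.
- split; first by split=> //; apply: sU.1.
  by move=> c x _ x' _ [Ux ->] [Ux' ->]; split; [exact: sU.2|rewrite scaler0 addr0].
- by move=> x _; exists x; rewrite subrr; apply: sU.1.
- by move=> x _ [Ux ->]; rewrite subr0.
- by move=> y [].
have {}taul : lin tau by move=> c x y; apply: taul.
have {}tauU x : U (x - tau x) by apply: tauU.
have {}tau0 x : U x -> tau x = 0 by move=> Ux; apply: tau0.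
have tauE x y : U (x - y) -> tau x = tau y.
  by move=> /tau0; rewrite (linB taul) => /eqP; rewrite subr_eq0 => /eqP.
have tauK x : tau (tau x) = tau x.
  by apply/esym/tauE.
(* Modulo LeK only the component faf of a acts, which is the action of C. *)
have tauf a x : tau (a *: (x : K)) = tau ((f * a * f) *: (x : K)).
  apply: tauE; suff: U ((a - f * a * f) *: (x : K)) by rewrite scalerBl.
  have -> : a - f * a * f = (e * (a * f)) + (a * e).
    rewrite -mulrA mulrBl mul1r opprB addrCA addrC -[RHS]addrC; congr (_ + _).
    by rewrite mulrBr mulr1 opprB addrC subrK.
  rewrite scalerDl; apply: (subspaceD sU); last exact: Ue.
  by have := Ue 1 ((a * f) *: (x : K)); rewrite mul1r scalerA.
have [D inD actD] : {D : submod_data C KV | sm_in D = (fun x => tau x = x) &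
    sm_act D = (fun c x => tau (iC c *: (x : K)))}.
  unshelve eexists (@SubmodData C KV (fun x => tau x = x)
    (fun c x => tau (iC c *: (x : K))) _ _ _ _ _ _ _) => //.
  - exact: lin0 taul.
  - by move=> x y tx ty; apply: (etrans (linB taul x y)); rewrite tx ty.
  - move=> a b x tx /=; rewrite (iC_mul CS) -scalerA; apply: tauE.
    suff: U (iC a *: (tau (iC b *: (x : K)) - iC b *: (x : K) : K)) by rewrite scalerBr.
    by apply: UL; rewrite -opprB; apply: (subspaceN sU).
  - by move=> x tx /=; have := tauf 1 x; rewrite mulr1 (ff CS) scale1r tx (iC1 CS) => <-.
  - by move=> a x y tx ty /=; rewrite scalerDr; apply: (linD taul).
  - by move=> a b x tx /=; rewrite (linD (iC_lin CS)) scalerDl; apply: (linD taul).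
pose Q : lmodType C := submod D; exists Q => n.
pose mk (x : KV) : Q := @sm_mk _ _ D (tau x) (eq_ind_r (fun P => P (tau x)) (tauK x) inD).
have mkE x : sm_val (mk x) = tau x by [].
have axk := kernel_axioms (Hom_lmod_axioms K Y) formK_axioms formK_hom.
have val_tau (x : Q) : tau (sm_val x) = sm_val x by have := sm_valP x; rewrite inD.
have kap_val c (x : Q) : sm_val (scal C c *: x) = c *: (sm_val x : KV).
  rewrite sm_valZ actD [scal C c](erefl (scal_fun C c)) /scal_fun (linZ (iC_lin CS)) (iC1 CS).
  have -> : c *: f = f * scal L c * f by rewrite -scalC -mulrA (ff CS) scalM.
  rewrite -tauf -[scal L c *: _]/(c *: (sm_val x : KV)).
  by apply: (etrans (linZ taul c (sm_val x))); rewrite val_tau.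
have kerU th x : carrier (kernel (Hom_lmod K Y) formK_of) th -> th (tau x) = th x.
  move=> [[tl _] t0]; apply/esym/eqP; rewrite -subr_eq0 -(@linB k KV V th tl).
  apply/eqP; apply: (tauU x (fun z => th z = 0)) => [|t y]; last exact: (congr1 (fun h => h y t) t0).
  split; first exact: (lin0 tl).
  by move=> c z z' tz tz'; rewrite (tl c z z') tz tz' scaler0 addr0.
apply: (@hoch0_hom_retract k L _ _ (HomC Y Q) (kernel (Hom_lmod K Y) formK_of)
  (fun th x => th (sm_val x)) (fun phi x => phi (mk x)) n (HomC_axioms _ _) axk).
- split=> //=.
  + move=> th [[tl tY] _]; split=> // c x y.
    by rewrite -[RHS](tl c (sm_val x) (sm_val y)) restrE sm_valD kap_val.
  + by move=> a th _; apply/funext => x; rewrite -[sm_act D 1 _]sm_valZ !scale1r.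
  + move=> a th Kth; apply/funext => x; rewrite actD (pCK CS) -tauf.
    by rewrite (kerU _ _ Kth).
- split=> //=.
  + move=> phi [pl pY]; split; first split=> // c x y.
      rewrite -[RHS](pl c (mk x) (mk y)); congr phi; apply: sm_val_inj.
      by rewrite !restrE sm_valD kap_val !mkE taul.
    apply/funext => x; apply/funext => t; rewrite /formK_of.
    rewrite (_ : mk _ = 0) ?(klin0 pl) //; apply: sm_val_inj.
    by rewrite mkE tau0.
  + by move=> a phi _; apply/funext => x; rewrite !scale1r.
  + move=> a phi _; apply/funext => x; congr phi; apply: sm_val_inj.
    rewrite sm_valZ actD !mkE (pCK CS) -tauf; apply/esym/tauE.
    suff: U (a *: ((x : K) - tau x)) by rewrite scalerBr.
    exact: UL.
- by move=> th Kth; apply/funext => x; exact: (kerU _ _ Kth).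
Qed.
End OneModule.
End ModuleForms.
End StratifiedGlobalDimension.

(** * Comparison of the global dimensions of L, B and C *)

Section CornersGlobalDimension.
Variables (k : fieldType) (L B C : fdAlg k) (e : L).
Variables (iB : B -> L) (pB : L -> B) (iC : C -> L) (pC : L -> C).
Hypothesis S : stratified e iB pB iC pC.
Let CS := strat_corners S.
Let ee := idem_e CS.
Local Notation f := (1 - e).

Section LiftForms.
Variable Y : lmodType L.
Local Notation V := (restr (scal L) Y).
Variable K : lmodType L.

(** For fixed [x] the form (t, y) |-> b(yx, t) on Le x eL is balanced, hence a linear function of
    tey. The lift is this function of [u], the candidate for [th (u *: x)]. *)
Definition formK_lift (b : K -> L -> V) (x : K) (u : L) : V :=
  form_ext e (fun t y => b (y *: x) t) u.

Lemma formK_liftE b x t y : carrier (formK S Y K) b ->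
  formK_lift b x (t * e * y) = b (y *: x) t.
Proof.
move=> [[bl bh] bi].
have bal c z s : b (iB c *: z) s = b z (s * iB c).
  by have := congr1 (fun h => h z s) (bi c); rewrite /= scale1r.
apply: (form_extE S (Q := fun=> True) (b := fun t y => b (y *: x) t)); split.
  split=> //.
  - by move=> c u v; apply/funext => z; apply: (bh (z *: x)).1.
  - move=> u c v w; rewrite -[RHS]/((c *: b (v *: x) + b (w *: x)) u) -bl.
    by rewrite scalerDl restrE scalerA scalM.
  - move=> u v; split; first exact: (bh (v *: x)).2.
    by rewrite -scalerA -(iB1 CS) bal (iB1 CS) (bh _).2.
by move=> c; apply/funext => u; apply/funext => v; rewrite /= -scalerA bal.
Qed.

Lemma formK_lift_lin b x : carrier (formK S Y K) b -> lin (formK_lift b x).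
Proof.
move=> [[bl bh] _] c u v; rewrite /formK_lift /form_ext.
have -> : b ((c *: u + v) *: x) e = c *: b (u *: x) e + b (v *: x) e.
  rewrite -[RHS]/((c *: b (u *: x) + b (v *: x)) e) -bl.
  by rewrite scalerDl restrE scalerA scalM.
by rewrite lin_mulr (bh (e *: x)).1 scalerDr -!addrA; congr (_ + _); rewrite addrCA.
Qed.

Lemma formK_lift_linx b u c x y : carrier (formK S Y K) b ->
  formK_lift b (scal L c *: x + y) u = c *: formK_lift b x u + formK_lift b y u.
Proof.
move=> [[bl _] _]; have h a s : b (a *: (scal L c *: x + y)) s = c *: b (a *: x) s + b (a *: y) s.
  rewrite -[RHS]/((c *: b (a *: x) + b (a *: y)) s) -bl.
  by rewrite scalerDr restrE kscaleC.
by rewrite /formK_lift /form_ext !h scalerDr addrACA.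
Qed.
End LiftForms.

Lemma formK_onto_regular Y b : carrier (formK S Y L^o) b ->
  exists2 th, carrier (Hom_lmod L^o Y) th & formK_of e th = b.
Proof.
move=> cb; exists (formK_lift b 1).
  split=> // c x y; rewrite restrE -[RHS](formK_lift_lin (1 : L^o) cb).
  by congr formK_lift; rewrite -scalM.
apply/funext => x; apply/funext => t; rewrite /formK_of.
by rewrite formK_liftE // [x *: _]mulr1.
Qed.

(** The lifts at the generators define [th]: on a free module there are no relations among the
    products ux to respect beyond bilinearity over k. *)
Lemma formK_onto_free Y X b : carrier (formK S Y (free_mod (scal L) X)) b ->
  exists2 th, carrier (Hom_lmod (free_mod (scal L) X) Y) th & formK_of e th = b.
Proof.
move=> cb; have gl c x y := free_gen_lin (scal L) (X := X) c x y.
have gZ c (x : X) : free_gen (scal L) (c *: x) = scal L c *: free_gen (scal L) x.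
  have := gl c x 0.
  have g0 : free_gen (scal L) (0 : X) = 0.
    by apply: (addrI (free_gen (scal L) 0)); have := gl 1 0 0; rewrite !scale1r rmorph1 scale1r !addr0.
  by rewrite addr0 g0 addr0.
have gD (x y : X) : free_gen (scal L) (x + y) = free_gen (scal L) x + free_gen (scal L) y.
  by have := gl 1 x y; rewrite scale1r rmorph1 scale1r.
have [|||h [hD hE]] := @free_biadd L k (scal L) X (restr (scal L) Y)
  (fun u x => formK_lift b (free_gen (scal L) x) u).
- by move=> u v x; rewrite (linD (formK_lift_lin _ cb)).
- move=> u x y; rewrite gD; have := formK_lift_linx u 1 (free_gen (scal L) x) (free_gen (scal L) y) cb.
  by rewrite rmorph1 !scale1r.
- move=> c u x; rewrite Mscal (linZ (formK_lift_lin _ cb)) gZ.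
  have := formK_lift_linx u c (free_gen (scal L) x) 0 cb.
  have -> : formK_lift b 0 u = 0.
    have := formK_lift_linx u 1 0 0 cb; rewrite rmorph1 !scale1r addr0 => /esym h.
    by apply: (addrI (formK_lift b 0 u)); rewrite h addr0.
  by rewrite !addr0.
have hK v t : h ((t * e) *: v) = b v t.
  have [[bl _] _] := cb.
  move: v; apply: free_additive_ext => [u v|u v|r x].
  - by rewrite scalerDr hD.
  - by rewrite (linD (V := restr (scal L) _) bl).
  - by rewrite scalerA hE formK_liftE.
exists h; last by apply/funext => v; apply/funext => t; apply: hK.
split=> // c u v; rewrite hD; congr (_ + _).
move: u; apply: free_additive_ext => [u u'|u u'|r x].
- by rewrite scalerDr hD.
- by rewrite hD scalerDr.
- by rewrite restrE scalerA !hE scalM (linZ (formK_lift_lin _ cb)).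
Qed.

(* As H^1(B, formKB X) = 0, a balanced form on the syzygy extends to the free
   module covering X.                                                         *)
Lemma formK_onto_syzygy Y X b : hoch0 0 (formKB S Y X) ->
    carrier (formK S Y (ker (cover (scal L) X))) b ->
  exists2 th, carrier (Hom_lmod (ker (cover (scal L) X)) Y) th & formK_of e th = b.
Proof.
move=> zX cb.
have [g gi gb] := hoch0_ker_invar (@scalC _ L) (cover_surj (scal L) (M := X)) zX cb.
have [th [tl _] tg] := formK_onto_free gi.
exists (fun x => th (ker_val _ x)).
  split=> // c x y; rewrite -[RHS](tl c (ker_val _ x) (ker_val _ y)); congr th.
apply/funext => x; apply/funext => t; rewrite -gb -tg /formK_of.
by rewrite linearZ.
Qed.

(** For K = L, restricting K to eL gives the forms of [tor_acyclic], and the kernel has zero right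
    action. *)
Lemma hoch0_formKB_regular Y m : hoch0 m (formKB S Y L^o).
Proof.
pose V := restr (scal L) Y.
have axF := form_bimod_axioms CS (subspaceT V).
pose p (b : L^o -> L -> V) (t y : L) := b (e * y) t.
have pH : bimod_hom (formKB S Y L^o) (form_bimod e iB (fun _ : V => True)) p.
  split=> //=.
  - move=> b [bl bh]; split=> //.
    + by move=> c u v; apply/funext => y; rewrite /p (bh _).1.
    + move=> u c v w; rewrite /p lin_mulr -scalM.
      exact: (congr1 (fun h : L -> V => h u) (bl c (e * v) (e * w))).
    + by move=> u v; rewrite /p (bh _).2 mulrA ee.
  - by move=> a b _; apply/funext => t; apply/funext => y; rewrite /p scale1r.
  - move=> a b _; apply/funext => t; apply/funext => y; rewrite /p.
    by rewrite [iB a *: _]mulrA (iB_e CS) [in RHS]mulrA (e_iB CS).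
have axK := formKB_axioms S Y L^o.
apply: (hoch0_middle axK axF pH _ _ (strat_tor S (subspaceT V) m)).
- move=> b [bl br _ be]; exists (fun y t => b t y).
    split=> [c x y|x].
      apply/funext => t; rewrite -[RHS]br; congr (b t _).
      by rewrite -scalM.
    by split=> [c u v|t]; [rewrite bl|have [] := be t x].
  by apply/funext => t; apply/funext => y; rewrite /p (be _ _).2.
- apply: hoch0_ract0; first exact: kernel_axioms axK axF pH.
  move=> c b [_ pb]; apply/funext => y; apply/funext => t /=.
  have := congr1 (fun h => h t (iB c * y)) pb.
  by rewrite /p mulrA (e_iB CS).
Qed.

Lemma hoch0_formKB_projective Y P m : projective P -> hoch0 m (formKB S Y P).
Proof.
by move=> pP; apply: hoch0_Hom_projective pP (hoch0_formKB_regular _ _); apply: scalC.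
Qed.

Lemma hoch0_Hom_lmod_projective (P Y : lmodType L) m : projective P -> hoch0 m (Hom_lmod P Y).
Proof.
by move=> pP; apply: hoch0_Hom_projective pP (hoch0_hom_regular _ _); apply: scalC.
Qed.

Lemma formK_of_kernel_regular Y th : carrier (kernel (Hom_lmod L^o Y) (formK_of e (K := L^o))) th ->
  forall z, th (iC (pC z)) = th z.
Proof.
move=> [[tl _] t0] z; pose V := restr (scal L) Y.
have tl' : @lin k L V th.
  move=> c u v; rewrite -scalM; exact: (tl c u v).
by apply: (lin_factor S tl') => x y; apply: (congr1 (fun h => h y x) t0).
Qed.

Section BoundedCorner.
Variable b0 : nat.
Hypothesis zB : forall (X Z : lmodType B) m, (b0 <= m)%N -> hoch0 m (Hom_lmod X Z).

(** In 0 -> Hom(C, Y) -> Hom(L, Y) -> [formK] -> 0 the middle term is acyclic and the last is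
    Ext_B(eL, eY). The connecting map costs one degree, hence the strict inequality. *)
Lemma hoch0_HomC_regular Y m : (b0 < m)%N -> hoch0 m (HomC S Y C^o).
Proof.
case: m => // m; rewrite ltnS => bm.
have zF : hoch0 m (formK S Y L^o).
  apply/hoch0_formK; first by move=> n; apply: hoch0_formKB_regular.
  exact: (hoch0_HomB S (eY_axioms S Y) L^o zB (eY_unital S (Y := Y)) bm).
have axH := Hom_lmod_axioms L^o Y; have axF := formK_axioms S Y L^o; have pH := formK_hom S Y L^o.
have axk := kernel_axioms axH axF pH.
have kerE := formK_of_kernel_regular (Y := Y).
have := hoch0_kernel axH axF pH (@formK_onto_regular Y) zF (hoch0_hom_regular _ m.+1).
apply: (@hoch0_hom_retract k L _ _ (kernel (Hom_lmod L^o Y) (formK_of e (K := L^o))) (HomC S Y C^o)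
  (fun phi x => phi (pC x)) (fun th x => th (iC x)) m.+1 axk (HomC_axioms S Y C^o)).
- split=> //=.
  + move=> phi [pl _]; split.
      split=> // c x y; rewrite -[RHS](pl c (pC x) (pC y)); congr phi.
      by rewrite !restrE [scal L c *: _]scalM [scal C c *: _]scalM (pC_lin CS).
    apply/funext => x; apply/funext => t; rewrite /formK_of.
    by rewrite [pC _](pCe0 CS) (klin0 pl).
  + by move=> a phi _; apply/funext => x; rewrite !scale1r.
  + by move=> a phi _; apply/funext => x; congr phi; exact/esym/(pCM CS a x).
- split=> //=.
  + move=> th [[tl _] _]; split=> // c x y.
    rewrite -[RHS](tl c (iC x) (iC y)); congr th.
    by rewrite !restrE [scal L c *: _]scalM [scal C c *: _]scalM (iC_lin CS).
  + by move=> a th _; apply/funext => x; rewrite !scale1r.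
  + move=> a th Kth; apply/funext => x.
    rewrite -[LHS](kerE _ Kth (a * iC x)); rewrite (pCM CS) (iCK CS); done.
- by move=> phi _; apply/funext => x; rewrite (iCK CS).
Qed.

Lemma hoch0_HomC d (X : lmodType C) (P : proj_resolution X) Y m :
    (forall n, (d <= n)%N -> forall x : P n, x = 0) ->
  (b0.+1 + d <= m)%N -> hoch0 m (HomC S Y X).
Proof.
move=> P0; apply: (hoch0_bounded_resolution (@scalC _ C) (P := P)) => // n bn.
exact: hoch0_HomC_regular.
Qed.

Section BoundedCorners.
Variable c0 : nat.
Hypothesis zC : forall Y (X : lmodType C) m, (c0 <= m)%N -> hoch0 m (HomC S Y X).

(* The hypothesis holds when e X has projective dimension at most j over B; it
   then holds with j - 1 for the syzygy of X.                                 *)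
Lemma hoch0_Hom_lmod j (X : lmodType L) :
    (forall Y m, (j <= m)%N -> hoch0 m (formKB S Y X)) ->
  forall Y m, (maxn b0 c0 + j < m)%N -> hoch0 m (Hom_lmod X Y).
Proof.
have gP Z : projective (free_mod (scal L) (restr (scal L) Z)) by apply: free_projective.
have gs Z := cover_surj (scal L) (M := Z).
(* A syzygy is taken even for [j = 0], where the sequence of forms needs it; this accounts for the
   strict inequality. *)
elim: j X => [|j IHj] X zX Y [//|m]; rewrite ltnS ?addn0 => bm; last first.
  apply: (hoch0_kerS (@scalC _ L) (gs X)); last exact: hoch0_Hom_lmod_projective (gP X).
  apply: IHj; last by rewrite -addnS.
  move=> Z n jn; apply: (hoch0_ker (@scalC _ L) (gs X)); last exact: zX.
  exact: hoch0_formKB_projective (gP X).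
apply: (hoch0_kerS (@scalC _ L) (gs X)); last exact: hoch0_Hom_lmod_projective (gP X).
have [bm0 cm] : (b0 <= m)%N /\ (c0 <= m)%N by apply/andP; rewrite -geq_max.
have [Q zQ] := formK_kernel S Y (ker (cover (scal L) X)).
apply: (hoch0_middle (Hom_lmod_axioms _ _) (formK_axioms S _ _) (formK_hom S _ _)).
- by move=> b cb; apply: formK_onto_syzygy cb; apply: zX.
- exact/zQ/zC.
apply/hoch0_formK.
  move=> n; apply: (hoch0_ker (@scalC _ L) (gs X)); last exact: zX.
  exact: hoch0_formKB_projective (gP X).
exact: (hoch0_HomB S (eY_axioms S Y) _ zB (eY_unital S (Y := Y)) bm0).
Qed.
End BoundedCorners.
End BoundedCorner.

Lemma finite_gldim_of_corners : finite_gldim B -> finite_gldim C -> finite_gldim L.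
Proof.
move=> /finite_gldimP[b0 zB] [c0 resC]; apply/finite_gldimP.
(* [b0.+1 + c0.+1] bounds [HomC], resolutions over C being zero from [c0.+1] on; the last [b0] is
   the number [j] of syzygies in [hoch0_Hom_lmod]. *)
exists (maxn b0 (b0.+1 + c0.+1) + b0).+1 => X Y m.
apply: (hoch0_Hom_lmod zB) => [Z W n|Z n bn].
  by have [P P0] := resC W; apply: (hoch0_HomC zB) P0.
exact: (hoch0_HomB S (LeY_axioms S Z) X zB (LeY_unital S (Y := Z)) bn).
Qed.

(* Y is the coinduced module Hom_B(eL, X), for which e Y is X.                *)
Lemma coinduced_module (X : lmodType B) : exists (Y : lmodType L) (h : X -> Y) (q : Y -> X),
  [/\ forall x y, h (x + y) = h x + h y, forall x y, q (x + y) = q x + q y,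
      forall b x, h (b *: x) = iB b *: h x, forall b y, q (iB b *: y) = b *: q y &
      forall x, q (h x) = x].
Proof.
pose D_in (h : L -> X) := (forall u v, h (u + v) = h u + h v) /\ forall b u, h (iB b * u) = b *: h u.
have [D inD actD] : {D : submod_data L (L -> X) | sm_in D = D_in &
    sm_act D = (fun a h u => h (u * a))}.
  unshelve eexists (@SubmodData L (L -> X) D_in (fun a h u => h (u * a)) _ _ _ _ _ _ _) => //.
  - by split=> [u v|b u]; rewrite [LHS]/(0 : X) ?addr0 ?scaler0.
  - move=> g h [gD gB] [hD hB]; split=> [u v|b u].
      by rewrite [LHS]/(g (u + v) - h (u + v)) gD hD opprD addrACA.
    change (g (iB b * u) - h (iB b * u) = b *: (g u - h u)).
    by rewrite gB hB scalerBr.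
  - by move=> a h [hD hB]; split=> [u v|b u]; [rewrite mulrDl hD|rewrite -mulrA hB].
  - by move=> a b h _; apply/funext => u; rewrite mulrA.
  - by move=> h _; apply/funext => u; rewrite mulr1.
  - by move=> a b h [hD _]; apply/funext => u; rewrite mulrDr hD.
have hP x : sm_in D (fun u => pB u *: x).
  rewrite inD; split=> [u v|b u]; first by rewrite (linD (pB_lin CS)) scalerDl.
  rewrite scalerA; congr (_ *: x); apply: (can_inj (iBK CS)).
  by rewrite (iB_mul CS) !(pBK CS) !mulrA (e_iB CS) (iB_e CS).
exists (submod D), (fun x => sm_mk (hP x)), (fun y => sm_val y 1); split.
- by move=> x y; apply: sm_val_inj; apply/funext => u; apply: scalerDr.
- by [].
- move=> b x; apply: sm_val_inj; rewrite sm_valZ actD; apply/funext => u /=.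
  rewrite scalerA; congr (_ *: x); apply: (can_inj (iBK CS)).
  by rewrite (iB_mul CS) !(pBK CS) -!mulrA (e_iB CS) (iB_e CS).
- move=> b y; have := sm_valP y; rewrite inD => -[_ yB].
  by rewrite sm_valZ actD mul1r -[iB b](iB_e CS) yB -(iB1 CS) -[iB 1]mulr1 yB scale1r.
- by move=> x; rewrite /= (pB1 CS) scale1r.
Qed.

(** The sequence of forms for L bounds Ext_B(eL, eY), and coinduction replaces eY by an arbitrary
    B-module Y0. Resolving over L the module X' coinduced from X then bounds Ext_B(eX', Y0), of
    which Ext_B(X, Y0) is a retract. *)
Lemma finite_gldim_B : finite_gldim L -> finite_gldim B.
Proof.
move=> gL; have /finite_gldimP[d zL] := gL; have [d' resL] := gL.
have zE Y m : (d <= m)%N -> hoch0 m (HomB S (eY_axioms S Y) L^o).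
  move=> dm; apply/hoch0_formK; first by move=> n; apply: hoch0_formKB_regular.
  have [Q zQ] := formK_kernel S Y L^o.
  apply: (hoch0_cokernel (Hom_lmod_axioms _ _) (formK_axioms S _ _) (formK_hom S _ _)).
  - exact: formK_onto_regular.
  - exact: hoch0_hom_regular.
  - apply/zQ/hoch0_restr/zL; exact: leqW.
have scalB (Y : lmodType L) c (y : Y) : iB (scal B c) *: y = scal L c *: (iB 1 *: y).
  by rewrite scalerA scalM -(linZ (iB_lin CS)).
(* [d] serves the regular L-module, [d'.+1] the length of the resolution of [X']. *)
apply/finite_gldimP; exists (d + d'.+1)%N => X Y0 m dm.
pose axY := lmod_bimod_axioms Y0.
have zR n : (d <= n)%N -> hoch0 n (HomB S axY L^o).
  have [Y [h [q [hD qD hB qB qh]]]] := coinduced_module Y0.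
  have hS c y : h (scal B c *: y) = scal L c *: h y.
    by rewrite hB scalB -hB scale1r.
  have qS c y : q (scal L c *: y) = scal B c *: q y.
    by rewrite -[LHS]scale1r -qB scalerA -scalC -scalerA -scalB qB.
  move=> dn; apply: (@hoch0_hom_retract k B _ _ (HomB S (eY_axioms S Y) L^o) (HomB S axY L^o)
    (fun phi u => h (phi u)) (fun psi u => q (psi u)) n (HomB_axioms _ _ _) (HomB_axioms _ _ _) _ _ _ (zE Y n dn)).
  - split=> //=.
    + move=> phi [pl _]; split=> [c u v|u]; last by rewrite -(iB1 CS) -hB scale1r.
      by rewrite pl hD restrE hS.
    + move=> c phi psi _ _; apply/funext => u.
      change (h (scal B c *: (phi u : Y0) + psi u) = scal L c *: h (phi u) + h (psi u)).
      by rewrite hD hS.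
    + by move=> a phi _; apply/funext => u; rewrite hB.
  - split=> //=.
    + by move=> psi [pl _]; split=> // c u v; rewrite pl qD restrE qS.
    + move=> c phi psi _ _; apply/funext => u.
      change (q (scal L c *: (phi u : Y) + psi u) = scal B c *: q (phi u) + q (psi u)).
      by rewrite qD qS.
    + by move=> a psi _; apply/funext => u; rewrite qB.
  - by move=> phi _; apply/funext => u; apply: qh.
have [X' [h [q [hD qD hB qB qh]]]] := coinduced_module X.
have hS c y : h (scal B c *: y) = scal L c *: h y.
  by rewrite hB scalB -hB scale1r.
have qS c y : q (scal L c *: y) = scal B c *: q y.
  by rewrite -[LHS]scale1r -qB scalerA -scalC -scalerA -scalB qB.
have [P P0] := resL X'.
have zX' := hoch0_bounded_resolution (@scalC _ L) zR P0 dm.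
apply: (@hoch0_hom_retract k B _ _ (HomB S axY X') (Hom_lmod X Y0)
  (fun phi x => phi (q x)) (fun psi x => psi (h x)) m (HomB_axioms _ _ _) (Hom_lmod_axioms _ _) _ _ _ zX').
- split=> //=.
  + move=> phi [pl _]; split=> // c u v; rewrite -[RHS](pl c (q u) (q v)).
    by congr phi; rewrite qD restrE qS.
  + by move=> a phi _; apply/funext => u; rewrite !scale1r.
  + by move=> a phi _; apply/funext => u; rewrite qB.
- split=> //=.
  + move=> psi [pl _]; split=> // c u v; rewrite -[RHS](pl c (h u) (h v)).
    by congr psi; rewrite hD restrE hS.
  + by move=> a phi _; apply/funext => u; rewrite !scale1r.
  + by move=> a psi _; apply/funext => u; rewrite hB.
- by move=> phi _; apply/funext => x; rewrite qh.
Qed.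

Lemma finite_gldim_stratified : finite_gldim L <-> finite_gldim B /\ finite_gldim C.
Proof.
split=> [gL|[gB gC]]; last exact: finite_gldim_of_corners.
by split; [exact: finite_gldim_B|exact: finite_gldim_C S gL].
Qed.
End CornersGlobalDimension.

Lemma balanced_eq0 (R : pzRingType) (M : lmodType R^c) (N : lmodType R) (G : zmodType)
    (phi : M -> N -> G) :
    (forall x : tensmod M N, x = 0) ->
    (forall m m' n, phi (m + m') n = phi m n + phi m' n) ->
    (forall m n n', phi m (n + n') = phi m n + phi m n') ->
    (forall (r : R) m n, phi ((r : R^c) *: m) n = phi m (r *: n)) ->
  forall m n, phi m n = 0.
Proof.
move=> MN0 phiDl phiDr phiZ m n.
have liftE s := tens_liftE s phiDl phiDr phiZ.
have := congr1 (tens_lift phi) (MN0 (tens_cls _ _ [:: (m, n)])).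
by rewrite [0](_ : 0 = tens_cls _ _ [::]) // !liftE big_seq1 big_nil.
Qed.

(** * The two stratified algebras *)

Section CornerAlgebras.
Variables (k : fieldType) (L : fdAlg k) (e : idem L).

Fact to_peirce_subproof (g h x : L) : g * x * h \in peirce_space g h.
Proof. by apply/peirce_spaceP; exists x. Qed.
Definition to_peirce (g h x : L) : peirce g h := Subvs (to_peirce_subproof g h x).

Definition corner_in (g : idem L) (x : corner g) : L := vsval (x : peirce g g).
Definition corner_out (g : idem L) (x : L) : corner g := to_peirce g g x.

Lemma corner_in_lin g : lin (@corner_in g).
Proof. by move=> c x y; apply: linearP. Qed.

Lemma corner_out_lin g : lin (@corner_out g).
Proof.
move=> c x y; apply: val_inj.
by rewrite [RHS](corner_in_lin c) /= mulrDr mulrDl -fdscaleAr -fdscaleAl.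
Qed.

Lemma corner_inK g : cancel (@corner_in g) (@corner_out g).
Proof. by move=> x; apply: val_inj; rewrite /= [X in X * _]peirce_idl [LHS]peirce_idr. Qed.

Hypothesis he : strongly_stratifying e.
Let f := idemC e.

Lemma corner_product0 (m : rpeirce f e) (n : lpeirce e f) : (vsval m * vsval n : L) = 0.
Proof.
have [_ fef _] := he; move: m n.
apply: (balanced_eq0 (phi := fun (m : rpeirce f e) (n : lpeirce e f) => vsval m * vsval n : L) fef).
- by move=> m m' n; apply: mulrDl.
- by move=> m n n'; apply: mulrDr.
- by move=> c m n; apply/esym/mulrA.
Qed.

Lemma peirce_corners : corners e (@corner_in e) (corner_out e) (@corner_in f) (corner_out f).
Proof.
split; try exact: corner_in_lin; try exact: corner_out_lin; try exact: corner_inK; try by [].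
- exact: idemP.
- move=> x y; have := corner_product0 (to_peirce f e x) (to_peirce e f y).
  by rewrite /= !mulrA -[_ * (e : L) * (e : L)]mulrA idemP.
Qed.

Lemma corner_form_trivial : form_trivial e (@corner_in e).
Proof.
have [_ fef _] := he; move=> V b [[bl br _ be] bi] x y.
have bal (c : corner e) u v : b (u * corner_in c) v = b u (corner_in c * v).
  by have := congr1 (fun h => h u v) (bi c).
have -> : b ((1 - (e : L)) * x) (y * (1 - (e : L))) = b (vsval (to_peirce f e x)) (vsval (to_peirce e f y)).
  by rewrite /= (be _ _).1 -mulrA (be _ _).2.
move: (to_peirce f e x) (to_peirce e f y).
apply: (balanced_eq0 (phi := fun (m : rpeirce f e) (n : lpeirce e f) => b (vsval m) (vsval n)) fef).
- by move=> m m' n; rewrite -[RHS]/((b (vsval m) + b (vsval m')) (vsval n)) -(linD bl).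
- by move=> m n n'; rewrite -(linD (br _)).
- by move=> c m n; apply: bal.
Qed.

(** Forms on the modules Le and eL are matched with forms on L x L: restrict in one direction,
    compose with x |-> xe and y |-> ey in the other. *)
Lemma corner_tor_acyclic : tor_acyclic e (@corner_in e).
Proof.
have [tor _ _] := he; move=> V Q sQ n.
have axF := Form_axioms (rpeirce (idem1 L) e) (lpeirce e (idem1 L)) sQ.
have axB := form_bimod_axioms peirce_corners sQ.
have ee := idemP e.
have scalr c (w : rpeirce (idem1 L) e) : vsval (scalop (corner e) c *: w) = c *: vsval w.
  exact: etrans (esym (@fdscaleAr _ L c (vsval w) e)) (congr1 _ (peirce_idr w)).
have scall c (v : lpeirce e (idem1 L)) : vsval (scal (corner e) c *: v) = c *: vsval v.
  exact: etrans (esym (@fdscaleAl _ L c e (vsval v))) (congr1 _ (peirce_idl v)).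
have ea (a : corner e) : (e : L) * corner_in a = corner_in a by apply: peirce_idl.
have ae (a : corner e) : corner_in a * (e : L) = corner_in a by apply: peirce_idr.
have := tor_hoch0 sQ (fun n => tor n.+1 isT) n.
apply: (hoch0_hom_retract axF axB
  (j := fun b (w : rpeirce (idem1 L) e) (v : lpeirce e (idem1 L)) => b (vsval w) (vsval v))
  (q := fun phi (x y : L) => phi (to_peirce (idem1 L) e x) (to_peirce e (idem1 L) y))).
- split=> //=.
  + move=> b [bl br bQ be]; split=> [c w w'|w].
      by apply/funext => v; rewrite -[RHS]/((c *: b (vsval w) + b (vsval w')) (vsval v)) -bl -scalr.
    by split=> // c v v'; rewrite -br -scall.
  + by move=> c b _; apply/funext => w; apply/funext => v; rewrite peirce_idr.
- split=> //=.
  + move=> phi [pl pP]; split=> //.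
    + move=> c x y; apply/funext => z.
      rewrite -[RHS]/((c *: phi (to_peirce (idem1 L) e x) + phi (to_peirce (idem1 L) e y)) _) -pl.
      congr (phi _ _); apply: val_inj.
      rewrite [RHS]/(vsval (scalop (corner e) c *: (to_peirce (idem1 L) e x : rpeirce (idem1 L) e)) + (1 : L) * y * (e : L)).
      by rewrite scalr /= mulrDr mulrDl -fdscaleAr -fdscaleAl.
    + move=> x c y z; have [ql _] := pP (to_peirce (idem1 L) e x); rewrite -ql.
      congr (phi _ _); apply: val_inj.
      rewrite [RHS]/(vsval (scal (corner e) c *: (to_peirce e (idem1 L) y : lpeirce e (idem1 L))) + (e : L) * z * (1 : L)).
      by rewrite scall /= mulrDr mulrDl -fdscaleAr -fdscaleAl.
    + by move=> x y; have [_ pQ] := pP (to_peirce (idem1 L) e x).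
    + move=> x y; split; congr (phi _ _); apply: val_inj; rewrite /= !mulrA ?ee //.
      by rewrite -mulrA ee.
  + move=> a phi _; apply/funext => x; apply/funext => y; congr (phi _ _); apply: val_inj.
    have h : 1 * x * (e : L) * corner_in a = 1 * (x * corner_in a) * (e : L) by rewrite -!mulrA ea ae.
    exact: h.
  + move=> a phi _; apply/funext => x; apply/funext => y; rewrite scale1r; congr (phi _ _); apply: val_inj.
    have h : corner_in a * ((e : L) * y * 1) = (e : L) * (corner_in a * y) * 1 by rewrite !mulrA ea ae.
    exact: h.
- move=> b [_ _ _ be]; apply/funext => x; apply/funext => y /=.
  by rewrite mul1r mulr1 (be _ _).1 (be _ _).2.
Qed.

Lemma stratified_corner :
  stratified e (@corner_in e) (corner_out e) (@corner_in f) (corner_out f).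
Proof. by split; [exact: peirce_corners|exact: corner_tor_acyclic|exact: corner_form_trivial]. Qed.
End CornerAlgebras.

(** * The product of the two corners *)

Section ProductStratified.
Variables (k : fieldType) (B C : fdAlg k).
Let L := prod_alg B C.
Let e : L := (1, 0).
Let iB (b : B) : L := (b, 0).
Let iC (c : C) : L := (0, c).
Let pB (x : L) : B := x.1.
Let pC (x : L) : C := x.2.

Let pair_ext (x y : L) : x.1 = y.1 -> x.2 = y.2 -> x = y.
Proof. by case: x y => [x1 x2] [y1 y2] /= -> ->. Qed.

Lemma product_corners : corners e iB pB iC pC.
Proof.
have fE : 1 - e = (0, 1) by apply: pair_ext; rewrite /= ?subrr ?subr0.
split; rewrite ?fE //.
- by apply: pair_ext; rewrite /= ?mulr1 ?mulr0.
- by move=> c x y; apply: pair_ext; rewrite /= ?scaler0 ?addr0.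
- by move=> x y; apply: pair_ext; rewrite /= ?mulr0.
- by move=> [x y]; apply: pair_ext; rewrite /= ?mulr1 ?mul1r ?mulr0.
- by move=> c x y; apply: pair_ext; rewrite /= ?scaler0 ?addr0.
- by move=> x y; apply: pair_ext; rewrite /= ?mulr0.
- by move=> [x y]; apply: pair_ext; rewrite /= ?mulr1 ?mul1r ?mulr0.
- by move=> [x y] [x' y']; apply: pair_ext; rewrite /= ?(mulr0, mul0r).
Qed.

(** Here e is central and Le = eL = B x 0, so the forms are coinduced over B, and fxe = 0 makes the
    mixed values of a form vanish. *)
Lemma stratified_product : stratified e iB pB iC pC.
Proof.
have CS := product_corners; have fE : 1 - e = (0, 1) by apply: pair_ext; rewrite /= ?subrr ?subr0.
have eE (x : L) : x * e = iB x.1 by apply: pair_ext; rewrite /= ?mulr1 ?mulr0.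
have eEr (x : L) : e * x = iB x.1 by apply: pair_ext; rewrite /= ?mul1r ?mul0r.
split=> //.
- move=> V Q sQ n; apply: hoch0_lcoinduced; first exact (form_bimod_axioms CS sQ).
  exists (fun psi x y => psi x.1 e y); split=> /=.
  + move=> psi [pl pF]; split.
    * by move=> c x y; apply/funext => z; rewrite [(_ + _).1]/(c *: x.1 + y.1) pl.
    * by move=> x; have [_ ] := pF x.1.
    * by move=> x y; have [_ _] := pF x.1.
    * move=> x y; have [_ _ _ be] := pF x.1; split; last by have [_] := be e y.
      by rewrite eE.
  + by [].
  + move=> b [_ _ _ be]; apply/funext => x; apply/funext => y.
    by rewrite -[RHS](be x y).1 eE (_ : e * iB x.1 = iB x.1) // eEr.
  + by move=> a psi _; apply/funext => x; apply/funext => y.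
  + by [].
- move=> V b [[bl br _ be] bi] x y.
  rewrite -(be _ _).1 (_ : _ * e = 0) ?(lin0 bl) // fE.
  by apply: pair_ext; rewrite /= ?mul0r ?mulr0.
Qed.
End ProductStratified.

Theorem theorem5p1 (k : fieldType) (L : fdAlg k) (e : idem L)
    (he : strongly_stratifying e) :
  Han L <-> Han (prod_alg (corner e) (corner (idemC e))).
Proof.
have SL := stratified_corner he.
have SP := stratified_product (corner e) (corner (idemC e)).
split=> han hh.
  apply/(finite_gldim_stratified SP)/(finite_gldim_stratified SL)/han.
  exact/(HH_finite_stratified SL)/(HH_finite_stratified SP).
apply/(finite_gldim_stratified SL)/(finite_gldim_stratified SP)/han.
exact/(HH_finite_stratified SP)/(HH_finite_stratified SL).
Qed.
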